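(* Let $m\ge1$ be an integer, $\alpha\in(0,1)$, $k\in\{1,\dots,6\}$ and $s\in[-1,0]$. There exists $\theta_0\in(\frac{\pi}{2},\pi)$ (depending on $k$) such that for every $\theta\in(\frac{\pi}{2},\theta_0)$ the following holds. For $u^0\in\dot H^s(\Omega)$ let $$u_h^r(t)=\frac{(-1)^m}{2\pi \mathrm{i}}\int_{\Gamma_{\theta,\kappa}}e^{zt}z^{(1+m)\alpha-1}(z^\alpha+A_h)^{-1}A_h^{-m}P_hu^0\,\mathrm{d}z,\qquad t>0,$$ $$U_h^{n,r}=\frac{(-1)^m}{2\pi \mathrm{i}}\int_{\Gamma^\tau_{\theta,\kappa}}e^{zt_n}\delta_\tau(e^{-z\tau})^{(1+m)\alpha-1}\big(\delta_\tau(e^{-z\tau})^\alpha+A_h\big)^{-1}A_h^{-m}P_hu^0\,\mathrm{d}z .$$ Then there is a constant $c$, independent of $h$, $\tau$, $n$ and $u^0$, such that for all $1\le n\le N$ $$\|U_h^{n,r}-u_h^r(t_n)\|_{L^2(\Omega)}\le c\,\tau^k\,t_n^{-k-m\alpha}\,\|u^0\|_{\dot H^s(\Omega)} .$$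
   Context: $\Omega\subset\mathbb{R}^d$ ($d\ge1$) is a bounded convex polygonal/polyhedral domain and $A=-\Delta:H^2(\Omega)\cap H^1_0(\Omega)\to L^2(\Omega)$ with eigenvalues $\lambda_j$ and $L^2(\Omega)$-orthonormal eigenfunctions $\varphi_j$. For $s\ge0$, $\dot H^s(\Omega)$ is the Hilbert space with norm $\|v\|_{\dot H^s(\Omega)}^2=\sum_j\lambda_j^s\langle v,\varphi_j\rangle^2$; for $s<0$, $\dot H^s(\Omega)$ is the dual of $\dot H^{-s}(\Omega)$. $\Omega$ is partitioned into a family $\mathcal{K}_h$ of shape-regular, locally quasi-uniform triangles (simplices) of mesh size $h=\max_{K}\mathrm{diam}(K)$, and $X_h=\{v_h\in H^1_0(\Omega):v_h|_K\in\mathbb{P}_{2m+1}\ \forall K\in\mathcal{K}_h\}$. $P_h$ is the $L^2$-projection onto $X_h$, $(P_h\psi,\chi)=(\psi,\chi)$ for all $\chi\in X_h$ (with the duality pairing on the right-hand side for $\psi\in\dot H^s(\Omega)$, $s\in[-1,0)$), and $A_h:X_h\to X_h$ is given by $(A_h\psi,\chi)=(\nabla\psi,\nabla\chi)$ for all $\psi,\chi\in X_h$. Time grid: $t_n=n\tau$, $n=0,\dots,N$, $\tau=T/N$, $T>0$ fixed, $N\in\mathbb{N}$. The BDF$k$ generating function is $\delta_\tau(\zeta)=\delta(\zeta)/\tau$ with $\delta(\zeta)=\sum_{j=1}^k\frac1j(1-\zeta)^j$. Contours: $\Gamma_{\theta,\kappa}=\{|z|=\kappa,\ |\arg z|\le\theta\}\cup\{z=\rho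 e^{\pm\mathrm{i}\theta}:\rho\ge\kappa\}$ and $\Gamma^\tau_{\theta,\kappa}=\{z\in\Gamma_{\theta,\kappa}:|\Im z|\le\pi/\tau\}$, both oriented with increasing imaginary part, with $0<\kappa\le1/\tau$ (the values of the integrals do not depend on $\kappa$ in this range). Fractional powers are principal branches. *)

(* Defs.v *)
From HB Require Import structures.
From mathcomp Require Import all_boot all_order all_algebra.
From mathcomp Require Import all_classical all_reals all_analysis.
From mathcomp Require Import complex.

Set Implicit Arguments.
Unset Strict Implicit.
Unset Printing Implicit Defensive.
Import Order.TTheory GRing.Theory Num.Theory.
Import numFieldNormedType.Exports.
Local Open Scope classical_set_scope.
Local Open Scope ring_scope.

Definition rv_display : measure_display.
Proof. exact: default_measure_display. Qed.

(* 'rV[R]_n carries the sigma-algebra generated by the coordinates *)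
Section rv_measurable.
Context {R : realType} (n : nat).

Definition coord_sets : set (set 'rV[R]_n) :=
  \bigcup_(j in [set: 'I_n])
    preimage_set_system setT (fun v : 'rV[R]_n => v 0 j : measurableTypeR R)
      measurable.

Let rv_set0 : <<s coord_sets >> set0. Proof. exact: sigma_algebra0. Qed.
Let rv_setC A : <<s coord_sets >> A -> <<s coord_sets >> (~` A).
Proof. exact: sigma_algebraC. Qed.
Let rv_bigcup (F : (set 'rV[R]_n)^nat) : (forall i, <<s coord_sets >> (F i)) ->
  <<s coord_sets >> (\bigcup_i F i).
Proof. exact: sigma_algebra_bigcup. Qed.

HB.instance Definition _ := @isMeasurable.Build rv_display
  'rV[R]_n <<s coord_sets >> rv_set0 rv_setC rv_bigcup.
End rv_measurable.

Section lebesgue_rv_step.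
Context {R : realType} (n : nat).

Definition rv_cons (p : measurableTypeR R * 'rV[R]_n) : 'rV[R]_n.+1 :=
  row_mx (p.1 : R)%:M p.2.

Definition rv_uncons (v : 'rV[R]_n.+1) : measurableTypeR R * 'rV[R]_n :=
  (v 0 0, rsubmx (v : 'rV_(1 + n))).

Lemma measurable_coord k (j : 'I_k) :
  measurable_fun setT (fun v : 'rV[R]_k => v 0 j : measurableTypeR R).
Proof.
by move=> _ Y mY; apply: sub_sigma_algebra; exists j => //; exists Y.
Qed.

Lemma measurable_rvP d (T : measurableType d) k (f : T -> 'rV[R]_k) :
  (forall j, measurable_fun setT (fun x => f x 0 j : measurableTypeR R)) ->
  measurable_fun setT f.
Proof.
move=> mf; apply: (@measurability _ _ _ _ _ _ (@coord_sets R k)) => //.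
move=> _ [_ [j _ [Y mY <-]] <-].
by have := mf j measurableT Y mY; rewrite !setTI.
Qed.

Lemma measurable_rv_cons : measurable_fun setT rv_cons.
Proof.
apply: measurable_rvP => j; rewrite /rv_cons.
case: (split_ordP (j : 'I_(1 + n))) => i ->.
  under eq_fun do rewrite (row_mxEl (_ : 'rV_1)) mxE ord1 eqxx mulr1n.
  exact: measurable_fst.
under eq_fun do rewrite (row_mxEr (_ : 'rV_1)).
exact: measurableT_comp (measurable_coord i) measurable_snd.
Qed.

Lemma measurable_rv_uncons : measurable_fun setT rv_uncons.
Proof.
apply/measurable_fun_pairP; split; first exact: measurable_coord.
apply: measurable_rvP => j; under eq_fun do rewrite /= mxE.
exact: measurable_coord.
Qed.

Lemma rv_consK : cancel rv_cons rv_uncons.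
Proof.
move=> [x v]; rewrite /rv_uncons /rv_cons /= row_mxKr; congr pair.
have -> : (0 : 'I_n.+1) = lshift n (0 : 'I_1) by exact: val_inj.
by apply: etrans (row_mxEl _ _ _ _) _; rewrite mxE eqxx mulr1n.
Qed.

Definition lebesgue_rvS (mu : {sigma_finite_measure set 'rV[R]_n -> \bar R}) :
  set 'rV[R]_n.+1 -> \bar R :=
  pushforward (@lebesgue_measure R \x mu)%E rv_cons.

Section instances.
Variable mu : {sigma_finite_measure set 'rV[R]_n -> \bar R}.
Local Open Scope ereal_scope.

Let rvS0 : lebesgue_rvS mu set0 = 0.
Proof. by rewrite /lebesgue_rvS /pushforward preimage_set0 measure0. Qed.

Let rvS_ge0 A : 0 <= lebesgue_rvS mu A.
Proof. exact: (measure_ge0 (@lebesgue_measure R \x mu)). Qed.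

Let rvS_semi_sigma_additive : semi_sigma_additive (lebesgue_rvS mu).
Proof.
move=> F mF tF mU; rewrite /lebesgue_rvS /pushforward preimage_bigcup.
have mF' i : measurable (rv_cons @^-1` F i).
  by rewrite -[X in measurable X]setTI; exact: measurable_rv_cons.
apply: (@measure_semi_sigma_additive _ _ _ (@lebesgue_measure R \x mu)
  (fun i => rv_cons @^-1` F i)) => //.
- apply/trivIsetP => /= i j _ _ ij; rewrite -preimage_setI.
  by move/trivIsetP : tF => /(_ _ _ _ _ ij) ->//; rewrite preimage_set0.
- exact: bigcup_measurable.
Qed.

HB.instance Definition _ := isMeasure.Build _ _ _ (lebesgue_rvS mu)
  rvS0 rvS_ge0 rvS_semi_sigma_additive.

Let rvS_sigma_finite : sigma_finite setT (lebesgue_rvS mu).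
Proof.
have [F TF mF] : sigma_finite setT (@lebesgue_measure R \x mu).
  have /sigma_finiteP[F [TF ndF Foo]] := sigma_finiteT (@lebesgue_measure R).
  have /sigma_finiteP[G [TG ndG Goo]] := sigma_finiteT mu.
  exists (fun n => F n `*` G n).
    rewrite -setXTT TF TG predeqE => -[x y]; split.
      move=> [/= [i _ Fix] [k _ Gky]]; exists (maxn i k) => //; split.
      - by move: x Fix; exact/subsetPset/ndF/leq_maxl.
      - by move: y Gky; exact/subsetPset/ndG/leq_maxr.
    by move=> [i _ []/= ? ?]; split; exists i.
  move=> k; have [? ?] := Foo k; have [? ?] := Goo k.
  split; first exact: measurableX.
  by rewrite product_measure1E// lte_mul_pinfty// ge0_fin_numE.
exists (fun i => rv_uncons @^-1` F i).
  by rewrite -preimage_bigcup -TF preimage_setT.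
move=> i; split.
  rewrite -[X in measurable X]setTI; apply: measurable_rv_uncons => //.
  exact: (mF i).1.
rewrite /lebesgue_rvS /pushforward -comp_preimage.
rewrite (_ : rv_uncons \o rv_cons = id); last exact/funext/rv_consK.
exact: (mF i).2.
Qed.

HB.instance Definition _ := Measure_isSigmaFinite.Build _ _ _ (lebesgue_rvS mu)
  rvS_sigma_finite.
End instances.
End lebesgue_rv_step.

(* Lebesgue measure on R^n, as an iterated product along rv_cons *)
Fixpoint lebesgue_rv {R : realType} (n : nat) :
    {sigma_finite_measure set 'rV[R]_n -> \bar R} :=
  match n with
  | 0 => dirac (0 : 'rV[R]_0)
  | n'.+1 => lebesgue_rvS (lebesgue_rv n')
  end.

(* In what follows a function on a domain Om is a function on R^d of which only
   the values on Om matter, and elements of L^2, H^1, X_h are represented by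
   such functions up to equality almost everywhere on Om. *)

Section geometry.
Context {R : realType} {d : nat}.
Implicit Types (x y : 'rV[R]_d) (Om A : set 'rV[R]_d).

Definition edot x y : R := \sum_i x 0 i * y 0 i.
(* the norm of the normedModType 'rV[R]_d is the sup norm *)
Definition enorm x : R := Num.sqrt (edot x x).

Definition convex_polyhedral_domain Om :=
  [/\ Om !=set0, bounded_set Om &
   exists p (a : 'I_p -> 'rV[R]_d) (b : 'I_p -> R),
     Om = [set x | forall i, edot (a i) x < b i]].

Definition simplex (p : 'I_d.+1 -> 'rV[R]_d) : set 'rV[R]_d :=
  [set x | exists c : 'I_d.+1 -> R,
    [/\ forall i, 0 <= c i, \sum_i c i = 1 & x = \sum_i c i *: p i]].

Definition affinely_independent (p : 'I_d.+1 -> 'rV[R]_d) :=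
  forall c : 'I_d.+1 -> R,
    \sum_i c i = 0 -> \sum_i c i *: p i = 0 -> forall i, c i = 0.

Definition diameter A : R := sup [set enorm (x - y) | x in A & y in A].

Definition inradius A : R :=
  sup [set r | 0 <= r /\ exists x, forall y, enorm (y - x) <= r -> A y].

(* a mesh is given by the vertices of its simplices *)
Definition mesh (nK : nat) := 'I_nK -> 'I_d.+1 -> 'rV[R]_d.

Definition partitions nK (K : mesh nK) Om :=
  [/\ forall k, affinely_independent (K k),
      closure Om = \bigcup_k simplex (K k) &
      forall k l, k != l ->
        interior (simplex (K k)) `&` interior (simplex (K l)) = set0].

Definition shape_regular (sigma : R) nK (K : mesh nK) :=
  forall k, diameter (simplex (K k)) <= sigma * inradius (simplex (K k)).

Definition locally_quasi_uniform (sigma : R) nK (K : mesh nK) :=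
  forall k l, simplex (K k) `&` simplex (K l) !=set0 ->
    diameter (simplex (K k)) <= sigma * diameter (simplex (K l)).

End geometry.

Section function_spaces.
Context {R : realType} {d : nat} (Om : set 'rV[R]_d).
Implicit Types (u v f g : 'rV[R]_d -> R).
Local Notation mu := (@lebesgue_rv R d).

Definition aeOm (P : 'rV[R]_d -> Prop) := {ae mu, forall x, Om x -> P x}.

Definition L2 f :=
  measurable_fun Om f /\ mu.-integrable Om (fun x => (f x ^+ 2)%:E).

Definition ip f g : R := \int[mu]_(x in Om) (f x * g x).

Definition L2norm f : R := Num.sqrt (ip f f).

Definition partial (i : 'I_d) f : 'rV[R]_d -> R :=
  fun x => 'D_(delta_mx 0 i : 'rV[R]_d) f x.

Definition smooth f := forall s : seq 'I_d,
  continuous (foldr partial f s) /\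
  forall i x, derivable (foldr partial f s) x (delta_mx 0 i : 'rV[R]_d).

Definition test_function f :=
  smooth f /\ exists2 C, compact C & C `<=` Om /\ forall x, ~ C x -> f x = 0.

Definition weak_partial (i : 'I_d) u g :=
  forall f, test_function f -> ip u (partial i f) = - ip g f.

(* a representative in L^2 of the weak derivative (0 if there is none) *)
Definition wpartial (i : 'I_d) u : 'rV[R]_d -> R :=
  xget (fun=> 0) [set g | L2 g /\ weak_partial i u g].

Definition H1 u :=
  L2 u /\ forall i, exists g, L2 g /\ weak_partial i u g.

Definition grad_ip u v : R := \sum_i ip (wpartial i u) (wpartial i v).

Definition H1norm u : R := Num.sqrt (ip u u + grad_ip u u).

Definition H10 u :=
  H1 u /\ forall e : R, 0 < e ->
    exists2 f, test_function f & H1norm (u \- f) < e.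

Definition H2 u := H1 u /\ forall i, H1 (wpartial i u).

Definition laplacian u : 'rV[R]_d -> R :=
  fun x => \sum_i wpartial i (wpartial i u) x.

(* eigenvalues and an orthonormal basis of L^2 of eigenfunctions of
   A = - Laplacian with domain H^2 and H^1_0 *)
Definition dirichlet_eigensystem (lam : nat -> R)
    (phi : nat -> 'rV[R]_d -> R) :=
  [/\ forall j, H2 (phi j) /\ H10 (phi j),
      forall j, aeOm (fun x => - laplacian (phi j) x = lam j * phi j x),
      forall i j, ip (phi i) (phi j) = (i == j)%:R &
      forall v, L2 v ->
        (fun J => L2norm (v \- (fun x => \sum_(j < J) ip v (phi j) * phi j x)))
          @ \oo --> (0 : R)].

End function_spaces.

Section hdot.
Context {R : realType} {d : nat} (Om : set 'rV[R]_d).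
Variables (lam : nat -> R) (phi : nat -> 'rV[R]_d -> R).
Local Notation fct := ('rV[R]_d -> R).

Definition hdot_sqnorm (s : R) (v : fct) : \bar R :=
  (\sum_(0 <= j <oo) (lam j `^ s * ip Om v (phi j) ^+ 2)%:E)%E.

Definition hdot_fun (s : R) (v : fct) :=
  L2 Om v /\ (hdot_sqnorm s v < +oo)%E.

Definition hdot_fun_norm (s : R) (v : fct) : R :=
  Num.sqrt (fine (hdot_sqnorm s v)).

Definition hdot_dual (s : R) (l : fct -> R) :=
  (forall a v w, hdot_fun s v -> hdot_fun s w ->
    l (fun x => a * v x + w x) = a * l v + l w) /\
  (exists M, forall v, hdot_fun s v -> `|l v| <= M * hdot_fun_norm s v).

Definition hdot_dual_norm (s : R) (l : fct -> R) : R :=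
  sup [set `|l v| | v in [set v | hdot_fun s v /\ hdot_fun_norm s v <= 1]].

(* an element of the space of index s is a function if 0 <= s, and a
   functional on the space of index - s if s < 0 *)
Variant hdot_elt := HdotFun of fct | HdotDual of (fct -> R).

Definition hdot (s : R) (u : hdot_elt) :=
  match u with
  | HdotFun v => 0 <= s /\ hdot_fun s v
  | HdotDual l => s < 0 /\ hdot_dual (- s) l
  end.

Definition hdot_norm (s : R) (u : hdot_elt) : R :=
  match u with
  | HdotFun v => hdot_fun_norm s v
  | HdotDual l => hdot_dual_norm (- s) l
  end.

Definition pairing (u : hdot_elt) (v : fct) : R :=
  match u with
  | HdotFun w => ip Om w v
  | HdotDual l => l v
  end.

End hdot.
Arguments HdotFun {R d}.
Arguments HdotDual {R d}.

Section complex_functions.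
Context {R : realType}.
Local Notation Re := (@complex.Re R).
Local Notation Im := (@complex.Im R).
Implicit Types z : R[i].

Definition cis (t : R) : R[i] := (cos t +i* sin t)%C.

Definition cexp z : R[i] := (expR (Re z))%:C%C * cis (Im z).

(* principal argument, in ]-pi, pi] for z != 0 *)
Definition carg z : R :=
  if 0 <= Im z then acos (Re z / Normc.normc z)
  else - acos (Re z / Normc.normc z).

(* principal branch *)
Definition cpow z (a : R) : R[i] :=
  (Normc.normc z `^ a)%:C%C * cis (a * carg z).

Definition bdf (k : nat) (tau : R) z : R[i] :=
  (tau^-1)%:C%C * \sum_(1 <= j < k.+1) j%:R^-1 * (1 - z) ^+ j.

Definition Cintegral (D : set R) (g : R -> R[i]) : R[i] :=
  (\int[@lebesgue_measure R]_(r in D) Re (g r) +i*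
   \int[@lebesgue_measure R]_(r in D) Im (g r))%C.

(* integral of g over the part of Gamma_(theta, kappa) contained in D:
   outgoing upper ray, incoming lower ray, arc *)
Definition contour_integral (theta kappa : R) (D : set R[i])
    (g : R[i] -> R[i]) : R[i] :=
  let ray t (r : R) := r%:C%C * cis t in
  let arc (t : R) := kappa%:C%C * cis t in
  Cintegral [set r | kappa <= r /\ D (ray theta r)]
    (fun r => g (ray theta r) * cis theta)
  - Cintegral [set r | kappa <= r /\ D (ray (- theta) r)]
    (fun r => g (ray (- theta) r) * cis (- theta))
  + Cintegral [set t | - theta <= t <= theta /\ D (arc t)]
    (fun t => g (arc t) * ('i%C * arc t)).

Definition strip (b : R) : set R[i] := [set z | `|Im z| <= b].

End complex_functions.

Section finite_elements.
Context {R : realType} {d : nat} (Om : set 'rV[R]_d).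
Local Notation fct := ('rV[R]_d -> R).
Local Notation cfct := ('rV[R]_d -> R[i]).
Local Notation Re := (@complex.Re R).
Local Notation Im := (@complex.Im R).

Definition re_fun (y : cfct) : fct := fun x => Re (y x).
Definition im_fun (y : cfct) : fct := fun x => Im (y x).

Definition CL2norm (y : cfct) : R :=
  Num.sqrt (ip Om (re_fun y) (re_fun y) + ip Om (im_fun y) (im_fun y)).

Definition polynomial_function (r : nat) (q : fct) :=
  exists c : {ffun 'I_d -> 'I_r.+1} -> R, forall x,
    q x = \sum_(b : {ffun 'I_d -> 'I_r.+1} | (\sum_i b i <= r)%N)
            c b * \prod_i x 0 i ^+ b i.

Definition fe_space (r : nat) nK (K : mesh nK) : set fct :=
  [set v | H10 Om v /\ forall k, exists2 q, polynomial_function r q &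
    aeOm Om (fun x => simplex (K k) x -> v x = q x)].

Variable X : set fct.

Definition Ph (u : hdot_elt) : fct :=
  xget (fun=> 0) [set w | X w /\
    forall chi, X chi -> ip Om w chi = pairing Om u chi].

Definition Ah (v : fct) : fct :=
  xget (fun=> 0) [set w | X w /\
    forall chi, X chi -> ip Om w chi = grad_ip Om v chi].

Definition Ah_inv (v : fct) : fct :=
  xget (fun=> 0) [set w | X w /\ aeOm Om (fun x => Ah w x = v x)].

(* complexifications of X and Ah *)
Definition XC : set cfct := [set y | X (re_fun y) /\ X (im_fun y)].

Definition AhC (y : cfct) : cfct :=
  fun x => (Ah (re_fun y) x +i* Ah (im_fun y) x)%C.

(* the operator (w + Ah)^-1 on XC, applied to g *)
Definition resolvent (w : R[i]) (g : cfct) : cfct :=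
  xget (fun=> 0) [set y | XC y /\
    aeOm Om (fun x => w * y x + AhC y x = g x)].

Definition cpairing (y : cfct) (chi : fct) : R[i] :=
  (ip Om (re_fun y) chi +i* ip Om (im_fun y) chi)%C.

(* integral of a function with values in the finite-dimensional space XC,
   characterized by its pairings with X *)
Definition contour_integralX (theta kappa : R) (D : set R[i])
    (G : R[i] -> cfct) : cfct :=
  xget (fun=> 0) [set U | XC U /\ forall chi, X chi ->
    cpairing U chi =
    contour_integral theta kappa D (fun z => cpairing (G z) chi)].

(* Ah^-m Ph u0 *)
Definition initial_r (m : nat) (u0 : hdot_elt) : cfct :=
  fun x => (iter m Ah_inv (Ph u0) x)%:C%C.

Definition prefactor (m : nat) : R[i] :=
  (-1) ^+ m / (2%:R * (pi : R)%:C%C * 'i%C).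

Definition semidiscrete_r (m : nat) (alpha theta kappa : R) (u0 : hdot_elt)
    (t : R) : cfct :=
  fun x => prefactor m * contour_integralX theta kappa setT (fun z x =>
    cexp (z * t%:C%C) * cpow z ((1 + m)%:R * alpha - 1) *
    resolvent (cpow z alpha) (initial_r m u0) x) x.

Definition fully_discrete_r (k m : nat) (alpha theta kappa tau : R)
    (u0 : hdot_elt) (n : nat) : cfct :=
  fun x => prefactor m * contour_integralX theta kappa (strip (pi / tau))
    (fun z x =>
      let w := bdf k tau (cexp (- (z * tau%:C%C))) in
      cexp (z * (n%:R * tau)%:C%C) * cpow w ((1 + m)%:R * alpha - 1) *
      resolvent (cpow w alpha) (initial_r m u0) x) x.

End finite_elements.

(* Main.v *)
(* In the eigenbasis (e_i, mu_i) of A_h on X_h everything becomes scalar: the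
   error has coefficients (contour difference for mu_i) * mu_i^-m * <u0, e_i>,
   so it suffices to bound, uniformly in mu > 0, the difference of the contour
   integrals of e^{zt} F(delta_tau(e^{-z tau})) and e^{zt} F(z), where
   F(w) = w^beta / (w^alpha + mu) and beta = (1 + m) alpha - 1. The weights are
   square summable because sum_i mu_i^-1 <u0, e_i>^2 is the value of u0 on an
   element chi of X_h whose Dirichlet energy is that same sum, u0 is bounded on
   H^1_0 since s >= -1, and mu_i is bounded below by Poincare's inequality.
   The scalar difference is O(tau^k |z|^(k + m alpha - 1) e^{t Re z}) on the
   contour: the symbol satisfies |delta_tau(e^{-z tau}) - z| <= C tau^k |z|^(k+1)
   because the derivative of delta(e^{-z}) is 1 - (1 - e^{-z})^k, and it stays
   comparable to z, in the half plane of z and off the negative axis. Integrating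
   gives the claim when kappa <= 1/t; for larger kappa both contours are first
   deformed to radius 1/t by Cauchy's theorem, proved in polar coordinates by
   differentiation under the integral sign. *)
From mathcomp Require Import all_boot all_order all_algebra.
From mathcomp Require Import all_classical all_reals all_analysis.
From mathcomp Require Import complex spectral measurable_realfun.
From mathcomp Require Import ring lra zify.
Require Import Defs.

Set Implicit Arguments.
Unset Strict Implicit.
Unset Printing Implicit Defensive.
Import Order.TTheory GRing.Theory Num.Theory.
Import numFieldNormedType.Exports.
Local Open Scope classical_set_scope.
Local Open Scope ring_scope.

(** * Complex numbers in polar form *)

(** Two obstacles shape the proof. First, the symbols of six schemes must be controlled on a contour
    that enters the left half plane. With w = 1 - e^(-z), the imaginary part of delta is Im w times
    a polynomial in Re w and Im w ^ 2, and this factor is at least 1/4 on a disk around 1 of radius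
    slightly above 1. So delta is real only for real w; this drives the lower bound for |delta|, the
    preservation of the half plane and the avoidance of the negative axis. An angle theta close to
    pi/2 keeps w in that disk. Second, functions are not identified up to null sets, and
    projections, discrete operators and vector integrals are choices made by [xget]. The L2 form is
    then only semidefinite on functions, so diagonalization is done modulo its null vectors, with
    finite rank because an element of X_h is given by finitely many polynomial coefficients. Chosen
    objects are known only through their pairings with the eigenbasis. Density of test functions in
    L2 comes from completeness of the eigenfunctions, each an H^1 limit of test functions; no
    mollification occurs. *)

Section complex_basics.
Context {R : realType}.
Local Notation C := R[i].
Local Notation nc := (@Normc.normc R).
Local Notation Re := (@complex.Re R).
Local Notation Im := (@complex.Im R).
Implicit Types (z w : C) (r t a : R).

Lemma nc_sqr z : nc z ^+ 2 = Re z ^+ 2 + Im z ^+ 2.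
Proof. by case: z => a b; rewrite sqr_sqrtr// addr_ge0// sqr_ge0. Qed.

Lemma nc_ge0 z : 0 <= nc z. Proof. by case: z => a b; exact: sqrtr_ge0. Qed.

Lemma cReM z w : Re (z * w) = Re z * Re w - Im z * Im w. Proof. by case: z; case: w. Qed.
Lemma cImM z w : Im (z * w) = Re z * Im w + Im z * Re w. Proof. by case: z; case: w. Qed.
Lemma cReD z w : Re (z + w) = Re z + Re w. Proof. by case: z; case: w. Qed.
Lemma cImD z w : Im (z + w) = Im z + Im w. Proof. by case: z; case: w. Qed.
Lemma cReN z : Re (- z) = - Re z. Proof. by case: z. Qed.
Lemma cImN z : Im (- z) = - Im z. Proof. by case: z. Qed.

Lemma complex_ext z w : Re z = Re w -> Im z = Im w -> z = w.
Proof. by case: z w => a b [c d] /= -> ->. Qed.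

Lemma nc_Re_le z : `|Re z| <= nc z.
Proof.
rewrite -(@ler_pXn2r _ 2)// ?nnegrE ?nc_ge0// nc_sqr real_normK ?num_real//.
by rewrite lerDl sqr_ge0.
Qed.

Lemma nc_Im_le z : `|Im z| <= nc z.
Proof.
rewrite -(@ler_pXn2r _ 2)// ?nnegrE ?nc_ge0// nc_sqr real_normK ?num_real//.
by rewrite lerDr sqr_ge0.
Qed.

Lemma nc_le_ReIm z : nc z <= `|Re z| + `|Im z|.
Proof.
rewrite -(@ler_pXn2r _ 2)// ?nnegrE ?nc_ge0// ?addr_ge0// nc_sqr.
rewrite -(real_normK (num_real (Re z))) -(real_normK (num_real (Im z))) sqrrD.
by rewrite lerD2r lerDl mulrn_wge0// mulr_ge0.
Qed.

Lemma nc_gt0 z : z != 0 -> 0 < nc z.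
Proof.
move=> z0; rewrite lt_neqAle nc_ge0 andbT eq_sym.
by apply: contra_neq z0 => /Normc.eq0_normc.
Qed.

Lemma nc_real r : nc r%:C%C = `|r|.
Proof. by rewrite /nc /= expr0n addr0 sqrtr_sqr. Qed.

Lemma nc_pos r : 0 <= r -> nc r%:C%C = r.
Proof. by move=> r0; rewrite nc_real ger0_norm. Qed.

Lemma ncX z n : nc (z ^+ n) = nc z ^+ n.
Proof. by elim: n => [|n IH]; [rewrite !expr0 Normc.normc1|rewrite !exprS Normc.normcM IH]. Qed.

Lemma nc_cis t : nc (cis t) = 1.
Proof. by rewrite /nc /= cos2Dsin2 sqrtr1. Qed.

Lemma nc_B z w : nc (z - w) <= nc z + nc w.
Proof. by rewrite -[nc w]normcN; exact: le_normcD. Qed.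

Lemma nc_Bge z w : nc z - nc w <= nc (z - w).
Proof. by rewrite lerBlDr; have := le_normcD (z - w) w; rewrite subrK. Qed.

Lemma nc_distC z w : nc (z - w) = nc (w - z).
Proof. by rewrite -normcN opprB. Qed.

Lemma nc_polar r t : 0 <= r -> nc (r%:C%C * cis t) = r.
Proof. by move=> r0; rewrite Normc.normcM nc_cis mulr1 nc_pos. Qed.

Lemma Re_polar r t : Re (r%:C%C * cis t) = r * cos t.
Proof. by rewrite /= mul0r subr0. Qed.

Lemma Im_polar r t : Im (r%:C%C * cis t) = r * sin t.
Proof. by rewrite /= mul0r addr0. Qed.

Lemma nc_exp z : nc (cexp z) = expR (Re z).
Proof. by rewrite nc_polar// expR_ge0. Qed.

Lemma carg_polar r t : 0 < r -> - pi < t <= pi -> carg (r%:C%C * cis t) = t.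
Proof.
move=> r0 /andP[t1 t2]; rewrite /carg (nc_polar _ (ltW r0)) Re_polar Im_polar.
rewrite mulrAC divff ?gt_eqF// mul1r pmulr_rge0//.
have [s0|s0] := leP 0 (sin t).
  rewrite cosK// in_itv/= t2 andbT leNgt; apply/negP => t0.
  have : 0 < sin (- t) by apply: sin_gt0_pi; rewrite oppr_gt0 t0/= ltrNl.
  by rewrite sinN oppr_gt0 ltNge s0.
rewrite cosKN ?opprK// ltW//= leNgt; apply/negP => t0.
by have : 0 <= sin t; [apply: sin_ge0_pi; rewrite ltW|rewrite leNgt s0].
Qed.

Lemma carg_bounds z : - pi <= carg z <= pi.
Proof.
have q : -1 <= Re z / nc z <= 1.
  rewrite -ler_norml normrM normfV (ger0_norm (nc_ge0 z)).
  have [->|z0] := eqVneq z 0; first by rewrite normr0 mul0r.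
  by rewrite ler_pdivrMr ?nc_gt0// mul1r nc_Re_le.
have := acos_ge0 q; have := acos_lepi q; rewrite /carg; case: ifP => _ h1 h2.
  by rewrite h1 andbT (le_trans _ h2)// oppr_le0 pi_ge0.
by rewrite lerN2 h1/= (le_trans _ (pi_ge0 R))// oppr_le0.
Qed.

Lemma carg_ge0 z : 0 <= Im z -> 0 <= carg z.
Proof.
move=> h; rewrite /carg h; apply: acos_ge0.
rewrite -ler_norml normrM normfV (ger0_norm (nc_ge0 z)).
have [->|z0] := eqVneq z 0; first by rewrite normr0 mul0r.
by rewrite ler_pdivrMr ?nc_gt0// mul1r nc_Re_le.
Qed.

Lemma polarE z : z = (nc z)%:C%C * cis (carg z).
Proof.
have [->|z0] := eqVneq z 0; first by rewrite Normc.normc0 mul0r.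
have n0 := nc_gt0 z0.
have q : -1 <= Re z / nc z <= 1.
  by rewrite -ler_norml normrM normfV (ger0_norm (nc_ge0 z)) ler_pdivrMr// mul1r nc_Re_le.
have sq : Num.sqrt (1 - (Re z / nc z) ^+ 2) = `|Im z| / nc z.
  have -> : 1 - (Re z / nc z) ^+ 2 = (`|Im z| / nc z) ^+ 2.
    rewrite !expr_div_n real_normK ?num_real//.
    have := nc_sqr z; move: (gt_eqF n0) => /negbT; move: (nc z) => m m0 h.
    have -> : Im z ^+ 2 = m ^+ 2 - Re z ^+ 2 by rewrite h; ring.
    by field.
  by rewrite sqrtr_sqr ger0_norm// divr_ge0// ltW.
apply: complex_ext; rewrite ?Re_polar ?Im_polar.
  by rewrite /carg; case: ifP => _; rewrite ?cosN acosK ?in_itv/= ?q// mulrC divfK// gt_eqF.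
rewrite /carg; case: ifP => h; rewrite ?sinN sin_acos// sq.
  by rewrite ger0_norm// mulrC divfK// gt_eqF.
rewrite ltr0_norm; last by rewrite ltNge h.
by rewrite mulNr opprK mulrC divfK// gt_eqF.
Qed.

Lemma nc_pow z a : nc (cpow z a) = nc z `^ a.
Proof. by rewrite nc_polar// powR_ge0. Qed.

End complex_basics.

(** * Differentiation of complex curves *)

Section cder.
Context {R : realType}.
Local Notation C := R[i].
Local Notation nc := (@Normc.normc R).
Local Notation Re := (@complex.Re R).
Local Notation Im := (@complex.Im R).
Implicit Types (f g : R -> C) (t : R) (u v : C) (p q : R -> R).

(** Componentwise, so that the real [is_derive] calculus can be reused. Holomorphic functions enter
    only through chain rules along such curves. *)
Definition cder f t v := is_derive t 1 (fun s => Re (f s)) (Re v) /\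
  is_derive t 1 (fun s => Im (f s)) (Im v).

Lemma is_derive_near p q t (v : R) : (\forall s \near t, p s = q s) ->
  is_derive t 1 p v -> is_derive t 1 q v.
Proof. exact: near_eq_is_derive. Qed.

Lemma is_derive_ext p q t (v w : R) : is_derive t 1 p v -> p =1 q -> v = w -> is_derive t 1 q w.
Proof. by move=> + /funext <- <-. Qed.

Lemma cder_ext f g t u v : cder f t u -> f =1 g -> u = v -> cder g t v.
Proof. by move=> + /funext <- <-. Qed.

Lemma cder_cst (c : C) t : cder (fun=> c) t 0.
Proof. by split; exact: is_derive_cst. Qed.

Lemma cder_real p t (v : R) : is_derive t 1 p v -> cder (fun s => (p s)%:C%C) t v%:C%C.
Proof. by split=> //; exact: is_derive_cst. Qed.

Lemma cderD f g t u v : cder f t u -> cder g t v -> cder (fun s => f s + g s) t (u + v).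
Proof.
move=> [f1 f2] [g1 g2]; split.
  by apply: is_derive_ext (is_deriveD f1 g1) _ _; [move=> s; rewrite cReD|rewrite cReD].
by apply: is_derive_ext (is_deriveD f2 g2) _ _; [move=> s; rewrite cImD|rewrite cImD].
Qed.

Lemma cderN f t u : cder f t u -> cder (fun s => - f s) t (- u).
Proof.
move=> [f1 f2]; split.
  by apply: is_derive_ext (is_deriveN f1) _ _; [move=> s; rewrite cReN|rewrite cReN].
by apply: is_derive_ext (is_deriveN f2) _ _; [move=> s; rewrite cImN|rewrite cImN].
Qed.

Lemma cderB f g t u v : cder f t u -> cder g t v -> cder (fun s => f s - g s) t (u - v).
Proof. by move=> hf hg; exact: cderD hf (cderN hg). Qed.

Lemma is_derive_mul p q t (u v : R) : is_derive t 1 p u -> is_derive t 1 q v ->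
  is_derive t 1 (fun s => p s * q s) (p t * v + u * q t).
Proof.
move=> hp hq; apply: is_derive_ext (is_deriveM hp hq) _ _ => //.
by rewrite /GRing.scale/= [q t * _]mulrC.
Qed.

Lemma is_derive_add p q t (u v : R) : is_derive t 1 p u -> is_derive t 1 q v ->
  is_derive t 1 (fun s => p s + q s) (u + v).
Proof. exact: is_deriveD. Qed.

Lemma is_derive_sub p q t (u v : R) : is_derive t 1 p u -> is_derive t 1 q v ->
  is_derive t 1 (fun s => p s - q s) (u - v).
Proof. exact: is_deriveB. Qed.

Lemma is_derive_opp p t (u : R) : is_derive t 1 p u -> is_derive t 1 (fun s => - p s) (- u).
Proof. exact: is_deriveN. Qed.

Lemma is_derive_comp p q t (u v : R) : is_derive (q t) 1 p u -> is_derive t 1 q v ->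
  is_derive t 1 (fun s => p (q s)) (v * u).
Proof.
by move=> hp hq; apply: is_derive_ext (is_derive1_comp hp hq) _ _ => //; rewrite mulrC.
Qed.

Lemma is_derive_inv p t (u : R) : p t != 0 -> is_derive t 1 p u ->
  is_derive t 1 (fun s => (p s)^-1) (- u / p t ^+ 2).
Proof.
move=> p0 hp; apply: is_derive_ext (is_deriveV p0 hp) _ _ => //.
by rewrite /GRing.scale/= !mulNr [u / _]mulrC.
Qed.

Lemma cderM f g t u v : cder f t u -> cder g t v ->
  cder (fun s => f s * g s) t (u * g t + f t * v).
Proof.
move=> [f1 f2] [g1 g2]; split.
  apply: is_derive_ext (is_derive_sub (is_derive_mul f1 g1) (is_derive_mul f2 g2)) _ _.
    by move=> s; rewrite cReM.
  by rewrite cReD !cReM; ring.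
apply: is_derive_ext (is_derive_add (is_derive_mul f1 g2) (is_derive_mul f2 g1)) _ _.
  by move=> s; rewrite cImM.
by rewrite cImD !cImM; ring.
Qed.

Lemma cder_sqr_norm f t u : cder f t u ->
  is_derive t 1 (fun s => nc (f s) ^+ 2) (2 * (Re (f t) * Re u + Im (f t) * Im u)).
Proof.
move=> [f1 f2].
apply: is_derive_ext (is_derive_add (is_derive_mul f1 f1) (is_derive_mul f2 f2)) _ _.
  by move=> s; rewrite nc_sqr !expr2.
ring.
Qed.

Lemma nc_neq0 (z : C) : z != 0 -> nc z != 0.
Proof. by move=> /nc_gt0/gt_eqF->. Qed.

Lemma cReV (z : C) : Re z^-1 = Re z / nc z ^+ 2.
Proof. by rewrite nc_sqr; case: z. Qed.

Lemma cImV (z : C) : Im z^-1 = - Im z / nc z ^+ 2.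
Proof. by rewrite nc_sqr; case: z => a b /=; rewrite mulNr. Qed.

Lemma cderV f t u : f t != 0 -> cder f t u -> cder (fun s => (f s)^-1) t (- u / f t ^+ 2).
Proof.
move=> f0 hf; have [f1 f2] := hf; have n0 := nc_neq0 f0.
have n20 : nc (f t) ^+ 2 != 0 by rewrite expf_neq0.
have hn := @is_derive_inv (fun s => nc (f s) ^+ 2) t _ n20 (cder_sqr_norm hf).
have E : - u / f t ^+ 2 = - (u * (f t)^-1 * (f t)^-1) by rewrite -exprVn expr2 mulNr mulrA.
split.
  apply: is_derive_ext (is_derive_mul f1 hn) _ _; first by move=> s; rewrite cReV.
  rewrite E cReN !cReM !cImM !cReV !cImV.
  move: n0 (nc_sqr (f t)); move: (nc (f t)) (Re (f t)) (Im (f t)) (Re u) (Im u) => n a b c d n0 h.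
  have -> : n ^+ 2 = a ^+ 2 + b ^+ 2 by [].
  by field; rewrite -h expf_neq0.
apply: is_derive_ext (is_derive_mul (is_derive_opp f2) hn) _ _; first by move=> s; rewrite cImV.
rewrite E cImN !cImM !cReM !cReV !cImV.
move: n0 (nc_sqr (f t)); move: (nc (f t)) (Re (f t)) (Im (f t)) (Re u) (Im u) => n a b c d n0 h.
have -> : n ^+ 2 = a ^+ 2 + b ^+ 2 by [].
by field; rewrite -h expf_neq0.
Qed.

Lemma cderZ f t u (c : C) : cder f t u -> cder (fun s => c * f s) t (c * u).
Proof. by move=> hf; apply: cder_ext (cderM (cder_cst c t) hf) _ _ => //; rewrite mul0r add0r. Qed.

Lemma cder_cis p t (v : R) : is_derive t 1 p v -> cder (fun s => cis (p s)) t (v%:C%C * ('i%C * cis (p t))).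
Proof.
move=> hp; split.
  apply: is_derive_ext (is_derive_comp (is_derive_cos (p t)) hp) _ _ => //=.
  by rewrite !mul0r mul1r sub0r subr0.
apply: is_derive_ext (is_derive_comp (is_derive_sin (p t)) hp) _ _ => //=.
by rewrite !mul0r !mul1r add0r addr0.
Qed.

Lemma cder_exp f t u : cder f t u -> cder (fun s => cexp (f s)) t (cexp (f t) * u).
Proof.
move=> [f1 f2].
have h1 := cder_real (is_derive_comp (is_derive_expR (Re (f t))) f1).
apply: cder_ext (cderM h1 (cder_cis f2)) _ _ => //.
rewrite /cexp; apply: complex_ext; rewrite !(cReD, cImD, cReM, cImM) /=; ring.
Qed.

Lemma cderX f t u n : cder f t u -> cder (fun s => f s ^+ n.+1) t (n.+1%:R * f t ^+ n * u).
Proof.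
move=> hf; elim: n => [|n IH].
  by apply: cder_ext hf _ _ => [s|]; rewrite ?expr1// expr0 !mul1r.
apply: cder_ext (cderM hf IH) _ _ => [s|]; first by rewrite [RHS]exprS.
by rewrite exprS -[n.+2%:R]natr1; ring.
Qed.

Lemma is_derive_atan_comp p t (u : R) : is_derive t 1 p u ->
  is_derive t 1 (fun s => atan (p s)) (u / (1 + p t ^+ 2)).
Proof.
by move=> hp; exact: is_derive_comp (is_derive1_atan (p t)) hp.
Qed.

Lemma is_derive_cont f t v : cder f t v ->
  {for t, continuous (fun s => Re (f s))} /\ {for t, continuous (fun s => Im (f s))}.
Proof.
move=> [[d1 _] [d2 _]]; split; apply: differentiable_continuous; exact/derivable1_diffP.
Qed.

(** The plane without the closed negative half axis, where the principal argument and the principal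
    powers are differentiable. *)
Definition slit (z : C) := (0 < Re z) || (Im z != 0).

Lemma slit_neq0 z : slit z -> z != 0.
Proof. by apply: contraTneq => ->; rewrite /slit ltxx eqxx. Qed.

(** Polar coordinates on the right half plane by the arctangent. Exchanging or negating the
    coordinates gives the upper and lower half planes below. *)
Lemma tan_polar (x y : R) : 0 < x -> let s := atan (y / x) in
  x = x / cos s * cos s /\ y = x / cos s * sin s /\ 0 < x / cos s.
Proof.
move=> x0 s; have cs : 0 < cos s by apply: cos_gt0_pihalf; rewrite atan_gtNpi2 atan_ltpi2.
split; first by rewrite divfK// gt_eqF.
split; last by rewrite divr_gt0.
have : tan s = y / x by rewrite atanK.
rewrite /tan => h; rewrite mulrAC -mulrA h mulrC divfK// gt_eqF//.
Qed.

Lemma carg_right z : 0 < Re z -> carg z = atan (Im z / Re z).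
Proof.
move=> x0; have [h1 [h2 h3]] := tan_polar (Im z) x0.
set s := atan _ in h1 h2 h3 *.
have -> : z = (Re z / cos s)%:C%C * cis s.
  by apply: complex_ext; rewrite ?Re_polar ?Im_polar.
rewrite carg_polar//; have := atan_gtNpi2 (Im z / Re z); have := atan_ltpi2 (Im z / Re z).
rewrite -/s; have := pi_gt0 R; lra.
Qed.

Lemma carg_upper z : 0 < Im z -> carg z = pi / 2 - atan (Re z / Im z).
Proof.
move=> y0; have [h1 [h2 h3]] := tan_polar (Re z) y0.
set s := atan _ in h1 h2 h3 *.
have hc : cos (pi / 2 - s) = sin s by rewrite cosB cos_pihalf sin_pihalf mul0r mul1r add0r.
have hs : sin (pi / 2 - s) = cos s by rewrite sinB cos_pihalf sin_pihalf mul0r mul1r subr0.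
have -> : z = (Im z / cos s)%:C%C * cis (pi / 2 - s).
  by apply: complex_ext; rewrite ?Re_polar ?Im_polar ?hc ?hs.
rewrite carg_polar//; have := atan_gtNpi2 (Re z / Im z); have := atan_ltpi2 (Re z / Im z).
rewrite -/s; have := pi_gt0 R; lra.
Qed.

Lemma carg_lower z : Im z < 0 -> carg z = - (pi / 2) - atan (Re z / Im z).
Proof.
move=> y0; have y1 : 0 < - Im z by rewrite oppr_gt0.
have [h1 [h2 h3]] := tan_polar (- Re z) y1.
have e : - Re z / - Im z = Re z / Im z by rewrite invrN mulrNN.
rewrite e in h1 h2 h3.
set s := atan _ in h1 h2 h3 *.
have hc : cos (- (pi / 2) - s) = - sin s.
  by rewrite cosB cosN sinN cos_pihalf sin_pihalf mul0r mulN1r add0r.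
have hs : sin (- (pi / 2) - s) = - cos s.
  by rewrite sinB sinN cosN cos_pihalf sin_pihalf mul0r mulN1r subr0.
have -> : z = (- Im z / cos s)%:C%C * cis (- (pi / 2) - s).
  apply: complex_ext; rewrite ?Re_polar ?Im_polar ?hc ?hs mulrN.
    by rewrite -h2 opprK.
  by rewrite -h1 opprK.
rewrite carg_polar//; have := atan_gtNpi2 (Re z / Im z); have := atan_ltpi2 (Re z / Im z).
rewrite -/s; have := pi_gt0 R; lra.
Qed.

Lemma near_gt0 p t : {for t, continuous p} -> 0 < p t -> \forall s \near t, 0 < p s.
Proof. by move=> cp pt; exact: (cvgr_gt (p t) cp 0 pt). Qed.

(** The right, upper and lower half planes are open and cover the slit plane; on each of them the
    argument is an arctangent up to a constant, and by continuity the curve stays there near t. *)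
Lemma is_derive_carg f t v : cder f t v -> slit (f t) ->
  is_derive t 1 (fun s => carg (f s)) ((Re (f t) * Im v - Im (f t) * Re v) / nc (f t) ^+ 2).
Proof.
move=> hf sf; have [c1 c2] := is_derive_cont hf; have [f1 f2] := hf.
rewrite nc_sqr.
have quot (a b : R -> R) (a' b' : R) : b t != 0 -> is_derive t 1 a a' -> is_derive t 1 b b' ->
    is_derive t 1 (fun s => atan (a s / b s)) ((a' * b t - a t * b') / (a t ^+ 2 + b t ^+ 2)).
  move=> b0 ha hb.
  apply: is_derive_ext (is_derive_atan_comp (is_derive_mul ha (is_derive_inv b0 hb))) _ _ => //.
  have h : 0 < a t ^+ 2 + b t ^+ 2 by rewrite ltr_wpDl ?sqr_ge0// exprn_even_gt0.
  have h2 : b t ^+ 2 + a t ^+ 2 != 0 by rewrite addrC gt_eqF.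
  by field; rewrite b0 addrC h2.
have [x0|x0] := ltP 0 (Re (f t)).
  have hq := quot _ _ _ _ (negbT (gt_eqF x0)) f2 f1.
  apply: (is_derive_near (p := fun s => atan (Im (f s) / Re (f s)))).
    by apply: filterS (near_gt0 c1 x0) => s hs; rewrite carg_right.
  apply: is_derive_ext hq _ _ => //; rewrite addrC; congr (_ / _); ring.
have y0 : Im (f t) != 0 by move: sf; rewrite /slit ltNge x0.
have hq := quot _ _ _ _ y0 f1 f2.
move: y0; rewrite neq_lt => /orP[y0|y0].
  apply: (is_derive_near (p := fun s => - (pi / 2) - atan (Re (f s) / Im (f s)))).
    have cN : {for t, continuous (fun s => - Im (f s))} by exact: continuousN.
    have yN : 0 < - Im (f t) by rewrite oppr_gt0.
    by apply: filterS (near_gt0 cN yN) => s; rewrite oppr_gt0 => hs; rewrite carg_lower.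
  apply: is_derive_ext (is_derive_sub (is_derive_cst _ _ _) hq) _ _ => //.
  by rewrite sub0r -mulNr; congr (_ / _); ring.
apply: (is_derive_near (p := fun s => pi / 2 - atan (Re (f s) / Im (f s)))).
  by apply: filterS (near_gt0 c2 y0) => s hs; rewrite carg_upper.
apply: is_derive_ext (is_derive_sub (is_derive_cst _ _ _) hq) _ _ => //.
by rewrite sub0r -mulNr; congr (_ / _); ring.
Qed.

Lemma powR_sqr (x a : R) : 0 <= x -> x `^ a = (x ^+ 2) `^ (a / 2).
Proof.
move=> x0; rewrite -powR_mulrn// -powRrM; congr (_ `^ _).
by rewrite mulrC divfK// pnatr_eq0.
Qed.

(** The modulus power is written as a power of the squared modulus, which is polynomial in the two
    components, so that the square root is never differentiated. *)
Lemma is_derive_nc_pow f t v a : cder f t v -> f t != 0 ->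
  is_derive t 1 (fun s => nc (f s) `^ a)
   (a * nc (f t) `^ a * ((Re (f t) * Re v + Im (f t) * Im v) / nc (f t) ^+ 2)).
Proof.
move=> hf f0; have n0 := nc_gt0 f0.
have n2 : 0 < nc (f t) ^+ 2 by rewrite exprn_gt0.
have hp := @is_derive_comp (fun x => x `^ (a / 2)) (fun s => nc (f s) ^+ 2) t _ _
  (is_derive1_powR (a / 2) n2) (cder_sqr_norm hf).
apply: is_derive_ext hp _ _.
  by move=> s; rewrite -powR_sqr// nc_ge0.
have -> : (nc (f t) ^+ 2) `^ (a / 2 - 1) = nc (f t) `^ a / nc (f t) ^+ 2.
  rewrite powRB; last by rewrite (gt_eqF n2) implybT.
  by rewrite -powR_sqr ?(ltW n0)// powRr1// ltW.
by field; rewrite gt_eqF.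
Qed.

Lemma cder_pow f t v a : cder f t v -> slit (f t) ->
  cder (fun s => cpow (f s) a) t (a%:C%C * cpow (f t) a * (v / f t)).
Proof.
move=> hf sf; have f0 := slit_neq0 sf; have n0 := nc_neq0 f0.
have h1 := cder_real (is_derive_nc_pow a hf f0).
have h2 := cder_cis (is_derive_mul (is_derive_cst a _ _) (is_derive_carg hf sf)).
apply: cder_ext (cderM h1 h2) _ _ => //.
(* The real part is the logarithmic derivative of the modulus, the imaginary part the derivative of
   the argument. *)
have -> : v / f t = ((Re (f t) * Re v + Im (f t) * Im v) / nc (f t) ^+ 2)%:C%C +
    ((Re (f t) * Im v - Im (f t) * Re v) / nc (f t) ^+ 2)%:C%C * 'i%C.
  apply: complex_ext; rewrite !(cReD, cImD, cReM, cImM, cReV, cImV) /=; field; exact: n0.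
rewrite /cpow mul0r addr0.
move: (_ / nc (f t) ^+ 2) (_ / nc (f t) ^+ 2) => x y.
move: (cis (a * carg (f t))) (nc (f t) `^ a) => c n.
by rewrite !rmorphM /=; ring.
Qed.

End cder.

(** * The symbol w^beta / (w^alpha + mu) *)

Section elementary.
Context {R : realType}.
Local Notation C := R[i].
Local Notation nc := (@Normc.normc R).
Local Notation Re := (@complex.Re R).
Local Notation Im := (@complex.Im R).

Lemma mean_value (f df : R -> R) (a b : R) : a <= b ->
  (forall x, a <= x <= b -> is_derive x 1 f (df x)) ->
  exists2 c, a <= c <= b & f b - f a = df c * (b - a).
Proof.
move=> ab h.
have hd x : x \in `]a, b[ -> is_derive x 1 f (df x).
  by rewrite in_itv/= => /andP[h1 h2]; apply: h; rewrite !ltW.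
have hc : {within `[a, b], continuous f}.
  apply: derivable_within_continuous => x; rewrite in_itv/= => /h.
  by case.
have [c + ->] := MVT_segment ab hd hc.
by rewrite in_itv/= => h1; exists c.
Qed.

Lemma mean_value_bound (f df : R -> R) (a b K : R) : a <= b ->
  (forall x, a <= x <= b -> is_derive x 1 f (df x)) ->
  (forall x, a <= x <= b -> `|df x| <= K) -> `|f b - f a| <= K * (b - a).
Proof.
move=> ab h hK; have [c cab ->] := mean_value ab h.
by rewrite normrM [X in _ * X]ger0_norm ?subr_ge0// ler_wpM2r ?subr_ge0// hK.
Qed.

Lemma norm_cosB (a b : R) : `|cos a - cos b| <= `|a - b|.
Proof.
wlog ba : a b / b <= a.
  move=> h; have [|/ltW ab] := leP b a; first exact: h.
  by rewrite distrC [leRHS]distrC; exact: h.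
rewrite [leRHS]ger0_norm ?subr_ge0// -[leRHS]mul1r.
apply: (mean_value_bound (df := fun x => - sin x)) => // x _.
by rewrite normrN sin_max.
Qed.

Lemma norm_sinB (a b : R) : `|sin a - sin b| <= `|a - b|.
Proof.
wlog ba : a b / b <= a.
  move=> h; have [|/ltW ab] := leP b a; first exact: h.
  by rewrite distrC [leRHS]distrC; exact: h.
rewrite [leRHS]ger0_norm ?subr_ge0// -[leRHS]mul1r.
apply: (mean_value_bound (df := fun x => cos x)) => // x _.
by rewrite cos_max.
Qed.

Lemma nc_cisB (a b : R) : nc (cis a - cis b) <= 2 * `|a - b|.
Proof.
apply: le_trans (nc_le_ReIm _) _; rewrite cReD cImD cReN cImN /=.
by rewrite mulr_natl mulr2n lerD ?norm_cosB ?norm_sinB.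
Qed.

(** With u = t / 2, sin u >= u cos u because sin x - x cos x has derivative x sin x >= 0. Hence sin
    t = 2 sin u cos u >= t cos^2 u, and cos^2 u >= 1/2 since cos t >= 0. *)
Lemma sin_ge_half (t : R) : 0 <= t <= pi / 2 -> t / 2 <= sin t.
Proof.
move=> /andP[t0 t1]; pose u := t / 2.
have u0 : 0 <= u by rewrite divr_ge0.
have tu : t = u *+ 2 by rewrite mulr2n -splitr.
have h1 : u * cos u <= sin u.
  have hd x : 0 <= x <= u -> is_derive x 1 (fun x => sin x - x * cos x) (x * sin x).
    move=> _; apply: is_derive_ext (is_derive_sub (is_derive_sin x)
       (is_derive_mul (is_derive_id _ _) (is_derive_cos x))) _ _ => //.
    by rewrite /=; ring.
  have [c /andP[c0 cu]] := mean_value u0 hd.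
  rewrite sin0 mul0r !subr0 -subr_ge0 => ->.
  rewrite mulr_ge0// mulr_ge0// sin_ge0_pi// c0/=.
  apply: le_trans cu _; rewrite /u; have := pi_gt0 R; lra.
have h2 : 1 / 2 <= cos u ^+ 2.
  have := cos_mulr2n u; rewrite -tu -mulr_natl => e.
  have : 0 <= cos t by apply: cos_ge0_pihalf; have := pi_gt0 R; lra.
  by rewrite e; lra.
have c0 : 0 <= cos u by apply: cos_ge0_pihalf; have := pi_gt0 R; rewrite /u; lra.
rewrite {2}tu sin_mulr2n -mulr_natl -/u.
have := ler_wpM2l c0 h1; rewrite (_ : cos u * (u * cos u) = u * cos u ^+ 2); last by ring.
have := ler_wpM2l u0 h2; lra.
Qed.

(** 1 - cos t = 2 sin^2(t/2), and [sin_ge_half] gives sin(t/2) >= t/4 for t in [0, pi]. *)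
Lemma cos_upper (t : R) : - pi <= t <= pi -> t ^+ 2 / 8 <= 1 - cos t.
Proof.
move=> ht; wlog t0 : t ht / 0 <= t.
  move=> h; have [|/ltW tn] := leP 0 t; first exact: h.
  rewrite -cosN -sqrrN; apply: h; last by rewrite oppr_ge0.
  by move: ht; rewrite lerN2 lerNl andbC.
pose u := t / 2.
have tu : t = u *+ 2 by rewrite mulr2n -splitr.
have hu : 0 <= u <= pi / 2 by rewrite /u; case/andP: ht; lra.
have u0 : 0 <= u by case/andP: hu.
have hs := sin_ge_half hu.
rewrite {2}tu cos_mulr2n -[_ *+ 2]mulr_natl cos2sin2.
have : (u / 2) ^+ 2 <= sin u ^+ 2 by rewrite ler_pXn2r ?nnegrE ?divr_ge0// (le_trans _ hs)// divr_ge0.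
rewrite /u; lra.
Qed.

(** For p < 0 both powers are inverted, which exchanges the roles of x and y; hence comparability in
    both directions and the exponent [|p|]. *)
Lemma powR_comparable (A x y p : R) : 1 <= A -> 0 < x -> 0 < y -> y <= A * x -> x <= A * y ->
  y `^ p <= A `^ `|p| * x `^ p.
Proof.
move=> A1 x0 y0 yx xy; have A0 : 0 < A by exact: lt_le_trans A1.
have [p0|p0] := leP 0 p.
  rewrite (ger0_norm p0) -powRM ?(ltW A0) ?(ltW x0)//.
  by rewrite ge0_ler_powR// ?nnegrE ?(ltW y0)// mulr_ge0 ?ltW.
have q0 : 0 <= - p by rewrite oppr_ge0 ltW.
rewrite (ltr0_norm p0) -[p]opprK [y `^ _]powRN [x `^ _]powRN opprK.
rewrite -[leRHS]/(_ / _) ler_pdivlMr ?powR_gt0// mulrC ler_pdivrMr ?powR_gt0//.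
rewrite -powRM ?(ltW A0) ?(ltW y0)//.
by rewrite ge0_ler_powR// ?nnegrE ?(ltW x0)// mulr_ge0 ?ltW.
Qed.

(** Mean value theorem: every point between x and y is comparable to x with the same constant A, so
    the derivative there is bounded by its size at x. *)
Lemma powR_diff (A p x y : R) : 1 <= A -> 0 < x -> 0 < y -> y <= A * x -> x <= A * y ->
  `|x `^ p - y `^ p| <= `|p| * A `^ `|p - 1| * x `^ (p - 1) * `|x - y|.
Proof.
move=> A1 x0 y0 yx xy; have A0 : 0 < A by exact: lt_le_trans A1.
have key c : 0 < c -> c <= A * x -> x <= A * c ->
    `|p * c `^ (p - 1)| <= `|p| * A `^ `|p - 1| * x `^ (p - 1).
  move=> c0 cx xc; rewrite normrM (ger0_norm (powR_ge0 _ _)) -mulrA ler_wpM2l//.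
  exact: powR_comparable.
have xA : x <= A * x by rewrite ler_peMl// ltW.
have mv a b : 0 < a -> a <= b -> (forall c, a <= c <= b -> c <= A * x /\ x <= A * c) ->
    `|b `^ p - a `^ p| <= `|p| * A `^ `|p - 1| * x `^ (p - 1) * (b - a).
  move=> a0 ab hc; apply: (mean_value_bound (f := fun c => c `^ p)
    (df := fun c => p * c `^ (p - 1))) => // c cab.
    by apply: is_derive1_powR; case/andP: cab => h _; exact: lt_le_trans h.
  have [h1 h2] := hc c cab; apply: key => //.
  by case/andP: cab => h _; exact: lt_le_trans h.
have [yx'|/ltW xy'] := leP y x.
  rewrite [`|x - y|]ger0_norm ?subr_ge0//; apply: mv => // c /andP[h1 h2].
  split; first exact: le_trans h2 _.
  by apply: le_trans xy _; rewrite ler_wpM2l// ltW.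
rewrite distrC [`|x - y|]distrC [`|y - x|]ger0_norm ?subr_ge0//.
apply: mv => // c /andP[h1 h2]; split; first exact: le_trans h2 _.
by apply: le_trans xA _; rewrite ler_wpM2l// ltW.
Qed.

(** Excludes two nearby points on opposite sides of the cut, whose principal arguments would differ
    by almost 2 pi. *)
Definition same_side (w1 w2 : C) :=
  (0 <= carg w1 /\ 0 <= carg w2) \/ (carg w1 <= 0 /\ carg w2 <= 0).

Lemma same_side_bound w1 w2 : same_side w1 w2 -> - pi <= carg w1 - carg w2 <= pi.
Proof.
have := carg_bounds w1; have := carg_bounds w2; rewrite /same_side.
by move=> /andP[? ?] /andP[? ?] [[? ?]|[? ?]]; apply/andP; split; lra.
Qed.

(* law of cosines: |w1-w2|^2 = (r1-r2)^2 + 2 r1 r2 (1 - cos D) *)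
Lemma carg_diff (A : R) w1 w2 : 1 <= A -> w1 != 0 -> w2 != 0 -> same_side w1 w2 ->
  nc w1 <= A * nc w2 ->
  `|carg w1 - carg w2| <= 2 * A * nc (w1 - w2) / nc w1.
Proof.
move=> A1 w10 w20 ss h.
have r1 := nc_gt0 w10; have r2 := nc_gt0 w20.
set D := carg w1 - carg w2.
have law : nc (w1 - w2) ^+ 2 = (nc w1 - nc w2) ^+ 2 + 2 * (nc w1 * nc w2) * (1 - cos D).
  rewrite [in LHS](polarE w1) [in LHS](polarE w2) nc_sqr cReD cImD cReN cImN !Re_polar !Im_polar.
  rewrite /D cosB.
  have e1 := cos2Dsin2 (carg w1); have e2 := cos2Dsin2 (carg w2).
  move: (cos (carg w1)) (sin (carg w1)) (cos (carg w2)) (sin (carg w2)) e1 e2 => c1 s1 c2 s2 e1 e2.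
  move: (nc w1) (nc w2) => a b.
  rewrite (_ : (a * c1 - b * c2) ^+ 2 + (a * s1 - b * s2) ^+ 2 = a ^+ 2 * (c1 ^+ 2 + s1 ^+ 2) + b ^+ 2 * (c2 ^+ 2 + s2 ^+ 2) - 2 * a * b * (c1 * c2 + s1 * s2)); last by ring.
  by rewrite e1 e2; ring.
have hD := cos_upper (same_side_bound ss); rewrite -/D in hD.
have A0 : 0 < A by exact: lt_le_trans A1.
rewrite ler_pdivlMr// -(@ler_pXn2r _ 2)// ?nnegrE ?mulr_ge0 ?nc_ge0// ?(ltW A0)//.
rewrite !exprMn real_normK ?num_real// law.
have h1 : 2 * (nc w1 * nc w2) * (D ^+ 2 / 8) <= 2 * (nc w1 * nc w2) * (1 - cos D).
  by rewrite ler_wpM2l// !mulr_ge0// ltW.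
have h2 : nc w1 * nc w1 * D ^+ 2 <= A * (nc w1 * nc w2) * D ^+ 2.
  by rewrite ler_wpM2r ?sqr_ge0// mulrCA ler_pM2l.
have h3 : A * (2 * (nc w1 * nc w2) * (D ^+ 2 / 8)) <= A ^+ 2 * (2 * (nc w1 * nc w2) * (D ^+ 2 / 8)).
  apply: ler_wpM2r; last by rewrite ler_eXnr.
  by apply: mulr_ge0; [rewrite !mulr_ge0 ?nc_ge0|rewrite divr_ge0// sqr_ge0].
have h4 := ler_wpM2l (sqr_ge0 A) h1.
have h5 : 0 <= A ^+ 2 * (nc w1 - nc w2) ^+ 2 by rewrite mulr_ge0// sqr_ge0.
move: h2 h3 h4 h5; rewrite !expr2.
move: (nc w1) (nc w2) (1 - cos D) => a b e.
lra.
Qed.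

(** The modulus is changed first and the argument second; each change costs a relative error of
    order |w1 - w2| / |w1|. *)
Lemma cpow_diff (A p : R) : 1 <= A -> exists2 K, 0 < K & forall w1 w2 : C,
  w1 != 0 -> w2 != 0 -> same_side w1 w2 -> nc w1 <= A * nc w2 -> nc w2 <= A * nc w1 ->
  nc (cpow w1 p - cpow w2 p) <= K * nc (w1 - w2) * nc w1 `^ (p - 1).
Proof.
move=> A1; have A0 : 0 < A by exact: lt_le_trans A1.
(* One term for the modulus, one for the argument; the final 1 keeps K positive when p = 0. *)
pose K := `|p| * A `^ `|p - 1| + A `^ `|p| * (2 * `|p| * (2 * A)) + 1.
exists K => [|w1 w2 w10 w20 ss h12 h21].
  by rewrite /K ltr_wpDl// addr_ge0// !mulr_ge0 ?powR_ge0// (ltW A0).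
have r1 := nc_gt0 w10; have r2 := nc_gt0 w20.
have -> : cpow w1 p - cpow w2 p = (nc w1 `^ p - nc w2 `^ p)%:C%C * cis (p * carg w1)
    + (nc w2 `^ p)%:C%C * (cis (p * carg w1) - cis (p * carg w2)).
  by rewrite rmorphB /= /cpow; ring.
apply: le_trans (le_normcD _ _) _.
rewrite !Normc.normcM nc_cis mulr1 nc_real nc_pos ?powR_ge0//.
have h1 := powR_diff p A1 r1 r2 h21 h12.
have h2 : `|nc w1 - nc w2| <= nc (w1 - w2).
  by rewrite ler_norml nc_Bge andbT lerNl opprB nc_distC nc_Bge.
have h3 := nc_cisB (p * carg w1) (p * carg w2).
rewrite -mulrBr normrM in h3.
have h4 := carg_diff A1 w10 w20 ss h12.
have h5 := powR_comparable p A1 r1 r2 h21 h12.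
have e : nc w1 `^ p = nc w1 `^ (p - 1) * nc w1.
  by rewrite -{3}[nc w1]powRr1 ?ltW// -powRD ?subrK// (gt_eqF r1) implybT.
have n0 := nc_ge0 (w1 - w2).
have P0 : 0 <= nc w1 `^ (p - 1) by exact: powR_ge0.
have Q1 : 0 <= `|p| * A `^ `|p - 1| by rewrite mulr_ge0// powR_ge0.
have Q2 : 0 <= A `^ `|p| by exact: powR_ge0.
have s1 : `|nc w1 `^ p - nc w2 `^ p| <= `|p| * A `^ `|p - 1| * (nc (w1 - w2) * nc w1 `^ (p - 1)).
  apply: le_trans h1 _; rewrite -!mulrA ler_wpM2l// ler_wpM2l ?powR_ge0// mulrC.
  by rewrite ler_wpM2r.
have s2 : nc w2 `^ p * nc (cis (p * carg w1) - cis (p * carg w2)) <=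
    A `^ `|p| * (2 * `|p| * (2 * A)) * (nc (w1 - w2) * nc w1 `^ (p - 1)).
  apply: (@le_trans _ _ (A `^ `|p| * nc w1 `^ p * (2 * (`|p| * (2 * A * nc (w1 - w2) / nc w1))))).
    apply: ler_pM; rewrite ?powR_ge0 ?nc_ge0//.
    apply: le_trans h3 _; rewrite ler_pM2l// ler_wpM2l//.
  rewrite e le_eqVlt; apply/orP; left; apply/eqP; field.
  by rewrite gt_eqF.
apply: le_trans (lerD s1 s2) _.
rewrite -mulrDl -[leRHS]mulrA; apply: ler_wpM2r; first by rewrite mulr_ge0.
by rewrite /K lerDl.
Qed.

Section resolvent_symbol.
Variable alpha : R.
Hypothesis a01 : 0 < alpha < 1.

Let s := sin (alpha * pi).

Lemma sin_alpha_gt0 : 0 < s.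
Proof.
case/andP: a01 => a0 a1; apply: sin_gt0_pi; rewrite mulr_gt0 ?pi_gt0//=.
by rewrite gtr_pMl ?pi_gt0.
Qed.

(** The argument of w^alpha is at most alpha pi in absolute value. With r = |w|^alpha and c0 =
    cos(alpha pi), |w^alpha + mu|^2 >= r^2 + 2 r mu c0 + mu^2 = (r sin(alpha pi))^2 + (mu + r c0)^2.
    The bound does not involve mu, which is the source of uniformity in the mesh. *)
Lemma cpow_add_lower (mu : R) (w : C) : 0 < mu ->
  s * nc w `^ alpha <= nc (cpow w alpha + mu%:C%C).
Proof.
move=> mu0; case/andP: a01 => a0 a1.
have s0 := sin_alpha_gt0.
have r0 : 0 <= nc w `^ alpha by exact: powR_ge0.
rewrite -(@ler_pXn2r _ 2)// ?nnegrE ?nc_ge0 ?mulr_ge0 ?(ltW s0)//.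
rewrite nc_sqr cReD cImD /cpow Re_polar Im_polar /=.
have hc : cos (alpha * pi) <= cos (alpha * carg w).
  rewrite -[cos (_ * carg w)]cos_norm leNgt ltr_cos ?in_itv/= ?normr_ge0 ?mulr_ge0 ?pi_ge0 ?(ltW a0)//=.
  - by rewrite -leNgt normrM (gtr0_norm a0) ler_pM2l// ler_norml carg_bounds.
  - by rewrite ger_pMl ?pi_gt0// ltW.
  - rewrite normrM (gtr0_norm a0).
    have hp : `|carg w| <= pi by rewrite ler_norml carg_bounds.
    by apply: le_trans hp; rewrite ler_piMl// ltW.
have e1 := cos2Dsin2 (alpha * pi); have e2 := cos2Dsin2 (alpha * carg w).
have h1 : 0 <= 2 * (nc w `^ alpha * mu) * (cos (alpha * carg w) - cos (alpha * pi)).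
  by rewrite !mulr_ge0 ?(ltW mu0)// subr_ge0.
rewrite -/s in e1.
move: (cos (alpha * pi)) (cos (alpha * carg w)) (sin (alpha * carg w)) (nc w `^ alpha) e1 e2 h1 => c0 c t r e1 e2 h1.
rewrite addr0 exprMn.
have -> : s ^+ 2 = 1 - c0 ^+ 2 by rewrite -e1; ring.
have : (r * t) ^+ 2 = r ^+ 2 - (r * c) ^+ 2 by rewrite !exprMn -[X in X - _]mulr1 -e2; ring.
move=> ->.
have := sqr_ge0 (mu + c0 * r).
lra.
Qed.

Variable beta : R.

Definition Fsym (mu : R) (w : C) : C := cpow w beta / (cpow w alpha + mu%:C%C).

(** The factor 1/w is taken out, so that only the powers alpha and beta occur and the bound follows
    by homogeneity. *)
Definition dFsym (mu : R) (w : C) : C :=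
  (beta%:C%C * cpow w beta / (cpow w alpha + mu%:C%C)
   - alpha%:C%C * cpow w beta * cpow w alpha / (cpow w alpha + mu%:C%C) ^+ 2) / w.

Lemma cpow_add_neq0 mu w : 0 < mu -> w != 0 -> cpow w alpha + mu%:C%C != 0.
Proof.
move=> mu0 w0; apply/eqP => h; have := cpow_add_lower w mu0.
by rewrite h Normc.normc0 leNgt mulr_gt0 ?sin_alpha_gt0// powR_gt0// nc_gt0.
Qed.

Lemma nc_cpow_addV mu w : 0 < mu -> w != 0 ->
  nc (cpow w alpha + mu%:C%C)^-1 <= s^-1 * nc w `^ (- alpha).
Proof.
move=> mu0 w0; rewrite Normc.normcV powRN -invfM lef_pV2 ?posrE.
- exact: cpow_add_lower.
- by apply: nc_gt0; exact: cpow_add_neq0.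
- by rewrite mulr_gt0 ?sin_alpha_gt0// powR_gt0// nc_gt0.
Qed.

Lemma Fsym_bound mu w : 0 < mu -> w != 0 -> nc (Fsym mu w) <= s^-1 * nc w `^ (beta - alpha).
Proof.
move=> mu0 w0; rewrite /Fsym Normc.normcM nc_pow.
rewrite powRD; last by rewrite (gt_eqF (nc_gt0 w0)) implybT.
by rewrite mulrCA ler_wpM2l ?powR_ge0// nc_cpow_addV.
Qed.

(** With b = w^alpha + mu, the difference is (w1^beta - w2^beta) / b1 minus (w2^beta / b2) (w1^alpha
    - w2^alpha) / b1; mu cancels from the difference of denominators and [nc_cpow_addV] removes it
    from the quotients. *)
Lemma Fsym_diff (A : R) : 1 <= A -> exists2 K, 0 < K & forall mu w1 w2, 0 < mu ->
  w1 != 0 -> w2 != 0 -> same_side w1 w2 -> nc w1 <= A * nc w2 -> nc w2 <= A * nc w1 ->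
  nc (Fsym mu w1 - Fsym mu w2) <= K * nc (w1 - w2) * nc w1 `^ (beta - alpha - 1).
Proof.
move=> A1; have s0 := sin_alpha_gt0.
have [K1 K10 h1] := cpow_diff beta A1; have [K2 K20 h2] := cpow_diff alpha A1.
pose P := A `^ `|beta - alpha|; have P0 : 0 <= P by exact: powR_ge0.
exists (K1 / s + P / s ^+ 2 * K2 + 1) => [|mu w1 w2 mu0 w10 w20 ss h12 h21].
  by rewrite ltr_wpDl// addr_ge0// ?mulr_ge0// ?invr_ge0 ?exprn_ge0// ltW.
have r1 := nc_gt0 w10; have r2 := nc_gt0 w20.
set b1 := cpow w1 alpha + mu%:C%C; set b2 := cpow w2 alpha + mu%:C%C.
have b10 : b1 != 0 by exact: cpow_add_neq0.
have b20 : b2 != 0 by exact: cpow_add_neq0.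
have -> : Fsym mu w1 - Fsym mu w2 = (cpow w1 beta - cpow w2 beta) * b1^-1 -
    cpow w2 beta * b2^-1 * ((cpow w1 alpha - cpow w2 alpha) * b1^-1).
  have -> : cpow w1 alpha - cpow w2 alpha = b1 - b2 by rewrite /b1 /b2; ring.
  rewrite /Fsym -/b1 -/b2; field; by rewrite b10 b20.
apply: le_trans (nc_B _ _) _.
rewrite (Normc.normcM (_ - _)) (Normc.normcM (_ * _)) (Normc.normcM (cpow w2 beta)) (Normc.normcM (cpow w1 alpha - _)).
have e1 : nc (cpow w1 beta - cpow w2 beta) * nc b1^-1 <=
    K1 / s * (nc (w1 - w2) * nc w1 `^ (beta - alpha - 1)).
  have -> : K1 / s * (nc (w1 - w2) * nc w1 `^ (beta - alpha - 1)) =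
     K1 * nc (w1 - w2) * nc w1 `^ (beta - 1) * (s^-1 * nc w1 `^ (- alpha)).
    have -> : beta - alpha - 1 = beta - 1 + - alpha by ring.
    by rewrite powRD ?(gt_eqF r1) ?implybT//; ring.
  by apply: ler_pM; rewrite ?nc_ge0// ?h1// nc_cpow_addV.
have e2 : nc (cpow w2 beta) * nc b2^-1 * (nc (cpow w1 alpha - cpow w2 alpha) * nc b1^-1) <=
    P / s ^+ 2 * K2 * (nc (w1 - w2) * nc w1 `^ (beta - alpha - 1)).
  have f1 : nc (cpow w2 beta) * nc b2^-1 <= s^-1 * (P * nc w1 `^ (beta - alpha)).
    rewrite -Normc.normcM; apply: le_trans (Fsym_bound mu0 w20) _.
    by rewrite ler_wpM2l ?invr_ge0 ?(ltW s0)// powR_comparable.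
  have f2 : nc (cpow w1 alpha - cpow w2 alpha) * nc b1^-1 <=
      K2 * nc (w1 - w2) * nc w1 `^ (alpha - 1) * (s^-1 * nc w1 `^ (- alpha)).
    by apply: ler_pM; rewrite ?nc_ge0// ?h2// nc_cpow_addV.
  have -> : P / s ^+ 2 * K2 * (nc (w1 - w2) * nc w1 `^ (beta - alpha - 1)) =
     s^-1 * (P * nc w1 `^ (beta - alpha)) *
     (K2 * nc (w1 - w2) * nc w1 `^ (alpha - 1) * (s^-1 * nc w1 `^ (- alpha))).
    have -> : beta - alpha - 1 = (beta - alpha) + ((alpha - 1) + - alpha) by ring.
    rewrite powRD; last by rewrite (gt_eqF r1) implybT.
    rewrite (powRD (r := alpha - 1)); last by rewrite (gt_eqF r1) implybT.
    by field; rewrite gt_eqF.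
  by apply: ler_pM => //; rewrite mulr_ge0// nc_ge0.
apply: le_trans (lerD e1 e2) _.
rewrite -mulrDl -[leRHS]mulrA; apply: ler_wpM2r; first by rewrite mulr_ge0 ?nc_ge0 ?powR_ge0.
by rewrite lerDl.
Qed.

Lemma Fsym_cder mu (f : R -> C) t v : 0 < mu -> cder f t v -> slit (f t) ->
  cder (fun x => Fsym mu (f x)) t (dFsym mu (f t) * v).
Proof.
move=> mu0 hf sf; have f0 := slit_neq0 sf.
have b0 := cpow_add_neq0 mu0 f0.
have h1 := cder_pow beta hf sf.
have h2 := cderD (cder_pow alpha hf sf) (cder_cst mu%:C%C t).
apply: cder_ext (cderM h1 (cderV b0 h2)) _ _ => //.
rewrite /dFsym addr0; move: b0; set b := cpow (f t) alpha + _ => b0.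
by field; rewrite b0 f0.
Qed.

Lemma dFsym_bound mu w : 0 < mu -> w != 0 ->
  nc (dFsym mu w) <= (`|beta| / s + `|alpha| / s ^+ 2) * nc w `^ (beta - alpha - 1).
Proof.
move=> mu0 w0; have r0 := nc_gt0 w0; have s0 := sin_alpha_gt0.
have hb := nc_cpow_addV mu0 w0.
rewrite /dFsym Normc.normcM Normc.normcV.
have -> : nc w `^ (beta - alpha - 1) = nc w `^ (beta - alpha) * (nc w)^-1.
  by rewrite powRD ?(gt_eqF r0) ?implybT// powR_inv1// ltW.
rewrite [leRHS]mulrA; apply: ler_wpM2r; first by rewrite invr_ge0 nc_ge0.
apply: le_trans (nc_B _ _) _; rewrite mulrDl; apply: lerD.
  rewrite -mulrA Normc.normcM nc_real -mulrA ler_wpM2l//.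
  exact: Fsym_bound.
rewrite (Normc.normcM (_ * _ * _)) (Normc.normcM (_ * cpow w beta)) (Normc.normcM alpha%:C%C).
rewrite !nc_pow nc_real Normc.normcV ncX -!mulrA ler_wpM2l//.
have -> : s ^- 2 * nc w `^ (beta - alpha) = nc w `^ beta * (nc w `^ alpha * (s^-1 * nc w `^ (- alpha)) ^+ 2).
  have -> : nc w `^ (beta - alpha) = nc w `^ beta * nc w `^ (- alpha).
    by rewrite powRD// (gt_eqF r0) implybT.
  have e : nc w `^ alpha * nc w `^ (- alpha) = 1.
    by rewrite -powRD ?subrr ?powRr0// (gt_eqF r0) implybT.
  rewrite exprMn exprVn [X in _ = _ * X](_ : _ = s ^- 2 * (nc w `^ alpha * nc w `^ (- alpha)) * nc w `^ (- alpha)); last by ring.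
  by rewrite e mulr1 mulrCA.
rewrite ler_wpM2l ?powR_ge0// ler_wpM2l ?powR_ge0//.
rewrite -exprVn ler_pXn2r ?nnegrE ?invr_ge0 ?nc_ge0 ?mulr_ge0 ?invr_ge0 ?(ltW s0) ?powR_ge0//.
by rewrite -Normc.normcV.
Qed.

End resolvent_symbol.
End elementary.

(** * The generating function of the BDF schemes *)

Section bdf_polynomials.
Context {R : realType}.
Implicit Types (x Y : R).

(** The coefficients in powers of x - 1 are nonnegative. The quintic is the main part of
    [im_quotient] for k = 6 on the boundary of the disk, see [base] in [im_quotient_lower]. *)
Let quintic1 x : 1 <= x ->
  1/4 <= 149/150 + 247/750*x + 2/15*x^+2 + 82/75*x^+3 - 112/15*x^+4 + 16/3*x^+5.
Proof.
move=> h; have [u [u0 ->]] : exists u, 0 <= u /\ x = 1 + u.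
  by exists (x - 1); split; [rewrite subr_ge0|ring].
have := exprn_ge0 2 u0; have := exprn_ge0 3 u0; have := exprn_ge0 4 u0.
have := exprn_ge0 5 u0; move=> *; lra.
Qed.

Let quintic2 x : 0 <= x <= 4/5 ->
  1/4 <= 149/150 + 247/750*x + 2/15*x^+2 + 82/75*x^+3 - 112/15*x^+4 + 16/3*x^+5.
Proof.
move=> /andP[x0 hx]; have x3 := exprn_ge0 3 x0.
(* 7/10 completes the square in the two leading terms: 112/15 = 16/3 times 7/5. *)
have h1 : 0 <= x^+3 * (x - 7/10)^+2 by rewrite mulr_ge0 ?sqr_ge0.
have x2 : 0 <= x^+2 by exact: sqr_ge0.
have x34 : x^+3 <= 4/5 * x^+2 by rewrite exprS ler_wpM2r.
have x24 : x^+2 <= 4/5 * x by rewrite expr2 ler_wpM2r.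
lra.
Qed.

Let quintic3 x : 4/5 <= x <= 1 ->
  1/4 <= 149/150 + 247/750*x + 2/15*x^+2 + 82/75*x^+3 - 112/15*x^+4 + 16/3*x^+5.
Proof.
move=> /andP[hx x1].
have [v [v0 v1 ->]] : exists v, [/\ 0 <= v, v <= 1/5 & x = 1 - v].
  by exists (1-x); split; [lra|lra|ring].
have v2 : 0 <= v^+2 by exact: sqr_ge0.
have v3 := exprn_ge0 3 v0; have v4 := exprn_ge0 4 v0.
have w5 : v^+5 <= 1/5*v^+4 by rewrite exprS ler_wpM2r.
have w4 : v^+4 <= 1/5*v^+3 by rewrite exprS ler_wpM2r.
have w3 : v^+3 <= 1/5*v^+2 by rewrite exprS ler_wpM2r.
have w2 : v^+2 <= 1/5*v by rewrite expr2 ler_wpM2r.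
have := sqr_ge0 (v - 1/20).
lra.
Qed.

Let quintic x : 0 <= x ->
  1/4 <= 149/150 + 247/750*x + 2/15*x^+2 + 82/75*x^+3 - 112/15*x^+4 + 16/3*x^+5.
Proof.
move=> x0; have [h|/ltW h] := leP 1 x; first exact: quintic1.
have [h2|/ltW h2] := leP x (4/5); first by apply: quintic2; rewrite x0.
by apply: quintic3; rewrite h2.
Qed.

(** The polynomial of k = 5 on the boundary of the disk, with its lower coefficients rounded down;
    7/16 completes the square in the two leading terms. *)
Let quartic x : - (1/50) <= x ->
  1/4 <= 9/10 + 1/4*x + 1/20*x^+2 - 14/5*x^+3 + 16/5*x^+4.
Proof.
move=> h1; have h0 : 0 <= x + 1/50 by lra.
have [h|h] := lerP x 1; first by have := sqr_ge0 (x*(x-7/16)); nra.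
have : 0 <= x^+3 * (x - 1) by rewrite mulr_ge0 ?exprn_ge0//; lra.
have := sqr_ge0 x; nra.
Qed.

(* (x + iy)^j = C_j + i y S_j with S_(j+1) = x S_j + C_j and
   C_(j+1) = x C_j - y^2 S_j *)
Fixpoint pow_parts x Y (j : nat) : R * R :=
  if j is j'.+1 then
    let: (s, c) := pow_parts x Y j' in (x * s + c, x * c - Y * s)
  else (0, 1).

(** The imaginary part of [bdf_sum] at x + iy, divided by y, as a polynomial in x and Y = y^2;
    unlike the quotient it also makes sense on the real axis. *)
Definition im_quotient k x Y : R := \sum_(1 <= j < k.+1) j%:R^-1 * (pow_parts x Y j).1.

(** For k <= 4 elementary inequalities suffice. For k = 5 and 6 the quotient is expanded in the
    slack u = 2 x - x^2 + 1/50 - Y >= 0: its value at u = 0 is at least 1/4 by the one-variable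
    bounds above, the coefficient of u is nonnegative, and so is the term in u^2. The margin 1/50
    leaves room for the part of the contour in the left half plane. *)
Lemma im_quotient_lower k x Y : (1 <= k <= 6)%N -> 0 <= Y -> Y <= 2 * x - x ^+ 2 + 1 / 50 ->
  1 / 4 <= im_quotient k x Y.
Proof.
move=> hk Y0 Yx; rewrite /im_quotient.
have x0 : - (1/50) <= x by nra.
have x3 : x <= 3 by nra.
have hx2 := sqr_ge0 x.
case: k hk => [//|[|[|[|[|[|[|//]]]]]]] _; rewrite unlock /= ?addr0.
- lra.
- lra.
- nra.
- have h4 : 0 <= (1/3 + x) * (2 * x - x ^+ 2 + 1 / 50 - Y) by apply: mulr_ge0; lra.
  have : 0 <= (x+1/50)*x^+2 by apply: mulr_ge0; lra.
  nra.
- have [u uE u0] : exists2 u, Y = 2 * x - x ^+ 2 + 1/50 - u & 0 <= u.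
    by exists (2 * x - x ^+ 2 + 1/50 - Y); [ring|lra].
  have := quartic x0; have h5 : 0 <= (x+1/50)*x^+2 by apply: mulr_ge0; lra.
  have h6 : 0 <= u * (1/3 + x + 2 * x ^+ 2 - 2/5 * (2 * x - x ^+ 2 + 1/50)).
    apply: mulr_ge0 => //; nra.
  have := sqr_ge0 u; rewrite uE; lra.
have [u uE u0] : exists2 u, Y = 2 * x - x ^+ 2 + 1/50 - u & 0 <= u.
  by exists (2 * x - x ^+ 2 + 1/50 - Y); [ring|lra].
have h7 : 0 <= (x + 1/50) * u ^+ 2 by apply: mulr_ge0; [lra|exact: sqr_ge0].
have h8 := sqr_ge0 u.
(* the factor of u is minus the derivative in Y on the boundary u = 0 *)
have h6 : 0 <= u * (1/3 + x + 2 * x ^+ 2 + 10/3 * x ^+ 3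
    - 2 * (1/5 + x) * (2 * x - x ^+ 2 + 1/50)).
  apply: mulr_ge0 => //; have [xp|xn] := leP 0 x.
    have : 0 <= x * (x - 1/5) ^+ 2 by rewrite mulr_ge0 ?sqr_ge0.
    have := exprn_ge0 3 xp; lra.
  have : 0 <= (x + 1/50) * x ^+ 2 by apply: mulr_ge0; lra.
  nra.
have base : 1/4 <= 1 - 1/150 + (1/3 - 1/250) * x + 2/15*x^+2 + (6/5 - 8/75) * x^+3 - 112/15*x^+4 + 16/3*x^+5
   + 1/50 * (8/5) * x ^+ 2 + 1/50 * (1/50) * (1/5 + x).
  have [xp|xn] := leP 0 x; first by have := quintic xp; lra.
  have [v [v0 v1 ->]] : exists v, [/\ 0 <= v, v <= 1/50 & x = - v].
    by exists (- x); split; [lra|lra|ring].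
  have v3 := exprn_ge0 3 v0; have v4 := exprn_ge0 4 v0.
  have w5 : v^+5 <= 1/50*v^+4 by rewrite exprS ler_wpM2r.
  have w4 : v^+4 <= 1/50*v^+3 by rewrite exprS ler_wpM2r.
  have w3 : v^+3 <= 1/50*v^+2 by rewrite exprS ler_wpM2r// sqr_ge0.
  have w2 : v^+2 <= 1/50*v by rewrite expr2 ler_wpM2r.
  have := sqr_ge0 v; lra.
rewrite uE; lra.
Qed.

End bdf_polynomials.

(** * Stability and accuracy of the BDF symbol *)

Section bdf_symbol.
Context {R : realType}.
Local Notation C := R[i].
Local Notation nc := (@Normc.normc R).
Local Notation Re := (@complex.Re R).
Local Notation Im := (@complex.Im R).
Implicit Types (z w : C).

Definition bdf_sum k w : C := \sum_(1 <= j < k.+1) j%:R^-1 * w ^+ j.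

(* equivalent to |1 - w|^2 <= 51/50; contains 1 - e^{-z} for Re z >= - 1/200 *)
Definition near_disk w := Im w ^+ 2 <= 2 * Re w - Re w ^+ 2 + 1 / 50.

Lemma pow_partsE w j : w ^+ j = ((pow_parts (Re w) (Im w ^+ 2) j).2)%:C%C +
  (Im w * (pow_parts (Re w) (Im w ^+ 2) j).1)%:C%C * 'i%C.
Proof.
elim: j => [|j IH]; first by rewrite /= mulr0 mul0r addr0.
rewrite exprS IH /=; case: (pow_parts _ _ _) => s c /=.
by apply: complex_ext; rewrite !(cReD, cImD, cReM, cImM) /=; ring.
Qed.

Lemma natrC j : j%:R = (j%:R : R)%:C%C :> C. Proof. by rewrite rmorph_nat. Qed.

Lemma natrVC j : j%:R^-1 = ((j%:R : R)^-1)%:C%C :> C.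
Proof. by rewrite natrC fmorphV. Qed.

Lemma bdf_sum_Im k w : Im (bdf_sum k w) = Im w * im_quotient k (Re w) (Im w ^+ 2).
Proof.
rewrite /bdf_sum /im_quotient mulr_sumr.
rewrite (big_morph Im (id1 := 0) (op1 := +%R))//; last by move=> a b; rewrite cImD.
apply: eq_bigr => j _; rewrite natrVC pow_partsE.
by rewrite !(cReD, cImD, cReM, cImM) /=; ring.
Qed.

Lemma near_disk_bounds w : near_disk w -> [/\ - (1/50) <= Re w, Re w <= 3 & nc w <= 3].
Proof.
rewrite /near_disk => h; have y0 := sqr_ge0 (Im w); split; [nra|nra|].
rewrite -(@ler_pXn2r _ 2)// ?nnegrE ?nc_ge0// nc_sqr.
have : Re w <= 3 by nra.
lra.
Qed.

(** For x >= 0 all terms of p are nonnegative and the first is 1. For x in [-1/50, 0) each of the at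
    most five further terms costs at most 1/50. *)
Lemma bdf_sum_real_lower k x : (1 <= k <= 6)%N -> - (1/50) <= x ->
  exists2 p : R, bdf_sum k x%:C%C = (x * p)%:C%C & 1 / 2 <= p.
Proof.
move=> /andP[k1 k6] x0.
exists (\sum_(1 <= j < k.+1) j%:R^-1 * x ^+ j.-1).
  rewrite mulr_sumr rmorph_sum /=; apply: eq_big_nat => j /andP[j1 _].
  rewrite natrVC -rmorphXn -rmorphM /=; congr (_%:C)%C.
  by rewrite mulrCA -exprS prednK.
have key n : 1 - n%:R / 50 <= \sum_(1 <= j < n.+2) j%:R^-1 * x ^+ j.-1.
  elim: n => [|n IH]; first by rewrite big_nat1 invr1 mul1r expr0 mul0r subr0.
  have [j0 j1] : 0 <= (n.+2%:R : R)^-1 /\ (n.+2%:R : R)^-1 <= 1.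
    by rewrite invr_ge0 ler0n invf_le1 ?ltr0n// ler1n.
  rewrite big_nat_recr//= -[n.+1%:R]natr1 mulrDl opprD addrA; apply: lerD; first exact: IH.
  have [xp|xn] := leP 0 x.
    by apply: (@le_trans _ _ 0); [lra|rewrite mulr_ge0// exprn_ge0].
  have h : `|n.+2%:R^-1 * x ^+ n.+1| <= 1/50.
    rewrite normrM (ger0_norm j0) -[leRHS]mul1r; apply: ler_pM => //.
    rewrite normrX exprS -[leRHS]mulr1; apply: ler_pM => //.
      by rewrite ltr0_norm//; lra.
    by apply: exprn_ile1 => //; rewrite ltr0_norm//; lra.
  by move: h; rewrite ler_norml => /andP[h _].
case: k k1 k6 => // k _ k6; apply: le_trans (key k).
have : k%:R <= (5%:R : R) by rewrite ler_nat.
by move: (k%:R : R) => a; lra.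
Qed.

Lemma expr_real_diff j : exists2 K : R, 0 <= K & forall w, nc w <= 3 ->
  nc (w ^+ j - (Re w)%:C%C ^+ j) <= K * `|Im w|.
Proof.
elim: j => [|j [K K0 IH]].
  by exists 0 => // w _; rewrite !expr0 subrr Normc.normc0 mul0r.
exists (3 * K + 3 ^+ j) => [|w w3]; first by rewrite addr_ge0// ?mulr_ge0// exprn_ge0.
have -> : w ^+ j.+1 - (Re w)%:C%C ^+ j.+1 =
   w * (w ^+ j - (Re w)%:C%C ^+ j) + (w - (Re w)%:C%C) * (Re w)%:C%C ^+ j.
  by rewrite !exprS; ring.
apply: le_trans (le_normcD _ _) _; rewrite !Normc.normcM mulrDl; apply: lerD.
  by rewrite -mulrA; apply: ler_pM; rewrite ?nc_ge0// IH.
rewrite mulrC; apply: ler_pM; rewrite ?nc_ge0// ?ncX.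
  apply: lerXn2r; rewrite ?nnegrE ?nc_ge0// nc_real.
  exact: le_trans (nc_Re_le _) w3.
have -> : w - (Re w)%:C%C = (Im w)%:C%C * 'i%C.
  by apply: complex_ext; rewrite !(cReD, cImD, cReM, cImM, cReN, cImN) /=; ring.
by rewrite Normc.normcM nc_real /Normc.normc /= expr0n/= add0r expr1n sqrtr1 mulr1.
Qed.

Lemma bdf_sum_real_diff k : exists2 K : R, 0 <= K & forall w, nc w <= 3 ->
  nc (bdf_sum k w - bdf_sum k (Re w)%:C%C) <= K * `|Im w|.
Proof.
elim: k => [|k [K K0 IH]].
  by exists 0 => // w _; rewrite /bdf_sum !big_geq// subrr Normc.normc0 mul0r.
have [L L0 hL] := expr_real_diff k.+1.
exists (K + L) => [|w w3]; first exact: addr_ge0.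
rewrite /bdf_sum !(big_nat_recr k.+1)//= -/(bdf_sum k w) -/(bdf_sum k (Re w)%:C%C).
set p := bdf_sum k w; set q := bdf_sum k (Re w)%:C%C.
rewrite (_ : _ - _ = p - q + k.+1%:R^-1 * (w ^+ k.+1 - (Re w)%:C%C ^+ k.+1)); last by ring.
apply: le_trans (le_normcD _ _) _; rewrite mulrDl; apply: lerD; first exact: IH.
rewrite Normc.normcM natrVC nc_real -[leRHS]mul1r; apply: ler_pM => //.
- exact: nc_ge0.
- by rewrite ger0_norm ?invr_ge0// invf_le1 ?ltr0n// ler1n.
- exact: hL.
Qed.

(** Two bounds are combined: the imaginary part gives |Im w| / 4, and comparison with the value at
    Re w gives |Re w| / 2 - K |Im w|, which is useful where Im w is small. *)
Lemma bdf_sum_lower k : (1 <= k <= 6)%N ->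
  exists2 c : R, 0 < c & forall w, near_disk w -> c * nc w <= nc (bdf_sum k w).
Proof.
move=> hk; have [K K0 hK] := bdf_sum_real_diff k.
have K1 : 0 < K + 1 by rewrite ltr_wpDl.
(* The two bounds add up to |Re w| + |Im w| <= (8 K + 6) |delta|, and 8 K + 6 <= 16 (K + 1). *)
pose c : R := (16 * (K + 1))^-1; have c0 : 0 < c by rewrite invr_gt0 mulr_gt0.
have c1 : c * (16 * (K + 1)) = 1 by rewrite mulVf// gt_eqF// mulr_gt0.
have c16 : c <= 1/16 by move: c1; nra.
exists c => // w nw; have [x0 x3 w3] := near_disk_bounds nw.
have n0 := nc_ge0 w; have y0 := normr_ge0 (Im w).
have hI : 1/4 * `|Im w| <= nc (bdf_sum k w).
  apply: le_trans (nc_Im_le _); rewrite bdf_sum_Im normrM mulrC ler_wpM2l//.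
  by apply: le_trans (ler_norm _); apply: im_quotient_lower => //; exact: sqr_ge0.
have [p pE p2] := bdf_sum_real_lower hk x0.
have hR : `|Re w| * p - K * `|Im w| <= nc (bdf_sum k w).
  have p0 : 0 <= p by lra.
  have := nc_Bge (bdf_sum k (Re w)%:C%C) (bdf_sum k (Re w)%:C%C - bdf_sum k w).
  have -> : bdf_sum k (Re w)%:C%C - (bdf_sum k (Re w)%:C%C - bdf_sum k w) = bdf_sum k w by ring.
  rewrite {1}pE nc_real normrM (ger0_norm p0) => h.
  apply: le_trans h; rewrite lerB// nc_distC; exact: hK.
have hw := nc_le_ReIm w.
have hx := normr_ge0 (Re w).
have hxp : `|Re w| * (1/2) <= `|Re w| * p by rewrite ler_wpM2l.
move: (`|Re w|) (`|Im w|) (nc (bdf_sum k w)) (nc w) hI hR hw hx hxp y0 n0 => a b d e hI hR hw hx hxp y0 n0.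
have h1 : c * e <= c * (a + b) by rewrite ler_wpM2l// ltW.
have h2 : a / 2 <= (4 * K + 1) * d.
  have : K * b <= K * (4 * d) by rewrite ler_wpM2l//; lra.
  lra.
have h3 : a + b <= (8 * K + 6) * d by lra.
have d0 : 0 <= d by apply: le_trans hI; rewrite mulr_ge0.
have h4 : c * (a + b) <= c * ((8 * K + 6) * d) by rewrite ler_wpM2l// ltW.
have h5 : c * ((8 * K + 6) * d) <= c * (16 * (K + 1)) * d.
  by rewrite -mulrA ler_wpM2l ?(ltW c0)// ler_wpM2r//; lra.
by rewrite c1 mul1r in h5; lra.
Qed.

Lemma slit_bdf_sum k w : (1 <= k <= 6)%N -> near_disk w -> slit w -> slit (bdf_sum k w).
Proof.
move=> hk nw; have [x0 x3 w3] := near_disk_bounds nw.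
have hQ := im_quotient_lower hk (sqr_ge0 (Im w)) nw.
have [y0|y0] := eqVneq (Im w) 0; last first.
  move=> _; apply/orP; right; rewrite bdf_sum_Im mulf_neq0// gt_eqF//.
  by apply: lt_le_trans hQ.
rewrite /slit y0 eqxx orbF => xp.
have [p pE p2] := bdf_sum_real_lower hk x0.
have -> : w = (Re w)%:C%C by apply: complex_ext.
by rewrite pE /= mulr_gt0//; lra.
Qed.

(** On the negative axis the argument is pi although the imaginary part is 0; [slit] excludes this
    case. *)
Lemma slit_carg_le0 w : slit w -> Im w <= 0 -> carg w <= 0.
Proof.
move=> sw y0; rewrite /carg; case: ifPn => [y1|_].
  have yE : Im w = 0 by apply/eqP; rewrite eq_le y0.
  move: sw; rewrite /slit yE eqxx orbF => x0.
  have -> : nc w = Re w.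
    by rewrite -[in LHS](_ : (Re w)%:C%C = w) ?nc_pos ?ltW//; apply: complex_ext.
  by rewrite divff ?gt_eqF// acos1.
rewrite oppr_le0; apply: acos_ge0.
rewrite -ler_norml normrM normfV (ger0_norm (nc_ge0 w)).
by rewrite ler_pdivrMr ?nc_gt0 ?slit_neq0// mul1r nc_Re_le.
Qed.

(* contains z tau for z on the truncated contour, where |z tau| <= 8 and
   cos theta >= - 1/2000 *)
Definition bdf_region z := [/\ - (1/200) <= Re z, Re z <= 2 & `|Im z| <= pi].

Definition bdf_arg z : C := 1 - cexp (- z).

Lemma Re_bdf_arg z : Re (bdf_arg z) = 1 - expR (- Re z) * cos (Im z).
Proof. by rewrite /bdf_arg cReD cReN Re_polar cReN cImN cosN. Qed.

Lemma Im_bdf_arg z : Im (bdf_arg z) = expR (- Re z) * sin (Im z).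
Proof. by rewrite /bdf_arg cImD cImN Im_polar cReN cImN sinN /= mulrN opprK add0r. Qed.

Lemma nc_bdf_arg z : nc (bdf_arg z) ^+ 2 =
  (1 - expR (- Re z)) ^+ 2 + 2 * expR (- Re z) * (1 - cos (Im z)).
Proof.
rewrite nc_sqr Re_bdf_arg Im_bdf_arg; have := cos2Dsin2 (Im z).
move: (expR _) (cos _) (sin _) => e c s h.
transitivity (1 - 2 * e * c + e ^+ 2 * (c ^+ 2 + s ^+ 2)); first by ring.
by rewrite h; ring.
Qed.

Lemma expR_region z : bdf_region z -> expR (- Re z) <= 200 / 199.
Proof.
move=> [h _ _].
have h1 := expR_ge1Dx (Re z).
have h2 : 199 / 200 <= 1 + Re z by lra.
have h3 : 199 / 200 <= expR (Re z) by exact: le_trans h1.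
have e0 : 0 < expR (Re z) by exact: expR_gt0.
by rewrite expRN -[_^-1]mul1r ler_pdivrMr//; lra.
Qed.

(** |1 - w| = e^(-Re z) <= 200/199, whose square is below 51/50. *)
Lemma near_disk_bdf_arg z : bdf_region z -> near_disk (bdf_arg z).
Proof.
move=> rz; rewrite /near_disk.
have he := expR_region rz; have e0 := expR_gt0 (- Re z).
have : nc (bdf_arg z) ^+ 2 <= 2 * Re (bdf_arg z) + 1/50.
  rewrite nc_bdf_arg Re_bdf_arg; move: (expR _) he e0 (cos _) => e he e0 c.
  have : e ^+ 2 <= 200/199 * (200/199) by rewrite expr2 ler_pM// ltW.
  lra.
by rewrite nc_sqr; lra.
Qed.

(** w is real only if sin(Im z) = 0, that is for Im z = 0 or, at the ends of the closed strip, Im z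
    = pi or -pi. In the first case w = 1 - e^(-Re z) with Re z > 0, in the others w = 1 + e^(-Re
    z). *)
Lemma slit_bdf_arg z : bdf_region z -> slit z -> slit (bdf_arg z).
Proof.
move=> [h1 h2 h3] sz; rewrite /slit Re_bdf_arg Im_bdf_arg.
have e0 := expR_gt0 (- Re z).
have [s0|s0] := eqVneq (sin (Im z)) 0; last by rewrite mulf_neq0 ?orbT// gt_eqF.
apply/orP; left; have := sin0cos1 s0.
have [y0|y0] := eqVneq (Im z) 0.
  rewrite y0 cos0 mulr1 => _; rewrite subr_gt0 -expR0 ltr_expR oppr_lt0.
  by move: sz; rewrite /slit y0 eqxx orbF.
have [c0|c0] := ltP (cos (Im z)) 0.
  rewrite ltr0_norm// => h; have -> : cos (Im z) = -1 by rewrite -h opprK.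
  by rewrite mulrN1 opprK addr_gt0.
rewrite ger0_norm// => h.
have : 0 < sin `|Im z| / 1 \/ `|Im z| = pi.
  have [e|ne] := eqVneq `|Im z| pi; [by right|left].
  by rewrite divr1; apply: sin_gt0_pi; rewrite normr_gt0 y0 lt_neqAle ne h3.
case=> [|hp]; last by move: h; rewrite -cos_norm hp cospi; lra.
rewrite divr1; have [yp|yn] := leP 0 (Im z); first by rewrite ger0_norm// s0 ltxx.
by rewrite ltr0_norm// sinN s0 oppr0 ltxx.
Qed.

(** Both terms of [nc_bdf_arg] are bounded separately, the first by Re z and the second by Im z
    through [cos_upper]; E = e^(-2) bounds e^(-Re z) from below because Re z <= 2. *)
Lemma bdf_arg_lower : exists2 c : R, 0 < c & forall z, bdf_region z -> c * nc z <= nc (bdf_arg z).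
Proof.
pose E : R := expR (- 2); have E0 : 0 < E by exact: expR_gt0.
have E1 : E <= 1 by rewrite -expR0 ler_expR; lra.
exists (E / 4) => [|z rz]; first by rewrite divr_gt0.
have [h1 h2 h3] := rz.
rewrite -(@ler_pXn2r _ 2)// ?nnegrE ?nc_ge0 ?mulr_ge0 ?nc_ge0 ?divr_ge0 ?(ltW E0)//.
rewrite exprMn (nc_sqr z) nc_bdf_arg.
have eE : E <= expR (- Re z) by rewrite ler_expR; lra.
have hc : Im z ^+ 2 / 8 <= 1 - cos (Im z) by apply: cos_upper; rewrite -ler_norml.
have hr : (E * Re z) ^+ 2 <= (1 - expR (- Re z)) ^+ 2.
  rewrite -[X in X <= _](real_normK (num_real _)) -[leRHS](real_normK (num_real _)).
  rewrite ler_pXn2r ?nnegrE//.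
  have [a0|/ltW a0] := leP 0 (Re z).
    have ea : expR (- Re z) <= 1 by rewrite -expR0 ler_expR oppr_le0.
    rewrite !ger0_norm ?mulr_ge0 ?subr_ge0 ?(ltW E0)//.
    have h := expR_ge1Dx (Re z).
    have : expR (- Re z) * (1 + Re z) <= 1.
      by rewrite expRN mulrC ler_pdivrMr ?expR_gt0// mul1r.
    have : E * Re z <= expR (- Re z) * Re z by rewrite ler_wpM2r.
    lra.
  have h := expR_ge1Dx (- Re z).
  rewrite normrM (ger0_norm (ltW E0)) (ler0_norm a0) ler0_norm; last by lra.
  have : E * - Re z <= - Re z by rewrite ler_piMl// oppr_ge0.
  lra.
have hc2 : E * (Im z ^+ 2 / 8) <= expR (- Re z) * (1 - cos (Im z)).
  by apply: ler_pM => //; [exact: ltW|rewrite divr_ge0 ?sqr_ge0].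
have hE2 : E ^+ 2 * (Im z ^+ 2) <= E * Im z ^+ 2.
  by rewrite ler_wpM2r ?sqr_ge0// expr2 ler_piMl// ltW.
have := sqr_ge0 (E * Im z); have := sqr_ge0 (E * Re z).
rewrite !exprMn in hr *; lra.
Qed.

Lemma bdf_arg_upper z : bdf_region z -> nc (bdf_arg z) <= 2 * nc z.
Proof.
move=> rz; have [h1 h2 h3] := rz; have he := expR_region rz; have e0 := expR_gt0 (- Re z).
rewrite -(@ler_pXn2r _ 2)// ?nnegrE ?nc_ge0 ?mulr_ge0 ?nc_ge0//.
rewrite exprMn (nc_sqr z) nc_bdf_arg.
have hc : 1 - cos (Im z) <= Im z ^+ 2 / 2.
  rewrite {1}(splitr (Im z)) -mulr2n cos_mulr2n -[_ *+ 2]mulr_natl cos2sin2.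
  have : sin (Im z / 2) ^+ 2 <= (Im z / 2) ^+ 2.
    rewrite -[leLHS](real_normK (num_real _)) -[leRHS](real_normK (num_real _)).
    rewrite ler_pXn2r ?nnegrE//.
    by have := norm_sinB (Im z / 2) 0; rewrite sin0 !subr0.
  lra.
have hr : (1 - expR (- Re z)) ^+ 2 <= 4 * Re z ^+ 2.
  have -> : 4 * Re z ^+ 2 = (2 * Re z) ^+ 2 by ring.
  rewrite -[leLHS](real_normK (num_real _)) -[leRHS](real_normK (num_real _)).
  rewrite ler_pXn2r ?nnegrE//.
  have h := expR_ge1Dx (- Re z).
  have [a0|/ltW a0] := leP 0 (Re z).
    have ea : expR (- Re z) <= 1 by rewrite -expR0 ler_expR oppr_le0.
    rewrite !ger0_norm ?mulr_ge0 ?subr_ge0//; lra.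
  have h' : expR (- Re z) * (1 + Re z) <= 1.
    by rewrite expRN mulrC ler_pdivrMr ?expR_gt0// mul1r expR_ge1Dx.
  have h'' : expR (- Re z) * (- Re z) <= 200/199 * (- Re z) by rewrite ler_wpM2r ?oppr_ge0.
  have e1 : 1 - expR (- Re z) <= 0 by lra.
  have e2 : 2 * Re z <= 0 by lra.
  by rewrite (ler0_norm e1) (ler0_norm e2); lra.
have hc2 : expR (- Re z) * (1 - cos (Im z)) <= 200/199 * (Im z ^+ 2 / 2).
  by apply: ler_pM.
have := sqr_ge0 (Im z); lra.
Qed.

Lemma bdf_sum_cder k (f : R -> C) t v : cder f t v ->
  cder (fun s => bdf_sum k (f s)) t ((\sum_(0 <= j < k) f t ^+ j) * v).
Proof.
move=> hf; elim: k => [|k IH].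
  apply: cder_ext (cder_cst 0 t) _ _ => [s|]; first by rewrite /bdf_sum big_geq.
  by rewrite big_geq// mul0r.
apply: cder_ext (cderD IH (cderZ (k.+1%:R^-1) (cderX k hf))) _ _ => [s|].
  by rewrite /bdf_sum [RHS](big_nat_recr k.+1).
rewrite big_nat_recr//= mulrDl; congr (_ + _).
by rewrite !mulrA mulVf ?mul1r// pnatr_eq0.
Qed.

(** The derivative of [bdf_sum] is a geometric sum in w, and the inner derivative e^(-z) = 1 - w
    collapses it to 1 - w^k. *)
Lemma bdf_symbol_cder k (f : R -> C) t v : cder f t v ->
  cder (fun s => bdf_sum k (bdf_arg (f s))) t ((1 - bdf_arg (f t) ^+ k) * v).
Proof.
move=> hf.
have h1 := cderB (cder_cst 1 t) (cder_exp (cderN hf)).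
apply: cder_ext (bdf_sum_cder k h1) _ _ => //.
rewrite -/(bdf_arg (f t)) sub0r -mulrN opprK mulrA; congr (_ * _).
have -> : cexp (- f t) = 1 - bdf_arg (f t) by rewrite /bdf_arg; ring.
by rewrite big_mkord -[LHS]opprK -[in LHS]mulrN opprB mulrC -subrX1 opprB.
Qed.

(** The error is integrated along the segment from 0 to z, which stays in the region. Its derivative
    there is - w^k z with |w| <= 2 |z|; the mean value theorem is applied to the real and imaginary
    parts separately, which costs the last factor 2. *)
Lemma bdf_accuracy k z : bdf_region z ->
  nc (bdf_sum k (bdf_arg z) - z) <= 2 ^+ k.+1 * nc z ^+ k.+1.
Proof.
move=> rz; have [z1 z2 z3] := rz.
pose E r := bdf_sum k (bdf_arg (r%:C%C * z)) - r%:C%C * z.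
have dl r : cder (fun r => r%:C%C * z) r z.
  apply: cder_ext (cderM (cder_real (is_derive_id r 1)) (cder_cst z r)) _ _ => //=.
  by rewrite mulr0 addr0 mul1r.
have dE r : cder E r (- (bdf_arg (r%:C%C * z) ^+ k * z)).
  apply: cder_ext (cderB (bdf_symbol_cder k (dl r)) (dl r)) _ _ => //.
  by ring.
have E0 : E 0 = 0.
  rewrite /E mul0r subr0 /bdf_arg oppr0 /cexp /= expR0 /cis cos0 sin0.
  rewrite /bdf_sum big1_seq// => j; rewrite mem_index_iota => /andP[_ /andP[j0 _]].
  have -> : 1 - 1%:C%C * (1 +i* 0)%C = 0 :> C by rewrite mul1r subrr.
  by rewrite expr0n; case: j j0 => //= j _; rewrite mulr0.
have reg r : 0 <= r <= 1 -> bdf_region (r%:C%C * z).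
  move=> /andP[r0 r1]; rewrite /bdf_region cReM cImM /= !mul0r subr0 addr0; split.
  - have [a0|a0] := leP 0 (Re z); first by rewrite (@le_trans _ _ 0) ?mulr_ge0//; lra.
    apply: le_trans z1 _; rewrite -subr_ge0.
    have -> : r * Re z - Re z = (1 - r) * - Re z by ring.
    by rewrite mulr_ge0//; lra.
  - have [a0|a0] := leP 0 (Re z); first by apply: le_trans z2; rewrite ler_piMl.
    by rewrite (@le_trans _ _ 0)// mulr_ge0_le0// ltW.
  - by rewrite normrM (ger0_norm r0); apply: le_trans z3; rewrite ler_piMl.
have bE r : 0 <= r <= 1 -> nc (- (bdf_arg (r%:C%C * z) ^+ k * z)) <= 2 ^+ k * nc z ^+ k.+1.
  move=> hr; rewrite normcN Normc.normcM ncX exprSr mulrA; apply: ler_wpM2r; first exact: nc_ge0.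
  rewrite -exprMn; apply: lerXn2r; rewrite ?nnegrE ?mulr_ge0 ?nc_ge0//.
  apply: le_trans (bdf_arg_upper (reg r hr)) _; rewrite ler_pM2l// Normc.normcM.
  by case/andP: hr => r0 r1; rewrite nc_pos// ler_piMl// nc_ge0.
apply: (@le_trans _ _ (nc (E 1))); first by rewrite /E mul1r.
apply: le_trans (nc_le_ReIm _) _.
have hR : `|Re (E 1) - Re (E 0)| <= 2 ^+ k * nc z ^+ k.+1 * (1 - 0).
  apply: (mean_value_bound (f := fun r => Re (E r)) (df := fun r => Re (- (bdf_arg (r%:C%C * z) ^+ k * z)))) => // r hr.
    by case: (dE r).
  exact: le_trans (nc_Re_le _) (bE r hr).
have hI : `|Im (E 1) - Im (E 0)| <= 2 ^+ k * nc z ^+ k.+1 * (1 - 0).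
  apply: (mean_value_bound (f := fun r => Im (E r)) (df := fun r => Im (- (bdf_arg (r%:C%C * z) ^+ k * z)))) => // r hr.
    by case: (dE r).
  exact: le_trans (nc_Im_le _) (bE r hr).
move: hR hI; rewrite E0 /= !subr0 mulr1 => hR hI.
by rewrite [2 ^+ k.+1]exprS -mulrA [leRHS]mulr_natl mulr2n lerD.
Qed.

End bdf_symbol.

(** * Contour integrals *)

Section real_integrals.
Context {R : realType}.
Local Notation leb := (@lebesgue_measure R).
Implicit Types (f g : R -> R).

Lemma measurable_continuous_on (D : set R) f : measurable D ->
  (forall x, D x -> {for x, continuous f}) -> measurable_fun D f.
Proof.
move=> mD cf; apply: subspace_continuous_measurable_fun => //.
by apply: continuous_in_subspaceT => x /set_mem Dx; exact: cf.
Qed.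

Lemma integral_exp_decay (a c : R) : 0 < c ->
  (\int[leb]_(x in `[a, +oo[) (expR (- c * x))%:E = (expR (- c * a) / c)%:E)%E.
Proof.
move=> c0.
have dF (x : R) : is_derive x 1 (fun x => - c^-1 * expR (- c * x)) (expR (- c * x)).
  have h1 : is_derive x 1 (fun x => - c * x) (- c).
    apply: is_derive_ext (is_derive_mul (is_derive_cst (- c) x 1) (is_derive_id x 1)) _ _ => //.
    by rewrite mul0r addr0 mulr1.
  apply: is_derive_ext (is_derive_mul (is_derive_cst (- c^-1) x 1) (is_derive_comp (is_derive_expR _) h1)) _ _ => //.
  by rewrite mul0r addr0 mulrA mulrNN mulVf ?mul1r// gt_eqF.
have cF (x : R) : {for x, continuous (fun x => - c^-1 * expR (- c * x))}.
  by apply: differentiable_continuous; apply/derivable1_diffP; case: (dF x).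
rewrite (@ge0_continuous_FTC2y _ _ (fun x => - c^-1 * expR (- c * x)) a 0).
- by rewrite sub0e -EFinN mulNr opprK mulrC.
- by move=> x _; exact: expR_ge0.
- apply: continuous_subspaceT => x.
  apply: (@continuous_comp _ _ _ (fun x => - c * x) expR); last exact: continuous_expR.
  by apply: continuousM; [exact: cst_continuous|exact: cvg_id].
- rewrite -[X in _ --> X](mulr0 (- c^-1)); apply: cvgM; first exact: cvg_cst.
  under eq_fun do rewrite mulNr.
  have h := @cvgr_expR R.
  apply: (cvg_comp (fun x => c * x) (fun x => expR (- x)) _ h).
  by apply: gt0_cvgMry => //; exact: cvg_id.
- by move=> x _; case: (dF x).
- by apply: cvg_at_right_filter; exact: cF.
- by move=> x _; rewrite derive1E; case: (dF x).
Qed.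

Lemma integrable_exp_decay (a c B : R) : 0 < c ->
  leb.-integrable `[a, +oo[ (fun x => (B * expR (- c * x))%:E).
Proof.
move=> c0.
have mf : measurable_fun (`[a, +oo[%classic : set R) (fun x => expR (- c * x)).
  apply: measurable_continuous_on => // x _.
  apply: (@continuous_comp _ _ _ (fun x => - c * x) expR); last exact: continuous_expR.
  by apply: continuousM; [exact: cst_continuous|exact: cvg_id].
have h : leb.-integrable `[a, +oo[ (fun x => (expR (- c * x))%:E).
  apply/integrableP; split; first exact/measurable_EFinP.
  rewrite (_ : (\int[leb]_(x in _) _)%E = (\int[leb]_(x in `[a, +oo[) (expR (- c * x))%:E)%E).
    by rewrite integral_exp_decay// ltry.
  by apply: eq_integral => x _; rewrite gee0_abs// lee_fin expR_ge0.
by have := @integrableZl _ _ _ leb _ (measurable_itv _) B _ h.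
Qed.

Lemma Rintegral_exp_decay_le (a c B : R) : 0 <= a -> 0 < c -> 0 <= B ->
  \int[leb]_(x in `[a, +oo[) (B * expR (- c * x)) <= B / c.
Proof.
move=> a0 c0 B0.
have h : leb.-integrable `[a, +oo[ (EFin \o (fun x => expR (- c * x))).
  have := @integrable_exp_decay a c 1 c0.
  by rewrite (_ : (fun x => (1 * expR (- c * x))%:E) = EFin \o (fun x => expR (- c * x)))//; apply/funext => x; rewrite mul1r.
rewrite RintegralZl// /Rintegral integral_exp_decay//= ler_wpM2l//.
rewrite -[leRHS]mul1r ler_wpM2r ?invr_ge0 ?(ltW c0)// -expR0 ler_expR.
by rewrite mulNr oppr_le0 mulr_ge0// ltW.
Qed.

Lemma integrable_dominated (D : set R) f g : measurable D ->
  (forall x, D x -> {for x, continuous f}) -> leb.-integrable D (EFin \o g) ->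
  (forall x, D x -> `|f x| <= g x) -> leb.-integrable D (EFin \o f).
Proof.
move=> mD cf ig fg; apply: (@le_integrable _ _ _ leb D mD (EFin \o f) (EFin \o g) _ _ ig).
  by apply/measurable_EFinP; exact: measurable_continuous_on.
move=> x Dx; rewrite /= lee_fin; apply: le_trans (fg x Dx) _; exact: ler_norm.
Qed.

Lemma integrable_segment (a b : R) f : (forall x, a <= x <= b -> {for x, continuous f}) ->
  leb.-integrable `[a, b] (EFin \o f).
Proof.
move=> cf; apply: continuous_compact_integrable; first exact: segment_compact.
by apply: continuous_in_subspaceT => x /set_mem /=; rewrite in_itv/=; exact: cf.
Qed.

(** f is extended by zero outside S, so that a single exponential dominates both the difference on
    the truncated ray and the tail of g. *)
Lemma Rintegral_diff_exp (S : set R) (a c B : R) f g :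
  0 <= a -> 0 < c -> 0 <= B -> measurable S -> S `<=` `[a, +oo[ ->
  leb.-integrable S (EFin \o f) -> leb.-integrable `[a, +oo[ (EFin \o g) ->
  (forall x, a <= x -> S x -> `|f x - g x| <= B * expR (- c * x)) ->
  (forall x, a <= x -> ~ S x -> `|g x| <= B * expR (- c * x)) ->
  `|\int[leb]_(x in S) f x - \int[leb]_(x in `[a, +oo[) g x| <= B / c.
Proof.
move=> a0 c0 B0 mS SJ iF ig hS hnS.
have E : \int[leb]_(x in S) f x = \int[leb]_(x in `[a, +oo[) (f \_ S) x.
  by rewrite -Rintegral_mkcondr setIidr.
have i1 : leb.-integrable `[a, +oo[ (EFin \o (f \_ S)).
  have := (@integrable_restrict _ _ _ leb S mS _ (measurable_itv `[a, +oo[) (EFin \o f)).1.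
  by rewrite setIidr// restrict_EFin; exact.
rewrite E -RintegralB//.
have i2 : leb.-integrable `[a, +oo[ (EFin \o (fun x => (f \_ S) x - g x)).
  by have := @integrableB _ _ _ leb _ (measurable_itv _) _ _ i1 ig.
apply: le_trans; first exact: (@le_normr_Rintegral _ _ _ leb _ _ (measurable_itv _) i2).
apply: le_trans (Rintegral_exp_decay_le a0 c0 B0).
apply: le_Rintegral => //.
- exact: (integrable_abse i2).
- exact: integrable_exp_decay.
- move=> x; rewrite /= in_itv/= andbT => ax; rewrite patchE; case: ifPn => [/set_mem Sx|/negP nS].
    exact: hS.
  by rewrite sub0r normrN; apply: hnS => // /mem_set.
Qed.

(** y <= e^y at y = x / (2 p), raised to the power p, gives x^p <= (2 p)^p e^(x/2). *)
Lemma powR_exp_bound (p : R) : exists2 K, 0 < K & forall x, 0 <= x -> 0 <= p -> x `^ p * expR (- x) <= K * expR (- (x / 2)).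
Proof.
have [p0|p0] := ltP 0 p; last first.
  exists 1 => // x x0 p1; have -> : p = 0 by apply/eqP; rewrite eq_le p0 p1.
  rewrite powRr0 !mul1r ler_expR lerN2; lra.
pose K := (2 * p) `^ p; have K0 : 0 < K by rewrite powR_gt0// mulr_gt0.
exists K => // x x0 _.
have h : x `^ p <= K * expR (x / 2).
  have -> : expR (x / 2) = expR (x / (2 * p)) `^ p.
    by rewrite -expRM; congr expR; field; rewrite gt_eqF.
  rewrite -powRM ?expR_ge0 ?mulr_ge0 ?(ltW p0)//.
  rewrite ge0_ler_powR ?nnegrE ?mulr_ge0 ?expR_ge0 ?(ltW p0)//.
  have := expR_ge1Dx (x / (2 * p)) => h.
  have h2 : x / (2 * p) <= expR (x / (2 * p)) by apply: le_trans h; rewrite lerDr.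
  have := ler_wpM2l (ltW (mulr_gt0 (ltr0n R 2) p0) : 0 <= 2 * p) h2.
  by rewrite mulrCA divff ?mulr1// gt_eqF// mulr_gt0.
have -> : expR (- (x / 2)) = expR (x / 2) * expR (- x) by rewrite -expRD; congr expR; field.
by rewrite mulrA ler_wpM2r ?expR_ge0.
Qed.

Lemma powR_exp_scaled (p : R) : 0 <= p -> exists2 K, 0 < K & forall c x, 0 < c -> 0 <= x ->
  x `^ p * expR (- c * x) <= K * c `^ (- p) * expR (- (c / 2) * x).
Proof.
move=> p0; have [K K0 hK] := powR_exp_bound p; exists K => // c x c0 x0.
have := hK (c * x) (mulr_ge0 (ltW c0) x0) p0.
rewrite powRM ?(ltW c0)// => h.
have -> : - (c / 2) * x = - (c * x / 2) by ring.
have -> : x `^ p * expR (- c * x) = c `^ (- p) * (c `^ p * x `^ p * expR (- (c * x))).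
  rewrite mulrA [c `^ (- p) * _]mulrA -powRD ?(gt_eqF c0) ?implybT//.
  by rewrite addrC subrr powRr0 mul1r mulNr.
by rewrite [K * _]mulrC -[_ * K * _]mulrA; apply: ler_wpM2l h; exact: powR_ge0.
Qed.

Lemma powR_exp_dominated (p a c : R) : 0 < a -> 0 < c -> exists K : R, forall x, a <= x ->
  x `^ p * expR (- c * x) <= K * expR (- (c / 2) * x).
Proof.
move=> a0 c0; have [p0|p0] := leP 0 p.
  have [K K0 hK] := powR_exp_scaled p0; exists (K * c `^ (- p)) => x ax.
  by apply: hK => //; exact: le_trans (ltW a0) ax.
exists (a `^ p) => x ax; have x0 := lt_le_trans a0 ax.
apply: ler_pM; rewrite ?powR_ge0 ?expR_ge0//.
  rewrite -[p]opprK [x `^ _]powRN [a `^ _]powRN lef_pV2 ?posrE ?powR_gt0//.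
  by rewrite ge0_ler_powR ?nnegrE ?oppr_ge0 ?(ltW p0) ?(ltW a0) ?(ltW x0).
by rewrite ler_expR !mulNr lerN2 ler_wpM2r ?(ltW x0)//; lra.
Qed.

Lemma Rintegral_derive (f F : R -> R) (a b : R) : a < b ->
  (forall x, a <= x <= b -> {for x, continuous f}) ->
  (forall x, a <= x <= b -> is_derive x 1 F (f x)) ->
  \int[leb]_(x in `[a, b]) f x = F b - F a.
Proof.
move=> ab cf dF.
have cF x : a <= x <= b -> {for x, continuous F}.
  by move=> h; apply: differentiable_continuous; apply/derivable1_diffP; case: (dF x h).
rewrite /Rintegral (@continuous_FTC2 _ f F a b)//.
- apply: continuous_in_subspaceT => x /set_mem /=; rewrite in_itv/=; exact: cf.
- split.
  + by move=> x; rewrite in_itv/= => /andP[h1 h2]; case: (dF x); rewrite ?(ltW h1) ?(ltW h2).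
  + by apply: cvg_at_right_filter; apply: cF; rewrite lexx ltW.
  + by apply: cvg_at_left_filter; apply: cF; rewrite lexx ltW.
- move=> x; rewrite in_itv/= => /andP[h1 h2]; rewrite derive1E.
  by case: (dF x); rewrite ?(ltW h1) ?(ltW h2).
Qed.

(* Cauchy's theorem on the region u < r < v, |t| <= theta in polar form:
   d h / d r = d k / d t = D *)
Lemma deformation (h k D : R -> R -> R) (u v a b theta M : R) :
  u < a -> a < b -> b < v -> 0 < theta ->
  (forall r t, u < r < v -> - theta <= t <= theta -> is_derive r 1 (h ^~ t) (D r t)) ->
  (forall r t, u < r < v -> - theta <= t <= theta -> is_derive t 1 (k r) (D r t)) ->
  (forall r t, u < r < v -> - theta <= t <= theta -> {for t, continuous (D r)}) ->
  (forall r t, u < r < v -> - theta <= t <= theta -> {for t, continuous (h r)}) ->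
  (forall r t, u < r < v -> - theta <= t <= theta -> `|D r t| <= M) ->
  (forall r, u < r < v -> {for r, continuous (k ^~ theta)} /\ {for r, continuous (k ^~ (- theta))}) ->
  \int[leb]_(t in `[- theta, theta]) h b t - \int[leb]_(t in `[- theta, theta]) h a t =
  \int[leb]_(r in `[a, b]) (k r theta - k r (- theta)).
Proof.
move=> ua ab bv th0 dh dk cD ch DM ck; have tN : - theta < theta by rewrite gtrN.
have inI r : `]u, v[%classic r -> u < r < v by rewrite /= in_itv.
have inT t : `[- theta, theta]%classic t -> - theta <= t <= theta by rewrite /= in_itv.
pose F r := \int[leb]_(t in `[- theta, theta]) h r t.
have M0 : 0 <= M.
  apply: le_trans (normr_ge0 _) (DM ((a + b) / 2) 0 _ _); last by rewrite oppr_le0 !ltW.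
  by apply/andP; split; lra.
have dF r : u < r < v -> is_derive r 1 F (k r theta - k r (- theta)).
  move=> ur.
  have intf x : `]u, v[%classic x -> leb.-integrable `[- theta, theta] (EFin \o h x).
    by move=> /inI ux; apply: integrable_segment => t ht; exact: ch.
  have derf x y : `]u, v[%classic x -> `[- theta, theta]%classic y -> derivable (h ^~ y) x 1.
    by move=> /inI ux /inT hy; case: (dh x y ux hy).
  have intG : leb.-integrable `[- theta, theta] (EFin \o (fun=> M)).
    by apply: integrable_segment => t _; exact: cst_continuous.
  have dhE x y : `]u, v[%classic x -> `[- theta, theta]%classic y -> partial1of2 h x y = D x y.
    by move=> /inI ux /inT hy; rewrite partial1of2E; case: (dh x y ux hy).
  have Gub x y : `]u, v[%classic x -> `[- theta, theta]%classic y -> `|partial1of2 h x y| <= M.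
    by move=> hx hy; rewrite dhE//; apply: DM; [exact: inI|exact: inT].
  have Ir : `]u, v[%classic r by rewrite /= in_itv.
  have F0 : forall t : R, 0 <= (fun=> M) t by [].
  have dE := @differentiation_under_integral R _ _ leb h _ (measurable_itv `[- theta, theta]) r u v Ir intf derf _ F0 intG Gub.
  split; first exact: (@derivable_under_integral R _ _ leb h _ (measurable_itv `[- theta, theta]) r u v Ir intf derf _ F0 intG Gub).
  rewrite -derive1E dE.
  rewrite (_ : \int[leb]_(y in _) _ = \int[leb]_(t in `[- theta, theta]) D r t); last first.
    by apply: eq_Rintegral => t /set_mem ht; rewrite dhE.
  by apply: (@Rintegral_derive (D r) (k r)) => // t ht; [exact: cD|exact: dk].
have -> : \int[leb]_(t in `[- theta, theta]) h b t - \int[leb]_(t in `[- theta, theta]) h a t = F b - F a by [].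
symmetry; apply: (@Rintegral_derive _ F) => // r /andP[r1 r2].
  have [c1 c2] : {for r, continuous (k ^~ theta)} /\ {for r, continuous (k ^~ (- theta))}.
    by apply: ck; apply/andP; split; lra.
  exact: continuousB.
by apply: dF; apply/andP; split; lra.
Qed.

End real_integrals.

(** * Cauchy's theorem and independence of the radius of the arc *)

Section contours.
Context {R : realType}.
Local Notation C := R[i].
Local Notation nc := (@Normc.normc R).
Local Notation Re := (@complex.Re R).
Local Notation Im := (@complex.Im R).
Local Notation leb := (@lebesgue_measure R).
Implicit Types (g dg : C -> C) (f : R -> C) (D : set C) (A : set R).

Lemma ray_cder (t r : R) : cder (fun x => x%:C%C * cis t) r (cis t).
Proof.
have h := cderM (cder_real (is_derive_id r 1)) (cder_cst (cis t) r).
by apply: cder_ext h _ _ => //; rewrite mulr0 addr0 mul1r.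
Qed.

Lemma arc_cder (r t : R) : cder (fun x => r%:C%C * cis x) t ('i%C * (r%:C%C * cis t)).
Proof.
have h := cderZ r%:C%C (cder_cis (is_derive_id t 1)).
by apply: cder_ext h _ _ => //; rewrite mul1r mulrCA.
Qed.

(* holomorphy on S, tested along differentiable curves; the second clause stands
   for the continuity of the derivative *)
Definition holo (S : C -> Prop) g dg := forall f t v, cder f t v -> S (f t) ->
  cder (fun x => g (f x)) t (dg (f t) * v) /\ exists v', cder (fun x => dg (f x)) t v'.

Definition Cintegrable A f :=
  leb.-integrable A (EFin \o (fun x => Re (f x))) /\
  leb.-integrable A (EFin \o (fun x => Im (f x))).

Lemma cis_cder (t : R) : cder (fun x => cis x : C) t ('i%C * cis t).
Proof. by apply: cder_ext (cder_cis (is_derive_id t 1)) _ _ => //; rewrite mul1r. Qed.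

(** P is the real or the imaginary part. With z = r e^(it), the arc integrand g(z) i z and the ray
    integrand g(z) e^(it) satisfy the hypotheses of [deformation]: the r-derivative of the former
    and the t-derivative of the latter are both g'(z) i z e^(it) + g(z) i e^(it). *)
Lemma arc_deformation_part (P : C -> R) (S : C -> Prop) g dg (u v a b theta M : R) :
  (forall f t w, cder f t w -> is_derive t 1 (fun x => P (f x)) (P w)) ->
  (forall z, `|P z| <= nc z) ->
  0 < u -> u < a -> a < b -> b < v -> 0 < theta ->
  (forall r t, u < r < v -> - theta <= t <= theta -> S (r%:C%C * cis t)) ->
  holo S g dg ->
  (forall r t, u < r < v -> - theta <= t <= theta ->
    nc (g (r%:C%C * cis t)) <= M /\ nc (dg (r%:C%C * cis t)) <= M) ->
  \int[leb]_(t in `[- theta, theta]) P (g (b%:C%C * cis t) * ('i%C * (b%:C%C * cis t)))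
  - \int[leb]_(t in `[- theta, theta]) P (g (a%:C%C * cis t) * ('i%C * (a%:C%C * cis t)))
  = \int[leb]_(r in `[a, b]) P (g (r%:C%C * cis theta) * cis theta)
  - \int[leb]_(r in `[a, b]) P (g (r%:C%C * cis (- theta)) * cis (- theta)).
Proof.
move=> dP PM u0 ua ab bv th0 hS hg hM.
have cP f t w : cder f t w -> {for t, continuous (fun x => P (f x))}.
  by move=> /dP[h _]; apply: differentiable_continuous; exact/derivable1_diffP.
have thI : - theta <= theta <= theta by rewrite lexx andbT; lra.
have thI' : - theta <= - theta <= theta by rewrite lexx; lra.
have dk r t t' : u < r < v -> - theta <= t' <= theta -> t = t' ->
    cder (fun x => g (x%:C%C * cis t) * cis t) r (dg (r%:C%C * cis t) * cis t * cis t).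
  move=> hr ht ->; have [h _] := hg _ _ _ (ray_cder t' r) (hS _ _ hr ht).
  apply: cder_ext (cderM h (cder_cst (cis t') r)) _ _ => //.
  by rewrite mulr0 addr0.
apply: (@eq_trans _ _ (\int[leb]_(r in `[a, b]) (P (g (r%:C%C * cis theta) * cis theta)
  - P (g (r%:C%C * cis (- theta)) * cis (- theta))))); last first.
  rewrite RintegralB//; apply: integrable_segment => r hr; apply: cP.
    by apply: (dk r _ theta) => //; case/andP: hr => h1 h2; apply/andP; split; lra.
  by apply: (dk r _ (- theta)) => //; case/andP: hr => h1 h2; apply/andP; split; lra.
apply: (@deformation R (fun r t => P (g (r%:C%C * cis t) * ('i%C * (r%:C%C * cis t))))
  (fun r t => P (g (r%:C%C * cis t) * cis t))
  (fun r t => P (dg (r%:C%C * cis t) * ('i%C * (r%:C%C * cis t)) * cis t + g (r%:C%C * cis t) * ('i%C * cis t)))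
  u v a b theta (M * v + M)) => //.
- move=> r t hr ht; have [h _] := hg _ _ _ (ray_cder t r) (hS _ _ hr ht).
  apply: is_derive_ext (dP _ _ _ (cderM h (cderZ 'i%C (ray_cder t r)))) _ _ => //.
  by congr (P (_ + _)); rewrite mulrAC.
- move=> r t hr ht; have [h _] := hg _ _ _ (arc_cder r t) (hS _ _ hr ht).
  exact: (dP _ _ _ (cderM h (cis_cder t))).
- move=> r t hr ht; have [h [w hw]] := hg _ _ _ (arc_cder r t) (hS _ _ hr ht).
  apply: cP; apply: cderD; first exact: cderM (cderM hw (cderZ 'i%C (arc_cder r t))) (cis_cder t).
  exact: cderM h (cderZ 'i%C (cis_cder t)).
- move=> r t hr ht; have [h _] := hg _ _ _ (arc_cder r t) (hS _ _ hr ht).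
  by apply: cP; apply: cderM h (cderZ 'i%C (arc_cder r t)).
- move=> r t hr ht; have [M1 M2] := hM r t hr ht; case/andP: (hr) => r1 r2.
  apply: le_trans (PM _) _; apply: le_trans (le_normcD _ _) _.
  have nI : nc 'i%C = 1 by rewrite /Normc.normc /= expr0n add0r expr1n sqrtr1.
  rewrite (Normc.normcM (dg _ * _)) (Normc.normcM (dg _)) (Normc.normcM (g _)) !(Normc.normcM 'i%C) nI !mul1r.
  rewrite nc_cis !mulr1 nc_polar; last lra.
  apply: lerD => //; apply: ler_pM => //; rewrite ?nc_ge0//; lra.
- move=> r hr; split; apply: cP; [exact: (dk r _ theta)|exact: (dk r _ (- theta))].
Qed.

Lemma Cintegral_deformation (S : C -> Prop) g dg (u v a b theta M : R) :
  0 < u -> u < a -> a < b -> b < v -> 0 < theta ->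
  (forall r t, u < r < v -> - theta <= t <= theta -> S (r%:C%C * cis t)) ->
  holo S g dg ->
  (forall r t, u < r < v -> - theta <= t <= theta ->
    nc (g (r%:C%C * cis t)) <= M /\ nc (dg (r%:C%C * cis t)) <= M) ->
  Cintegral `[- theta, theta] (fun t => g (b%:C%C * cis t) * ('i%C * (b%:C%C * cis t)))
  - Cintegral `[- theta, theta] (fun t => g (a%:C%C * cis t) * ('i%C * (a%:C%C * cis t)))
  = Cintegral `[a, b] (fun r => g (r%:C%C * cis theta) * cis theta)
  - Cintegral `[a, b] (fun r => g (r%:C%C * cis (- theta)) * cis (- theta)).
Proof.
move=> u0 ua ab bv th0 hS hg hM; apply: complex_ext; rewrite !(cReD, cImD, cReN, cImN).
  by apply: (@arc_deformation_part Re S g dg u v a b theta M) => // [f t w []|z] //; exact: nc_Re_le.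
by apply: (@arc_deformation_part Im S g dg u v a b theta M) => // [f t w []|z] //; exact: nc_Im_le.
Qed.

Lemma Cintegral_split (kappa1 kappa2 : R) A1 A2 f : kappa1 < kappa2 ->
  measurable A1 -> A1 `<=` [set r | kappa1 <= r] ->
  (forall r, kappa1 <= r <= kappa2 -> A1 r) -> A2 = A1 `&` [set r | kappa2 <= r] ->
  Cintegrable A1 f ->
  Cintegral A1 f = Cintegral `[kappa1, kappa2] f + Cintegral A2 f.
Proof.
move=> k12 mA sA1 hA1 -> [i1 i2].
have E : A1 = `[kappa1, kappa2[ `|` (A1 `&` `[kappa2, +oo[).
  apply/seteqP; split=> r.
    move=> Ar; have [h|h] := ltP r kappa2; [left|right]; rewrite /= in_itv/=.
      by rewrite h andbT; exact: sA1.
    by rewrite h.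
  case=> [|[]//]; rewrite /= in_itv/= => /andP[h1 h2]; apply: hA1; rewrite h1 ltW//.
have EA : A1 `&` [set r | kappa2 <= r] = A1 `&` `[kappa2, +oo[.
  by congr (_ `&` _); apply/seteqP; split=> r; rewrite /= in_itv/= andbT.
have dis : [disjoint `[kappa1, kappa2[ & A1 `&` `[kappa2, +oo[].
  apply/disj_set2P/seteqP; split=> // r [] /=; rewrite !in_itv/= andbT => /andP[_ h1] [_ h2].
  by move: h1; rewrite ltNge h2.
have part (h : R -> R) : leb.-integrable A1 (EFin \o h) ->
    \int[leb]_(r in A1) h r = \int[leb]_(r in `[kappa1, kappa2]) h r +
      \int[leb]_(r in A1 `&` `[kappa2, +oo[) h r.
  move=> ih; rewrite {1}E Rintegral_setU//.
  - congr (_ + _); apply: Rintegral_itv_bndo_bndc.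
    apply: integrableS ih => //; rewrite E => r; exact: or_introl.
  - exact: measurableI.
  - by rewrite -E.
by apply: complex_ext; rewrite ?cReD ?cImD /= EA; exact: part.
Qed.

Lemma arc_set (theta kappa : R) D : 0 <= kappa -> (forall z, nc z <= kappa -> D z) ->
  [set t | - theta <= t <= theta /\ D (kappa%:C%C * cis t)] = `[- theta, theta]%classic.
Proof.
move=> k0 hD; apply/seteqP; split=> t /=; rewrite in_itv/=; first by case.
by move=> ht; split=> //; apply: hD; rewrite nc_polar.
Qed.

(** A larger arc removes the segments [kappa1, kappa2] from the two rays, and
    [Cintegral_deformation] says that the change of the arc integral compensates exactly for
    them. *)
Lemma contour_independent (S : C -> Prop) g dg D (u v kappa1 kappa2 theta M : R) :
  0 < u -> u < kappa1 -> kappa1 < kappa2 -> kappa2 < v -> 0 < theta ->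
  (forall z, nc z <= kappa2 -> D z) ->
  (forall r t, u < r < v -> - theta <= t <= theta -> S (r%:C%C * cis t)) ->
  holo S g dg ->
  (forall r t, u < r < v -> - theta <= t <= theta ->
    nc (g (r%:C%C * cis t)) <= M /\ nc (dg (r%:C%C * cis t)) <= M) ->
  (forall t, t = theta \/ t = - theta ->
    measurable [set r | kappa1 <= r /\ D (r%:C%C * cis t)] /\
    Cintegrable [set r | kappa1 <= r /\ D (r%:C%C * cis t)] (fun r => g (r%:C%C * cis t) * cis t)) ->
  contour_integral theta kappa1 D g = contour_integral theta kappa2 D g.
Proof.
move=> u0 uk1 k12 k2v th0 hD hS hg hM hi; rewrite /contour_integral.
have k1p : 0 < kappa1 by lra.
have k2p : 0 < kappa2 by lra.
rewrite (arc_set theta (ltW k2p) hD) (@arc_set theta kappa1 D (ltW k1p)); last first.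
  by move=> z hz; apply: hD; lra.
have split t : t = theta \/ t = - theta ->
    Cintegral [set r | kappa1 <= r /\ D (r%:C%C * cis t)] (fun r => g (r%:C%C * cis t) * cis t) =
    Cintegral `[kappa1, kappa2] (fun r => g (r%:C%C * cis t) * cis t) +
    Cintegral [set r | kappa2 <= r /\ D (r%:C%C * cis t)] (fun r => g (r%:C%C * cis t) * cis t).
  move=> /hi[mA iA]; apply: Cintegral_split => //.
  - by move=> r [].
  - move=> r /andP[h1 h2]; split=> //; apply: hD; rewrite nc_polar//; lra.
  - apply/seteqP; split=> r [h1 h2]; split=> //; first by split=> //; lra.
    by case: h1.
rewrite (split theta (or_introl erefl)) (split (- theta) (or_intror erefl)).
have := Cintegral_deformation u0 uk1 k12 k2v th0 hS hg hM.
move: (Cintegral `[- theta, theta] _) (Cintegral `[- theta, theta] _) => x y.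
move: (Cintegral `[kappa1, kappa2] _) (Cintegral `[kappa1, kappa2] _) => p q h.
have -> : y = x + (q - p) by rewrite -h addrC subrK.
ring.
Qed.

End contours.

(** * Linearity of contour integrals *)

Section contour_linearity.
Context {R : realType}.
Local Notation C := R[i].
Local Notation Re := (@complex.Re R).
Local Notation Im := (@complex.Im R).
Local Notation leb := (@lebesgue_measure R).
Implicit Types (g : C -> C) (f h : R -> C) (D : set C) (A : set R).

Lemma integrable_lin A (a : R) (f g : R -> R) : measurable A ->
  leb.-integrable A (EFin \o f) -> leb.-integrable A (EFin \o g) ->
  leb.-integrable A (EFin \o (fun x => a * f x + g x)) /\
  \int[leb]_(x in A) (a * f x + g x) = a * \int[leb]_(x in A) f x + \int[leb]_(x in A) g x.
Proof.
move=> mA i1 i2.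
have i3 : leb.-integrable A (EFin \o (fun x => a * f x)) 
  by have := @integrableZl _ _ _ leb _ mA a _ i1.
split; first by have := @integrableD _ _ _ leb _ mA _ _ i3 i2.
by rewrite RintegralD// RintegralZl.
Qed.

Lemma Cintegral_lin A (c : C) f h : measurable A -> Cintegrable A f -> Cintegrable A h ->
  Cintegrable A (fun r => c * f r + h r) /\
  Cintegral A (fun r => c * f r + h r) = c * Cintegral A f + Cintegral A h.
Proof.
move=> mA [f1 f2] [h1 h2].
have [i1 e1] := integrable_lin (- Im c) mA f2 h1.
have [i2 e2] := integrable_lin (Re c) mA f1 i1.
have [i3 e3] := integrable_lin (Im c) mA f1 h2.
have [i4 e4] := integrable_lin (Re c) mA f2 i3.
have E1 : (fun r => Re (c * f r + h r)) = (fun r => Re c * Re (f r) + (- Im c * Im (f r) + Re (h r))).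
  by apply/funext => r; rewrite cReD cReM mulNr addrA.
have E2 : (fun r => Im (c * f r + h r)) = (fun r => Re c * Im (f r) + (Im c * Re (f r) + Im (h r))).
  by apply/funext => r; rewrite cImD cImM addrA.
split; first by rewrite /Cintegrable E1 E2.
apply: complex_ext; rewrite /Cintegral ?(cReD, cImD) ?(cReM, cImM) /= ?E1 ?E2.
  by rewrite e2 e1 mulNr addrA.
by rewrite e4 e3 addrA.
Qed.

(** [contour_integral] has a value for every integrand; linearity requires measurable pieces and
    integrability on the rays and on the arc. *)
Definition contour_integrable (theta kappa : R) D g := forall t, t = theta \/ t = - theta ->
  [/\ measurable [set r | kappa <= r /\ D (r%:C%C * cis t)],
   Cintegrable [set r | kappa <= r /\ D (r%:C%C * cis t)] (fun r => g (r%:C%C * cis t) * cis t),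
   measurable [set t | - theta <= t <= theta /\ D (kappa%:C%C * cis t)] &
   Cintegrable [set t | - theta <= t <= theta /\ D (kappa%:C%C * cis t)]
     (fun t => g (kappa%:C%C * cis t) * ('i%C * (kappa%:C%C * cis t)))].

Lemma contour_lin theta kappa D (c : C) g1 g2 :
  contour_integrable theta kappa D g1 -> contour_integrable theta kappa D g2 ->
  contour_integrable theta kappa D (fun z => c * g1 z + g2 z) /\
  contour_integral theta kappa D (fun z => c * g1 z + g2 z) =
  c * contour_integral theta kappa D g1 + contour_integral theta kappa D g2.
Proof.
move=> h1 h2.
have E (p w : R -> C) : (fun r => (c * g1 (p r) + g2 (p r)) * w r) =
    (fun r => c * (g1 (p r) * w r) + g2 (p r) * w r).
  by apply/funext => r; rewrite mulrDl mulrA.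
have Er t := E (fun r => r%:C%C * cis t) (fun=> cis t).
have Ea := E (fun t => kappa%:C%C * cis t) (fun t => 'i%C * (kappa%:C%C * cis t)).
have key t : t = theta \/ t = - theta -> _ := fun ht =>
  let: And4 mA i1 mB j1 := h1 t ht in let: And4 _ i2 _ j2 := h2 t ht in
  (conj (Cintegral_lin c mA i1 i2) (Cintegral_lin c mB j1 j2)).
split.
  move=> t ht; have [mA i1 mB j1] := h1 t ht; have [[k1 _] [k2 _]] := key t ht.
  by split=> //; rewrite ?Er ?Ea.
rewrite /contour_integral !Er Ea.
have [[_ ->] [_ ->]] := key theta (or_introl erefl).
have [[_ ->] _] := key (- theta) (or_intror erefl).
ring.
Qed.

(** Subtracting g from itself transfers the measurability of the pieces to the zero integrand, the
    base case of [contour_sum]. *)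
Lemma contour_integrable0 theta kappa D g : contour_integrable theta kappa D g ->
  contour_integrable theta kappa D (fun=> 0) /\ contour_integral theta kappa D (fun=> 0) = 0.
Proof.
move=> h; have [h1 e1] := contour_lin (- 1) h h; split.
  by move: h1; under eq_fun do rewrite mulN1r addNr.
by move: e1; under [X in contour_integral _ _ _ X]eq_fun do rewrite mulN1r addNr; rewrite mulN1r addNr.
Qed.

Lemma contour_sum theta kappa D n (g : 'I_n -> C -> C) (c : 'I_n -> C) :
  contour_integrable theta kappa D (fun=> 0) ->
  (forall i, contour_integrable theta kappa D (g i)) ->
  contour_integral theta kappa D (fun z => \sum_i c i * g i z) =
  \sum_i c i * contour_integral theta kappa D (g i).
Proof.
move=> h0 h; suff H s : contour_integrable theta kappa D (fun z => \sum_(i <- s) c i * g i z) /\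
    contour_integral theta kappa D (fun z => \sum_(i <- s) c i * g i z) =
    \sum_(i <- s) c i * contour_integral theta kappa D (g i) by case: (H (index_enum _)).
elim: s => [|j s [IH1 IH2]].
  have [h1 h2] := contour_integrable0 h0; split; last rewrite big_nil -[RHS]h2.
    by rewrite (_ : (fun z => _) = (fun=> 0)) => //; apply/funext => z; rewrite big_nil.
  by congr contour_integral; apply/funext => z; rewrite big_nil.
have -> : (fun z => \sum_(i <- j :: s) c i * g i z) = (fun z => c j * g j z + \sum_(i <- s) c i * g i z).
  by apply/funext => z; rewrite big_cons.
by have [k1 k2] := contour_lin (c j) (h j) IH1; split=> //; rewrite k2 IH2 big_cons.
Qed.

Lemma contour_ext theta kappa D g1 g2 :
  (forall t r, t = theta \/ t = - theta -> kappa <= r -> D (r%:C%C * cis t) ->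
    g1 (r%:C%C * cis t) = g2 (r%:C%C * cis t)) ->
  (forall t, - theta <= t <= theta -> D (kappa%:C%C * cis t) ->
    g1 (kappa%:C%C * cis t) = g2 (kappa%:C%C * cis t)) ->
  contour_integral theta kappa D g1 = contour_integral theta kappa D g2.
Proof.
move=> h1 h2; have CE A f1 f2 : (forall r, A r -> f1 r = f2 r) -> Cintegral A f1 = Cintegral A f2.
  move=> h; apply: complex_ext; apply: eq_Rintegral => r /set_mem Ar; by rewrite h.
rewrite /contour_integral; congr (_ - _ + _); apply: CE => r [r1 r2].
- by rewrite h1//; left.
- by rewrite h1//; right.
- by rewrite h2.
Qed.

End contour_linearity.

(** * The scalar error *)

Section step_symbol.
Context {R : realType}.
Local Notation C := R[i].
Local Notation nc := (@Normc.normc R).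
Local Notation Re := (@complex.Re R).
Local Notation Im := (@complex.Im R).
Variables (k : nat) (hk : (1 <= k <= 6)%N).

Definition step_symbol (tau : R) (z : C) : C := bdf k tau (cexp (- (z * tau%:C%C))).

Definition dstep_symbol (tau : R) (z : C) : C := 1 - bdf_arg (z * tau%:C%C) ^+ k.

Definition step_region (tau : R) (z : C) := slit z /\ bdf_region (z * tau%:C%C).

Lemma step_symbolE tau z : step_symbol tau z = (tau^-1)%:C%C * bdf_sum k (bdf_arg (z * tau%:C%C)).
Proof. by []. Qed.

Lemma Re_mulr (z : C) (r : R) : Re (z * r%:C%C) = Re z * r.
Proof. by rewrite cReM /= mulr0 subr0. Qed.

Lemma Im_mulr (z : C) (r : R) : Im (z * r%:C%C) = Im z * r.
Proof. by rewrite cImM /= mulr0 add0r. Qed.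

Lemma nc_mulr (z : C) (r : R) : 0 <= r -> nc (z * r%:C%C) = r * nc z.
Proof. by move=> r0; rewrite Normc.normcM nc_pos// mulrC. Qed.

Lemma Im_scale (z : C) (r : R) : Im (r%:C%C * z) = r * Im z.
Proof. by rewrite mulrC Im_mulr mulrC. Qed.

Lemma slit_mulr (z : C) (r : R) : 0 < r -> slit (z * r%:C%C) = slit z.
Proof. by move=> r0; rewrite /slit Re_mulr Im_mulr pmulr_lgt0// mulf_eq0 (gt_eqF r0) orbF. Qed.

Lemma slit_step_symbol tau z : 0 < tau -> step_region tau z -> slit (step_symbol tau z).
Proof.
move=> t0 [sz rz]; rewrite step_symbolE mulrC slit_mulr ?invr_gt0//.
apply: slit_bdf_sum => //; first exact: near_disk_bdf_arg.
by apply: slit_bdf_arg => //; rewrite slit_mulr.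
Qed.

Lemma Im_step_symbol tau z : 0 < tau -> step_region tau z ->
  exists2 q, 0 < q & Im (step_symbol tau z) = q * sin (Im z * tau).
Proof.
move=> t0 [sz rz]; have nd := near_disk_bdf_arg rz.
have q4 := im_quotient_lower hk (sqr_ge0 (Im (bdf_arg (z * tau%:C%C)))) nd.
exists (tau^-1 * expR (- Re (z * tau%:C%C)) * im_quotient k (Re (bdf_arg (z * tau%:C%C))) (Im (bdf_arg (z * tau%:C%C)) ^+ 2)).
  rewrite !mulr_gt0 ?invr_gt0 ?expR_gt0//; apply: lt_le_trans q4; lra.
rewrite step_symbolE Im_scale bdf_sum_Im {1}Im_bdf_arg Im_mulr; ring.
Qed.

(** The imaginary part of the symbol is a positive multiple of sin(tau Im z) with |tau Im z| <= pi,
    so it has the sign of Im z or vanishes; in the latter case [slit] fixes the argument. *)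
Lemma same_side_step_symbol tau z : 0 < tau -> step_region tau z ->
  same_side z (step_symbol tau z).
Proof.
move=> t0 rz; have sW := slit_step_symbol t0 rz.
have [q q0 Wq] := Im_step_symbol t0 rz.
have [sz [_ _]] := rz; rewrite Im_mulr => hpi.
have [I0|I0] := leP 0 (Im z); [left|right]; split.
- exact: carg_ge0.
- apply: carg_ge0; rewrite Wq mulr_ge0 ?(ltW q0)// sin_ge0_pi// mulr_ge0 ?(ltW t0)//=.
  exact: le_trans (ler_norm _) hpi.
- by apply: slit_carg_le0 => //; exact: ltW.
- apply: slit_carg_le0 => //; rewrite Wq -oppr_ge0 -mulrN -sinN mulr_ge0 ?(ltW q0)//.
  rewrite sin_ge0_pi// -mulNr mulr_ge0 ?oppr_ge0 ?(ltW I0) ?(ltW t0)//= mulNr.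
  by apply: le_trans (ler_norm _) _; rewrite normrN.
Qed.

Lemma step_symbol_accuracy tau z : 0 < tau -> step_region tau z ->
  nc (step_symbol tau z - z) <= 2 ^+ k.+1 * tau ^+ k * nc z ^+ k.+1.
Proof.
move=> t0 [_ rz]; have h := bdf_accuracy k rz.
have -> : step_symbol tau z - z = (bdf_sum k (bdf_arg (z * tau%:C%C)) - z * tau%:C%C) * (tau^-1)%:C%C.
  rewrite step_symbolE mulrBl -[z * _ * _]mulrA -[tau%:C%C * _]rmorphM mulfV ?gt_eqF//.
  by rewrite rmorph1 mulr1 mulrC.
rewrite nc_mulr ?invr_ge0 ?(ltW t0)// mulrC ler_pdivrMr//; apply: le_trans h _.
rewrite nc_mulr ?(ltW t0)// exprMn [tau ^+ k.+1]exprSr.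
by rewrite le_eqVlt; apply/orP; left; apply/eqP; ring.
Qed.

Lemma bdf_region_nc (z : C) : bdf_region z -> nc z <= 6.
Proof.
move=> [h1 h2 h3]; apply: le_trans (nc_le_ReIm _) _.
have p4 := @pihalf_lt2 R.
have : `|Re z| <= 2 by rewrite ler_norml; apply/andP; split; lra.
lra.
Qed.

(** From below, [bdf_sum_lower] and [bdf_arg_lower] are composed. From above, the accuracy estimate
    suffices because |z tau| <= 6 on the region. A adds up both constants. *)
Lemma step_symbol_comparable : exists2 A : R, 1 <= A & forall tau z, 0 < tau ->
  step_region tau z -> nc z <= A * nc (step_symbol tau z) /\ nc (step_symbol tau z) <= A * nc z.
Proof.
have [c1 c10 h1] := @bdf_sum_lower R k hk; have [c2 c20 h2] := @bdf_arg_lower R.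
pose A : R := 1 + 2 ^+ k.+1 * 6 ^+ k + (c1 * c2)^-1.
have i0 : 0 < (c1 * c2)^-1 by rewrite invr_gt0 mulr_gt0.
have j0 : 0 <= 2 ^+ k.+1 * 6 ^+ k :> R by rewrite mulr_ge0// exprn_ge0.
exists A; first by rewrite /A -addrA lerDl addr_ge0// ltW.
move=> tau z t0 rz; have [sz bz] := rz.
have n0 := nc_ge0 z; have N0 := nc_ge0 (step_symbol tau z); split.
  have W : c1 * c2 * nc z <= nc (step_symbol tau z).
    rewrite step_symbolE [_%:C%C * _]mulrC nc_mulr ?invr_ge0 ?(ltW t0)//.
    rewrite -[leLHS](mulKf (negbT (gt_eqF t0))); apply: ler_wpM2l; first by rewrite invr_ge0 ltW.
    apply: le_trans (h1 _ (near_disk_bdf_arg bz)).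
    have := h2 _ bz; rewrite nc_mulr ?(ltW t0)// => h.
    have := ler_wpM2l (ltW c10) h.
    by rewrite (_ : tau * (c1 * c2 * nc z) = c1 * (c2 * (tau * nc z))); last ring.
  have : nc z <= (c1 * c2)^-1 * nc (step_symbol tau z).
    by rewrite -ler_pdivrMl ?invr_gt0 ?mulr_gt0 ?invr_gt0// invrK.
  move=> h; apply: le_trans h _; apply: ler_wpM2r => //.
  by rewrite /A lerDr addr_ge0.
have h := step_symbol_accuracy t0 rz.
have -> : step_symbol tau z = z + (step_symbol tau z - z) by rewrite addrC subrK.
apply: le_trans (le_normcD _ _) _.
have h6 : tau ^+ k * nc z ^+ k <= 6 ^+ k.
  rewrite -exprMn -nc_mulr ?(ltW t0)//; apply: lerXn2r; rewrite ?nnegrE ?nc_ge0//.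
  exact: bdf_region_nc.
apply: (@le_trans _ _ (nc z + 2 ^+ k.+1 * 6 ^+ k * nc z)).
  rewrite lerD2l; apply: le_trans h _; rewrite [nc z ^+ k.+1]exprSr mulrA.
  apply: ler_wpM2r => //; rewrite -mulrA; apply: ler_wpM2l => //; exact: exprn_ge0.
rewrite -[X in X + _]mul1r -mulrDl; apply: ler_wpM2r => //.
by rewrite /A lerDl ltW.
Qed.

Lemma step_symbol_cder tau (f : R -> C) t v : 0 < tau -> cder f t v ->
  cder (fun x => step_symbol tau (f x)) t (dstep_symbol tau (f t) * v).
Proof.
move=> t0 hf.
have h := cderZ (tau^-1)%:C%C (bdf_symbol_cder k (cderM hf (cder_cst tau%:C%C t))).
apply: cder_ext h _ _ => //; rewrite mulr0 addr0 /dstep_symbol.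
rewrite [v * _]mulrC mulrA [_ * (1 - _)]mulrC -!mulrA [X in _ * X]mulrA -rmorphM mulVf ?gt_eqF//.
by rewrite rmorph1 mul1r.
Qed.

Lemma dstep_symbol_cder tau (f : R -> C) t v : cder f t v ->
  exists v', cder (fun x => dstep_symbol tau (f x)) t v'.
Proof.
move=> hf; have h1 := cderN (cderM hf (cder_cst tau%:C%C t)).
have h2 := cderB (cder_cst 1 t) (cder_exp h1).
rewrite /dstep_symbol; case: k => [|j].
  by exists 0; apply: cder_ext (cder_cst 0 t) _ _ => // x; rewrite /dstep_symbol expr0 subrr.
eexists; apply: cderB; [exact: cder_cst|exact: cderX h2].
Qed.

Lemma dstep_symbol_bound tau z : 0 < tau -> step_region tau z ->
  nc (dstep_symbol tau z) <= 1 + 12 ^+ k.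
Proof.
move=> t0 [_ bz]; apply: le_trans (nc_B _ _) _; rewrite Normc.normc1 lerD2l ncX.
apply: lerXn2r; rewrite ?nnegrE ?nc_ge0//.
apply: le_trans (bdf_arg_upper bz) _.
by have := bdf_region_nc bz; lra.
Qed.

End step_symbol.

(** * Integrands e^(zT) F(W(z)), with W standing for the identity or for the BDF symbol *)

Section contour_symbol.
Context {R : realType}.
Local Notation C := R[i].
Local Notation nc := (@Normc.normc R).
Local Notation Re := (@complex.Re R).
Local Notation Im := (@complex.Im R).
Local Notation leb := (@lebesgue_measure R).

Lemma powR_between (u v x q : R) : 0 < u -> u <= x <= v -> x `^ q <= u `^ q + v `^ q.
Proof.
move=> u0 /andP[ux xv]; have x0 := lt_le_trans u0 ux; have v0 := lt_le_trans x0 xv.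
have [q0|q0] := leP 0 q.
  apply: (@le_trans _ _ (v `^ q)); last by rewrite lerDr powR_ge0.
  by apply: ge0_ler_powR => //; rewrite ?nnegrE ltW.
apply: (@le_trans _ _ (u `^ q)); last by rewrite lerDl powR_ge0.
rewrite -[q]opprK [x `^ _]powRN [u `^ _]powRN lef_pV2 ?posrE ?powR_gt0//.
by apply: ge0_ler_powR => //; rewrite ?nnegrE ?oppr_ge0 ltW.
Qed.

Variables (alpha beta : R).
Hypothesis a01 : 0 < alpha < 1.

Lemma dFsym_cder mu (f : R -> C) t v : 0 < mu -> cder f t v -> slit (f t) ->
  exists v', cder (fun x => dFsym alpha beta mu (f x)) t v'.
Proof.
move=> mu0 hf sf; have f0 := slit_neq0 sf.
have b0 := cpow_add_neq0 a01 mu0 f0.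
have hb := cder_pow beta hf sf; have ha := cder_pow alpha hf sf.
have hm := cderD ha (cder_cst mu%:C%C t).
eexists; apply: cderM (cderV f0 hf); apply: cderB.
  by apply: cderM (cderV b0 hm); apply: cderZ; exact: hb.
apply: cderM (cderV _ (cderX 1 hm)); last by rewrite expf_neq0.
by apply: cderM ha; apply: cderZ; exact: hb.
Qed.

Variables (S : C -> Prop) (W dW : C -> C) (A B : R).
Hypothesis A1 : 1 <= A.
Hypothesis Sslit : forall z, S z -> slit z.
Hypothesis Wslit : forall z, S z -> slit (W z).
Hypothesis Wcmp : forall z, S z -> nc z <= A * nc (W z) /\ nc (W z) <= A * nc z.
Hypothesis dWb : forall z, S z -> nc (dW z) <= B.
Hypothesis Wholo : holo S W dW.

Definition symbol (mu T : R) (z : C) : C := cexp (z * T%:C%C) * Fsym alpha beta mu (W z).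

Definition dsymbol (mu T : R) (z : C) : C :=
  T%:C%C * cexp (z * T%:C%C) * Fsym alpha beta mu (W z) +
  cexp (z * T%:C%C) * (dFsym alpha beta mu (W z) * dW z).

Let nc_W_pow p z : S z -> nc (W z) `^ p <= A `^ `|p| * nc z `^ p.
Proof.
move=> Sz; have [h1 h2] := Wcmp Sz.
by apply: powR_comparable => //; apply: nc_gt0; apply: slit_neq0; [exact: Sslit|exact: Wslit].
Qed.

Lemma symbol_bound : exists2 K, 0 < K & forall mu T z, 0 < mu -> S z ->
  nc (symbol mu T z) <= K * (expR (Re z * T) * nc z `^ (beta - alpha)).
Proof.
have s0 := sin_alpha_gt0 a01.
exists ((sin (alpha * pi))^-1 * A `^ `|beta - alpha|).
  by apply: mulr_gt0; [rewrite invr_gt0|apply: powR_gt0; exact: lt_le_trans A1].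
move=> mu T z mu0 Sz; rewrite /symbol (Normc.normcM (cexp _)) nc_exp Re_mulr.
rewrite [leRHS]mulrCA; apply: ler_wpM2l; first exact: expR_ge0.
apply: le_trans (Fsym_bound a01 beta mu0 (slit_neq0 (Wslit Sz))) _.
rewrite -mulrA; apply: ler_wpM2l; first by rewrite invr_ge0 ltW.
exact: nc_W_pow.
Qed.

Lemma symbol_holo mu T : 0 < mu -> holo S (symbol mu T) (dsymbol mu T).
Proof.
move=> mu0 f t v hf Sf; have [hW [w hw]] := Wholo hf Sf.
have he := cder_exp (cderM hf (cder_cst T%:C%C t)).
have hF := Fsym_cder a01 beta mu0 hW (Wslit Sf).
split.
  apply: cder_ext (cderM he hF) _ _ => //; rewrite mulr0 addr0 /dsymbol; ring.
have [w' hF'] := dFsym_cder mu0 hW (Wslit Sf).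
eexists; apply: cderD.
  by apply: cderM hF; apply: cderZ; exact: he.
by apply: cderM he _; apply: cderM hF' hw.
Qed.

(** Supplies the bound on an annulus that dominates the r-derivative when the arc is deformed. *)
Lemma symbol_locally_bounded mu T u v : 0 < mu -> 0 <= T -> 0 < u ->
  exists M, forall z, S z -> u <= nc z <= v -> nc (symbol mu T z) <= M /\ nc (dsymbol mu T z) <= M.
Proof.
move=> mu0 T0 u0; have [K K0 hK] := symbol_bound.
pose E := expR (v * T); have E0 : 0 <= E by exact: expR_ge0.
pose P q := u `^ q + v `^ q; have P0 q : 0 <= P q by rewrite addr_ge0 ?powR_ge0.
pose Q := `|beta| / sin (alpha * pi) + `|alpha| / sin (alpha * pi) ^+ 2.
have s0 := sin_alpha_gt0 a01.
have Q0 : 0 <= Q 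
  by apply: addr_ge0; apply: divr_ge0 => //; rewrite ?exprn_ge0 ?(ltW s0).
pose M1 := K * (E * P (beta - alpha)).
have M10 : 0 <= M1 by rewrite mulr_ge0 ?(ltW K0)// mulr_ge0.
pose M2 := E * (Q * (A `^ `|beta - alpha - 1| * P (beta - alpha - 1)) * `|B|).
have M20 : 0 <= M2 by rewrite !mulr_ge0 ?powR_ge0.
exists (M1 + T * M1 + M2) => z Sz hz.
have eE : expR (Re z * T) <= E.
  rewrite ler_expR; apply: ler_wpM2r => //; apply: le_trans (ler_norm _) _.
  by apply: le_trans (nc_Re_le z) _; case/andP: hz.
have h1 : nc (symbol mu T z) <= M1.
  apply: le_trans (hK _ _ _ mu0 Sz) _; apply: ler_wpM2l; first exact: ltW.
  by apply: ler_pM; rewrite ?expR_ge0 ?powR_ge0//; exact: powR_between.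
split; first by apply: le_trans h1 _; rewrite -addrA lerDl addr_ge0// mulr_ge0.
apply: le_trans (le_normcD _ _) _; apply: lerD.
  rewrite -mulrA (Normc.normcM T%:C%C) nc_pos//.
  apply: (@le_trans _ _ (T * M1)); last by rewrite lerDr.
  exact: ler_wpM2l.
rewrite (Normc.normcM (cexp _)) nc_exp Re_mulr; apply: ler_pM => //; rewrite ?expR_ge0 ?nc_ge0//.
rewrite (Normc.normcM (dFsym _ _ _ _)); apply: ler_pM; rewrite ?nc_ge0//; last first.
  by apply: le_trans (dWb Sz) _; exact: ler_norm.
apply: le_trans (dFsym_bound a01 beta mu0 (slit_neq0 (Wslit Sz))) _.
apply: ler_wpM2l => //; apply: le_trans (nc_W_pow _ Sz) _.
by apply: ler_wpM2l; [exact: powR_ge0|exact: powR_between].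
Qed.

(** cos t < 0 makes e^(zT) decay exponentially along the ray; half of the decay rate absorbs the
    power of |z|. *)
Lemma symbol_ray_integrable mu T t kappa (J : set R) : 0 < mu -> 0 < T -> 0 < kappa -> cos t < 0 ->
  measurable J -> J `<=` [set r | kappa <= r] -> (forall r, J r -> S (r%:C%C * cis t)) ->
  Cintegrable J (fun r => symbol mu T (r%:C%C * cis t) * cis t).
Proof.
move=> mu0 T0 k0 ct mJ sJ SJ; have [K K0 hK] := symbol_bound.
have c0 : 0 < - cos t * T by rewrite mulr_gt0// oppr_gt0.
have [L hL] := powR_exp_dominated (beta - alpha) k0 c0.
have iJ : leb.-integrable J (EFin \o (fun r => K * L * expR (- (- cos t * T / 2) * r))).
  apply: integrableS (integrable_exp_decay kappa (K * L) (_ : 0 < - cos t * T / 2)) => //; last lra.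
  by move=> r /sJ; rewrite /= in_itv/= andbT.
have bnd r : J r -> nc (symbol mu T (r%:C%C * cis t) * cis t) <= K * L * expR (- (- cos t * T / 2) * r).
  move=> Jr; have kr := sJ _ Jr; have r0 : 0 <= r by apply: ltW; exact: lt_le_trans kr.
  rewrite Normc.normcM nc_cis mulr1; apply: le_trans (hK _ T _ mu0 (SJ r Jr)) _.
  rewrite -mulrA; apply: ler_wpM2l; first exact: ltW.
  rewrite Re_polar nc_polar// mulrC (_ : r * cos t * T = - (- cos t * T) * r); last ring.
  exact: hL.
have cd r : J r -> exists w, cder (fun x => symbol mu T (x%:C%C * cis t) * cis t) r w.
  move=> Jr; have [h _] := symbol_holo T mu0 (ray_cder t r) (SJ r Jr).
  by eexists; apply: cderM h (cder_cst _ _).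
split; apply: (integrable_dominated mJ _ iJ) => r Jr.
- by have [w /is_derive_cont[]] := cd r Jr.
- by apply: le_trans (nc_Re_le _) _; exact: bnd.
- by have [w /is_derive_cont[]] := cd r Jr.
- by apply: le_trans (nc_Im_le _) _; exact: bnd.
Qed.

Lemma symbol_arc_integrable mu T theta kappa : 0 < mu ->
  (forall t, - theta <= t <= theta -> S (kappa%:C%C * cis t)) ->
  Cintegrable `[- theta, theta] (fun t => symbol mu T (kappa%:C%C * cis t) * ('i%C * (kappa%:C%C * cis t))).
Proof.
move=> mu0 SJ.
have cd r : - theta <= r <= theta ->
    exists w, cder (fun t => symbol mu T (kappa%:C%C * cis t) * ('i%C * (kappa%:C%C * cis t))) r w.
  move=> Jr; have [h _] := symbol_holo T mu0 (arc_cder kappa r) (SJ r Jr).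
  by eexists; apply: cderM h (cderZ _ (arc_cder kappa r)).
split; apply: integrable_segment => r hr; have [w /is_derive_cont[]] := cd r hr => //.
Qed.

Lemma symbol_contour_integrable mu T theta kappa (D : set C) : 0 < mu -> 0 < T -> 0 < kappa ->
  cos theta < 0 -> (forall z, nc z <= kappa -> D z) ->
  (forall t, t = theta \/ t = - theta -> measurable [set r | kappa <= r /\ D (r%:C%C * cis t)] /\
     forall r, kappa <= r -> D (r%:C%C * cis t) -> S (r%:C%C * cis t)) ->
  (forall t, - theta <= t <= theta -> S (kappa%:C%C * cis t)) ->
  contour_integrable theta kappa D (symbol mu T).
Proof.
move=> mu0 T0 k0 ct hD hray harc t ht; have [mJ SJ] := hray t ht.
have ct' : cos t < 0 by case: ht => ->; rewrite ?cosN.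
rewrite (arc_set theta (ltW k0) hD); split => //.
  by apply: (symbol_ray_integrable mu0 T0 k0 ct' mJ) => r [h1 h2] //; exact: SJ.
exact: symbol_arc_integrable.
Qed.

Lemma symbol_contour_independent mu T theta kappa1 kappa2 (D : set C) : 0 < mu -> 0 < T ->
  0 < kappa1 -> kappa1 < kappa2 -> 0 < theta -> cos theta < 0 ->
  (forall z, nc z <= kappa2 -> D z) ->
  (forall t, t = theta \/ t = - theta -> measurable [set r | kappa1 <= r /\ D (r%:C%C * cis t)] /\
     forall r, kappa1 <= r -> D (r%:C%C * cis t) -> S (r%:C%C * cis t)) ->
  (forall r t, 0 < r < 2 * kappa2 -> - theta <= t <= theta -> S (r%:C%C * cis t)) ->
  contour_integral theta kappa1 D (symbol mu T) = contour_integral theta kappa2 D (symbol mu T).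
Proof.
move=> mu0 T0 k0 k12 th0 ct hD hray hS.
have u0 : 0 < kappa1 / 2 by lra.
have [M hM] := symbol_locally_bounded (2 * kappa2) mu0 (ltW T0) u0.
(* The deformation needs an open range of radii around [kappa1, kappa2]. With kappa2 <= 1/tau, the
   outer radius 2 kappa2 is at most 2/tau, which is why [bdf_region] extends to Re z = 2. *)
apply: (@contour_independent R S _ (dsymbol mu T) D (kappa1 / 2) (2 * kappa2) kappa1 kappa2 theta M) => //; try lra.
- by move=> r t hr ht; apply: hS => //; lra.
- exact: symbol_holo.
- move=> r t /andP[h1 h2] ht; apply: hM; first by apply: hS => //; lra.
  by rewrite nc_polar ?(ltW h1) ?(ltW h2)//; lra.
- move=> t ht; have [mJ SJ] := hray t ht; split=> //.
  have ct' : cos t < 0 by case: ht => ->; rewrite ?cosN.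
  by apply: (symbol_ray_integrable mu0 T0 k0 ct' mJ) => r [h1 h2] //; exact: SJ.
Qed.

End contour_symbol.

(** * Position of the contour with respect to the regions of the symbols *)

Section geometry.
Context {R : realType}.
Local Notation C := R[i].
Local Notation nc := (@Normc.normc R).
Local Notation Re := (@complex.Re R).
Local Notation Im := (@complex.Im R).
Local Notation leb := (@lebesgue_measure R).
Variable theta : R.
Hypothesis th : pi / 2 < theta < pi / 2 + 1 / 2000.

(** With x = theta - pi/2 in (0, 1/2000): cos theta = - sin x >= - x, and sin theta = cos x >= 1 -
    x. *)
Lemma theta_facts : [/\ cos theta < 0, - (1 / 2000) <= cos theta, 1 / 2 <= sin theta, 0 < theta & theta < pi].
Proof.
have [h1 h2] := andP th; have p2 := @pi_ge2 R; have p4 := @pihalf_lt2 R.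
pose x := theta - pi / 2.
have x0 : 0 < x by rewrite subr_gt0.
have x1 : x < 1 / 2000 by rewrite /x; lra.
have E : theta = x + pi / 2 by rewrite /x subrK.
have sx : 0 < sin x by apply: sin_gt0_pihalf; apply/andP; split; lra.
have sx2 : sin x <= x.
  by have := @norm_sinB R x 0; rewrite sin0 !subr0 !ger0_norm// ltW.
have cx : 1 / 2 <= cos x.
  have := @norm_cosB R x 0; rewrite cos0 subr0 (ger0_norm (ltW x0)) ler_norml => /andP[h _].
  lra.
rewrite {1 2 3}E cosDpihalf sinDpihalf.
move: sx sx2 cx; generalize (sin x) (cos x) => S0 C0 sx sx2 cx; clear E.
by split; lra.
Qed.

Lemma cos_ge_theta t : - theta <= t <= theta -> cos theta <= cos t.
Proof.
move=> /andP[t1 t2]; have [_ _ _ h4 h5] := theta_facts.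
have tt : `|t| <= theta by rewrite ler_norml t1.
rewrite -[cos t]cos_norm leNgt ltr_cos ?in_itv/= ?normr_ge0 ?(ltW h4) ?(ltW h5) ?(le_trans tt (ltW h5))//.
by rewrite -leNgt.
Qed.

Lemma slit_polar r t : 0 < r -> - theta <= t <= theta -> slit (r%:C%C * cis t).
Proof.
move=> r0 ht; rewrite mulrC slit_mulr// /slit /=.
have [_ _ _ h4 h5] := theta_facts.
have [ct|ct] := ltP 0 (cos t); first by [].
rewrite /=; apply/eqP => st.
have c1 : cos t ^+ 2 = 1 by have := cos2Dsin2 t; rewrite st expr0n addr0.
have cE : cos t = -1.
  have : (cos t + 1) * (cos t - 1) = 0 by rewrite mulrC -subr_sqr c1 expr1n subrr.
  move/eqP; rewrite mulf_eq0 => /orP[/eqP|/eqP]; lra.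
have [_ c2 _ _ _] := theta_facts.
by have := cos_ge_theta ht; rewrite cE; lra.
Qed.

Lemma step_region_disk tau r t : 0 < tau -> 0 < r -> r * tau <= 2 -> - theta <= t <= theta ->
  step_region tau (r%:C%C * cis t).
Proof.
move=> t0 r0 rt ht; have [c1 c2 s1 h4 h5] := theta_facts.
have ct := cos_ge_theta ht; have p2 := @pi_ge2 R; have ub := cos_le1 t.
have rt0 : 0 < r * tau by rewrite mulr_gt0.
split; first exact: slit_polar.
rewrite /bdf_region Re_mulr Im_mulr Re_polar Im_polar -mulrAC -[_ * sin t * _]mulrAC; split.
- apply: (@le_trans _ _ (r * tau * - (1 / 2000))).
    by move: rt0 rt; generalize (r * tau) => q; lra.
  apply: ler_wpM2l; [exact: ltW|lra].
- by apply: le_trans rt; rewrite ler_piMr// ltW.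
- apply: (le_trans _ p2); apply: le_trans rt; rewrite normrM (ger0_norm (ltW rt0)) ler_piMr ?(ltW rt0)//.
  by rewrite ler_norml sin_geN1 sin_le1.
Qed.

Lemma sin_ray t : t = theta \/ t = - theta -> `|sin t| = sin theta.
Proof.
have [_ _ s1 _ _] := theta_facts; have s0 : 0 <= sin theta by lra.
by case=> ->; rewrite ?sinN ?normrN ger0_norm.
Qed.

Lemma cos_ray t : t = theta \/ t = - theta -> cos t = cos theta.
Proof. by case=> ->; rewrite ?cosN. Qed.

Lemma ray_bounds t : t = theta \/ t = - theta -> - theta <= t <= theta.
Proof. have [_ _ _ h4 _] := theta_facts; case=> ->; rewrite lexx ?andbT/=; lra. Qed.

Lemma strip_ray b r t : t = theta \/ t = - theta -> 0 <= r ->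
  strip b (r%:C%C * cis t) = (r * sin theta <= b) :> Prop.
Proof.
by move=> ht r0; rewrite /strip /mkset Im_polar normrM (ger0_norm r0) (sin_ray ht).
Qed.

(** Truncation bounds |z tau| sin theta by pi, and sin theta >= 1/2 turns this into |z tau| <= 8.
    Hence Re (z tau) >= - 8/2000 >= - 1/200. *)
Lemma step_region_ray tau r t : t = theta \/ t = - theta -> 0 < tau -> 0 < r ->
  strip (pi / tau) (r%:C%C * cis t) -> step_region tau (r%:C%C * cis t).
Proof.
move=> ht t0 r0; rewrite (strip_ray _ ht (ltW r0)) ler_pdivlMr// => hr.
have [c1 c2 s1 h4 h5] := theta_facts; have p4 := @pihalf_lt2 R.
have rt0 : 0 < r * tau by rewrite mulr_gt0.
have rt : r * tau <= 8.
  have : r * tau * (1 / 2) <= r * tau * sin theta by apply: ler_wpM2l => //; exact: ltW.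
  by rewrite -[r * sin theta * _]mulrAC in hr; lra.
split; first by apply: slit_polar => //; exact: ray_bounds.
rewrite /bdf_region Re_mulr Im_mulr Re_polar Im_polar (cos_ray ht) -mulrAC; split.
- apply: (@le_trans _ _ (r * tau * - (1 / 2000))).
    by move: rt0 rt; generalize (r * tau) => q; lra.
  apply: ler_wpM2l => //; exact: ltW.
- apply: (@le_trans _ _ 0) => //; rewrite nmulr_lle0// ltW//.
- by rewrite !normrM (sin_ray ht) (gtr0_norm r0) (gtr0_norm t0).
Qed.

Lemma measurable_strip_ray b kappa t : t = theta \/ t = - theta -> 0 < kappa ->
  measurable [set r | kappa <= r /\ strip b (r%:C%C * cis t)].
Proof.
move=> ht k0; have [_ _ s1 _ _] := theta_facts; have s0 : 0 < sin theta by lra.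
rewrite (_ : [set r | _] = `[kappa, b / sin theta]%classic)//.
apply/seteqP; split=> r /=; rewrite in_itv/= ler_pdivlMr//.
  by move=> [h1]; rewrite strip_ray// ?h1//; apply: le_trans h1; exact: ltW.
move=> /andP[h1 h2]; split=> //; rewrite strip_ray//; apply: le_trans h1; exact: ltW.
Qed.

Lemma measurable_full_ray kappa t :
  measurable [set r | kappa <= r /\ (setT : set C) (r%:C%C * cis t)].
Proof.
rewrite (_ : [set r | _] = `[kappa, +oo[%classic)//.
by apply/seteqP; split=> r /=; rewrite in_itv/= andbT => //; case.
Qed.

Lemma strip_disk tau z : 0 < tau -> nc z <= 1 / tau -> strip (pi / tau) z.
Proof.
move=> t0 hz; rewrite /strip /mkset; apply: le_trans (nc_Im_le z) _; apply: le_trans hz _.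
by rewrite ler_wpM2r ?invr_ge0 ?(ltW t0)//; have := @pi_ge2 R; lra.
Qed.

Variables (k : nat) (hk : (1 <= k <= 6)%N) (alpha beta : R).
Hypothesis a01 : 0 < alpha < 1.
Local Notation gd tau := (symbol alpha beta (step_symbol k tau)).
Local Notation gc := (symbol alpha beta id).

Lemma holo_step tau : 0 < tau -> holo (step_region tau) (step_symbol k tau) (@dstep_symbol R k tau).
Proof.
by move=> t0 f t v hf _; split; [exact: step_symbol_cder|exact: dstep_symbol_cder hf].
Qed.

Lemma holo_id : holo (slit (R := R)) id (fun=> 1).
Proof.
move=> f t v hf _; split; last by exists 0; exact: cder_cst.
by apply: cder_ext hf _ _ => //; rewrite mul1r.
Qed.

Let id_cmp (z : C) : slit z -> nc z <= 1 * nc z /\ nc z <= 1 * nc z.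
Proof. by rewrite mul1r. Qed.

Section fixed_data.
Variables (mu T tau : R).
Hypothesis mu0 : 0 < mu.
Hypothesis T0 : 0 < T.
Hypothesis t0 : 0 < tau.

Let slit_ray kappa t r : 0 < kappa -> t = theta \/ t = - theta -> kappa <= r -> slit (r%:C%C * cis t).
Proof.
move=> k0 ht kr; apply: slit_polar; [exact: lt_le_trans kr|exact: ray_bounds].
Qed.

Lemma continuous_contour_integrable kappa : 0 < kappa ->
  contour_integrable theta kappa setT (gc mu T).
Proof.
move=> k0; have [c1 _ _ _ _] := theta_facts.
apply: (symbol_contour_integrable beta a01 (lexx 1) (fun z h => h) (fun z h => h) id_cmp holo_id) => //.
- move=> t ht; split; first exact: measurable_full_ray.
  by move=> r kr _; exact: slit_ray kr.
- by move=> t ht; exact: slit_polar.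
Qed.

Lemma discrete_contour_integrable kappa : 0 < kappa -> kappa <= 1 / tau ->
  contour_integrable theta kappa (strip (pi / tau)) (gd tau mu T).
Proof.
move=> k0 kt; have [c1 _ _ _ _] := theta_facts; have [A A1 hA] := @step_symbol_comparable R k hk.
apply: (symbol_contour_integrable beta a01 A1 (fun z (h : step_region tau z) => h.1)
  (fun z => slit_step_symbol hk t0) (fun z => hA tau z t0) (holo_step t0)) => //.
- by move=> z hz; apply: strip_disk => //; exact: le_trans kt.
- move=> t ht; split; first exact: measurable_strip_ray.
  by move=> r kr hr; apply: step_region_ray => //; exact: lt_le_trans kr.
- move=> t ht; apply: step_region_disk => //.
  by move: kt; rewrite ler_pdivlMr// => h; lra.
Qed.

Lemma continuous_contour_independent kappa1 kappa2 : 0 < kappa1 -> kappa1 < kappa2 ->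
  contour_integral theta kappa1 setT (gc mu T) = contour_integral theta kappa2 setT (gc mu T).
Proof.
move=> k0 k12; have [c1 _ _ h4 _] := theta_facts.
apply: (symbol_contour_independent beta a01 (B := 1) (lexx 1) (fun z h => h) (fun z h => h) id_cmp _ holo_id) => //.
- by move=> z _; rewrite Normc.normc1.
- move=> t ht; split; first exact: measurable_full_ray.
  by move=> r kr _; exact: slit_ray kr.
- by move=> r t /andP[r0 _] ht; exact: slit_polar.
Qed.

Lemma discrete_contour_independent kappa1 kappa2 : 0 < kappa1 -> kappa1 < kappa2 -> kappa2 <= 1 / tau ->
  contour_integral theta kappa1 (strip (pi / tau)) (gd tau mu T) =
  contour_integral theta kappa2 (strip (pi / tau)) (gd tau mu T).
Proof.
move=> k0 k12 kt; have [c1 _ _ h4 _] := theta_facts; have [A A1 hA] := @step_symbol_comparable R k hk.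
apply: (symbol_contour_independent beta a01 A1 (fun z (h : step_region tau z) => h.1)
  (fun z => slit_step_symbol hk t0) (fun z => hA tau z t0) (fun z => dstep_symbol_bound k t0) (holo_step t0)) => //.
- by move=> z hz; apply: strip_disk => //; exact: le_trans kt.
- move=> t ht; split; first exact: measurable_strip_ray.
  by move=> r kr hr; apply: step_region_ray => //; exact: lt_le_trans kr.
- move=> r t /andP[r0 r2] ht; apply: step_region_disk => //.
  move: kt; rewrite ler_pdivlMr// => h.
  have := ler_wpM2r (ltW t0) (ltW r2); rewrite -mulrA; lra.
Qed.

End fixed_data.

(** [Fsym_diff] costs one power of |z| and the accuracy gains tau^k |z|^(k+1), so the exponent is (k
    + 1) + (beta - alpha - 1). *)
Lemma symbol_diff : exists2 K, 0 < K & forall mu T tau z, 0 < mu -> 0 < tau -> step_region tau z ->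
  nc (gd tau mu T z - gc mu T z) <=
  K * tau ^+ k * (nc z `^ (k%:R + beta - alpha) * expR (Re z * T)).
Proof.
have [A A1 hA] := @step_symbol_comparable R k hk; have [K K0 hK] := Fsym_diff a01 beta A1.
exists (K * 2 ^+ k.+1); first by rewrite mulr_gt0// exprn_gt0.
move=> mu T tau z mu0 t0 rz; have [c1 c2] := hA tau z t0 rz.
have z0 := slit_neq0 rz.1; have n0 := nc_gt0 z0.
have := hK mu z (step_symbol k tau z) mu0 z0 (slit_neq0 (slit_step_symbol hk t0 rz))
  (same_side_step_symbol hk t0 rz) c1 c2.
have hacc := step_symbol_accuracy k t0 rz.
rewrite nc_distC [nc (z - _)]nc_distC => h.
rewrite /symbol -mulrBr (Normc.normcM (cexp _)) nc_exp Re_mulr.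
rewrite mulrA [leRHS]mulrC; apply: ler_wpM2l; first exact: expR_ge0.
apply: le_trans h _.
have E : nc z `^ (k%:R + beta - alpha) = nc z ^+ k.+1 * nc z `^ (beta - alpha - 1).
  rewrite -powR_mulrn ?(ltW n0)// -powRD ?(gt_eqF n0) ?implybT//.
  by congr (_ `^ _); rewrite -natr1; ring.
rewrite E mulrA; apply: ler_wpM2r; first exact: powR_ge0.
by apply: le_trans (ler_wpM2l (ltW K0) hacc) _; rewrite !mulrA.
Qed.

End geometry.

(** * The scalar error on the rays and on the arc *)

Section scalar_bound.
Context {R : realType}.
Local Notation C := R[i].
Local Notation nc := (@Normc.normc R).
Local Notation Re := (@complex.Re R).
Local Notation Im := (@complex.Im R).
Local Notation leb := (@lebesgue_measure R).

Lemma Cintegral_ray_diff (S : set R) (a c B : R) (f g : R -> C) :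
  0 <= a -> 0 < c -> 0 <= B -> measurable S -> S `<=` `[a, +oo[ ->
  Cintegrable S f -> Cintegrable `[a, +oo[ g ->
  (forall x, a <= x -> S x -> nc (f x - g x) <= B * expR (- c * x)) ->
  (forall x, a <= x -> ~ S x -> nc (g x) <= B * expR (- c * x)) ->
  nc (Cintegral S f - Cintegral `[a, +oo[ g) <= 2 * (B / c).
Proof.
move=> a0 c0 B0 mS SJ [f1 f2] [g1 g2] h1 h2; apply: le_trans (nc_le_ReIm _) _.
rewrite mulr2n mulrDl mul1r; apply: lerD; rewrite ?cReB ?cImB ?cReD ?cImD ?cReN ?cImN /=.
  apply: (Rintegral_diff_exp (f := fun x => Re (f x)) (g := fun x => Re (g x)) a0 c0 B0 mS SJ f1 g1) => x ax Sx.
    by apply: le_trans (h1 x ax Sx); rewrite -cReN -cReD; exact: nc_Re_le.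
  by apply: le_trans (h2 x ax Sx); exact: nc_Re_le.
apply: (Rintegral_diff_exp (f := fun x => Im (f x)) (g := fun x => Im (g x)) a0 c0 B0 mS SJ f2 g2) => x ax Sx.
  by apply: le_trans (h1 x ax Sx); rewrite -cImN -cImD; exact: nc_Im_le.
by apply: le_trans (h2 x ax Sx); exact: nc_Im_le.
Qed.

Lemma Rintegral_diff_le (a b M : R) (f g : R -> R) : a < b ->
  leb.-integrable `[a, b] (EFin \o f) -> leb.-integrable `[a, b] (EFin \o g) ->
  (forall x, a <= x <= b -> `|f x - g x| <= M) ->
  `|\int[leb]_(x in `[a, b]) f x - \int[leb]_(x in `[a, b]) g x| <= M * (b - a).
Proof.
move=> ab iF iG h; rewrite -RintegralB//.
have i2 : leb.-integrable `[a, b] (EFin \o (fun x => f x - g x)).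
  by have := @integrableB _ _ _ leb _ (measurable_itv _) _ _ iF iG.
apply: le_trans; first exact: (@le_normr_Rintegral _ _ _ leb _ _ (measurable_itv _) i2).
have E : \int[leb]_(x in `[a, b]) M = M * (b - a).
  rewrite (_ : M * (b - a) = M * b - M * a); last by rewrite mulrBr.
  apply: (@Rintegral_derive R (fun=> M) (fun x => M * x)) => // x _; first exact: cst_continuous.
  by apply: is_derive_ext (is_derive_mul (is_derive_cst M x 1) (is_derive_id x 1)) _ _; rewrite ?mul0r ?addr0 ?mulr1.
rewrite -E; apply: le_Rintegral => //.
- exact: (integrable_abse i2).
- by apply: integrable_segment => x _; exact: cst_continuous.
Qed.

Lemma Cintegral_arc_diff (a b M : R) (f g : R -> C) : a < b ->
  Cintegrable `[a, b] f -> Cintegrable `[a, b] g ->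
  (forall x, a <= x <= b -> nc (f x - g x) <= M) ->
  nc (Cintegral `[a, b] f - Cintegral `[a, b] g) <= 2 * (M * (b - a)).
Proof.
move=> ab [f1 f2] [g1 g2] h; apply: le_trans (nc_le_ReIm _) _.
rewrite mulr2n mulrDl mul1r; apply: lerD; rewrite ?cReD ?cImD ?cReN ?cImN /=.
  apply: (Rintegral_diff_le ab f1 g1) => x hx; apply: le_trans (h x hx).
  by rewrite -cReN -cReD; exact: nc_Re_le.
apply: (Rintegral_diff_le ab f2 g2) => x hx; apply: le_trans (h x hx).
by rewrite -cImN -cImD; exact: nc_Im_le.
Qed.

Lemma full_ray_set (kappa t : R) :
  [set r | kappa <= r /\ (setT : set C) (r%:C%C * cis t)] = `[kappa, +oo[%classic.
Proof. by apply/seteqP; split=> r /=; rewrite in_itv/= andbT => //; case. Qed.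

Variable theta : R.
Hypothesis th : pi / 2 < theta < pi / 2 + 1 / 2000.
Variables (k : nat) (hk : (1 <= k <= 6)%N) (alpha beta : R).
Hypothesis a01 : 0 < alpha < 1.
Local Notation gd tau := (symbol alpha beta (step_symbol k tau)).
Local Notation gc := (symbol alpha beta id).
Let p := k%:R + beta - alpha.
Hypothesis p0 : 0 <= p.

Let id_cmp (z : C) : slit z -> nc z <= 1 * nc z /\ nc z <= 1 * nc z.
Proof. by rewrite mul1r. Qed.

(** The integral of r^p e^(-c r) with c = - T cos theta is of order c^(-p-1), which yields the power
    of T. Beyond the truncation only the continuous integrand is left, and it obeys the same
    bound. *)
Lemma ray_diff : exists2 K, 0 < K & forall mu T tau kappa t, 0 < mu -> 0 < T -> 0 < tau ->
  0 < kappa -> kappa <= 1 / tau -> t = theta \/ t = - theta ->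
  nc (Cintegral [set r | kappa <= r /\ strip (pi / tau) (r%:C%C * cis t)]
       (fun r => gd tau mu T (r%:C%C * cis t) * cis t)
   - Cintegral [set r | kappa <= r /\ (setT : set C) (r%:C%C * cis t)]
       (fun r => gc mu T (r%:C%C * cis t) * cis t))
  <= K * tau ^+ k * T `^ (- (p + 1)).
Proof.
have [c1 _ s1 th0 _] := theta_facts th.
have [K1 K10 h1] := symbol_diff hk beta a01.
have [K3 K30 h3] := symbol_bound beta a01 (lexx 1) (fun z (h : slit z) => h) (fun z h => h) id_cmp.
have [L L0 hL] := powR_exp_scaled p0.
pose K := K1 + K3; have K0 : 0 < K by exact: addr_gt0.
pose q := - cos theta; have q0 : 0 < q by rewrite oppr_gt0.
exists (4 * K * L * q `^ (- (p + 1))); first by rewrite !mulr_gt0// powR_gt0.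
move=> mu T tau kappa t mu0 T0 t0 k0 kt ht.
pose c := q * T; have c0 : 0 < c by exact: mulr_gt0.
pose B := K * tau ^+ k * (L * c `^ (- p)).
have tk : 0 < tau ^+ k by exact: exprn_gt0.
have B0 : 0 <= B by rewrite !mulr_ge0 ?powR_ge0 ?(ltW K0) ?(ltW L0) ?(ltW tk).
have -> : 4 * K * L * q `^ (- (p + 1)) * tau ^+ k * T `^ (- (p + 1)) = 2 * (B / (c / 2)).
  rewrite /B.
  have -> : c `^ (- p) = q `^ (- (p + 1)) * T `^ (- (p + 1)) * c.
    rewrite -powRM ?(ltW q0) ?(ltW T0)// -/c -[X in _ * X]powRr1 ?(ltW c0)//.
    by rewrite -powRD ?(gt_eqF c0) ?implybT//; congr (_ `^ _); ring.
  by field; rewrite gt_eqF.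
have Bexp r : 0 <= r -> K * tau ^+ k * (r `^ p * expR (Re (r%:C%C * cis t) * T)) <= B * expR (- (c / 2) * r).
  move=> r0; rewrite /B -[leRHS]mulrA; apply: ler_wpM2l; first by rewrite mulr_ge0 ?(ltW K0) ?(ltW tk).
  rewrite Re_polar (cos_ray ht) (_ : r * cos theta * T = - c * r); last by rewrite /c /q; ring.
  exact: hL.
have [mS iS _ _] := discrete_contour_integrable th hk beta a01 mu0 T0 t0 k0 kt ht.
have [_ iT _ _] := continuous_contour_integrable th beta a01 mu0 T0 k0 ht.
rewrite full_ray_set in iT *.
apply: Cintegral_ray_diff => //; try (by rewrite ltW); try (by rewrite divr_gt0).
- by move=> r [h _]; rewrite /= in_itv/= h.
- move=> r kr [_ hr]; have r0 := lt_le_trans k0 kr.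
  rewrite -mulrBl Normc.normcM nc_cis mulr1.
  apply: le_trans (h1 mu T tau _ mu0 t0 (step_region_ray th ht t0 r0 hr)) _.
  rewrite nc_polar ?(ltW r0)//; apply: le_trans (Bexp r (ltW r0)).
  apply: ler_wpM2r; first by rewrite mulr_ge0 ?powR_ge0 ?expR_ge0.
  by apply: ler_wpM2r; [exact: ltW|rewrite /K lerDl ltW].
- move=> r kr nS; have r0 := lt_le_trans k0 kr.
  rewrite Normc.normcM nc_cis mulr1.
  apply: le_trans (h3 mu T _ mu0 (slit_polar th r0 (ray_bounds th ht))) _.
  rewrite nc_polar ?(ltW r0)//; apply: le_trans (Bexp r (ltW r0)).
  (* Beyond the truncation r tau > pi, so the factor (r tau)^k >= 1 can be inserted; the tail, which
     by itself contains no power of tau, then has the form of the main term. *)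
  have rt1 : 1 <= r * tau.
    have : ~ (r * sin theta <= pi / tau).
      by move=> h; apply: nS; split=> //; rewrite (strip_ray th _ ht (ltW r0)).
    move/negP; rewrite -ltNge ltr_pdivrMr// => h.
    have p2 := @pi_ge2 R; have h2 : pi < r * tau.
      apply: lt_le_trans h _; rewrite mulrAC; apply: ler_piMr; [exact: mulr_ge0 (ltW r0) (ltW t0)|exact: sin_le1].
    lra.
  have rk : 1 <= r ^+ k * tau ^+ k by rewrite -exprMn; apply: exprn_ege1.
  have E : r `^ p = r ^+ k * r `^ (beta - alpha).
    rewrite -powR_mulrn ?(ltW r0)// -powRD ?(gt_eqF r0) ?implybT//.
    by congr (_ `^ _); rewrite /p addrA.
  rewrite E [expR _ * _]mulrC mulrA [in leRHS]mulrA; apply: ler_wpM2r; first exact: expR_ge0.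
  rewrite mulrA; apply: ler_wpM2r; first exact: powR_ge0.
  rewrite -mulrA [tau ^+ k * _]mulrC; apply: (@le_trans _ _ K).
    by rewrite /K lerDr ltW.
  by rewrite ler_peMr// ltW.
Qed.

(** kappa T <= 1 gives both e^(T Re z) <= e on the arc and kappa^(p+1) <= T^(-p-1). *)
Lemma arc_diff : exists2 K, 0 < K & forall mu T tau kappa, 0 < mu -> 0 < T -> 0 < tau ->
  0 < kappa -> kappa <= 1 / tau -> kappa <= 1 / T ->
  nc (Cintegral [set t | - theta <= t <= theta /\ strip (pi / tau) (kappa%:C%C * cis t)]
       (fun t => gd tau mu T (kappa%:C%C * cis t) * ('i%C * (kappa%:C%C * cis t)))
   - Cintegral [set t | - theta <= t <= theta /\ (setT : set C) (kappa%:C%C * cis t)]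
       (fun t => gc mu T (kappa%:C%C * cis t) * ('i%C * (kappa%:C%C * cis t))))
  <= K * tau ^+ k * T `^ (- (p + 1)).
Proof.
have [c1 _ s1 th0 _] := theta_facts th.
have [K1 K10 h1] := symbol_diff hk beta a01.
exists (4 * K1 * expR 1 * theta); first by rewrite !mulr_gt0// expR_gt0.
move=> mu T tau kappa mu0 T0 t0 k0 kt kT.
have [_ _ _ iS] := discrete_contour_integrable th hk beta a01 mu0 T0 t0 k0 kt (or_introl erefl).
have [_ _ _ iT] := continuous_contour_integrable th beta a01 mu0 T0 k0 (or_introl erefl).
have e1 : [set t | - theta <= t <= theta /\ strip (pi / tau) (kappa%:C%C * cis t)] = `[- theta, theta]%classic.
  by apply: arc_set; [exact: ltW|move=> z hz; apply: strip_disk => //; exact: le_trans kt].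
have e2 : [set t | - theta <= t <= theta /\ (setT : set C) (kappa%:C%C * cis t)] = `[- theta, theta]%classic.
  by apply: arc_set => //; exact: ltW.
rewrite e1 in iS *; rewrite e2 in iT *.
have tk : 0 < tau ^+ k by exact: exprn_gt0.
have kT1 : kappa * T <= 1 by move: kT; rewrite ler_pdivlMr.
have ktau : kappa * tau <= 2 by move: kt; rewrite ler_pdivlMr// => h; lra.
have kp : kappa `^ p * kappa <= T `^ (- (p + 1)).
  rewrite -[X in _ * X]powRr1 ?(ltW k0)// -powRD ?(gt_eqF k0) ?implybT// powRN.
  rewrite -[leRHS]mul1r ler_pdivlMr ?powR_gt0// -powRM ?(ltW k0) ?(ltW T0)//.
  apply: (@le_trans _ _ (1 `^ (p + 1))); last by rewrite powR1.
  apply: ge0_ler_powR; rewrite ?nnegrE ?mulr_ge0 ?(ltW k0) ?(ltW T0)//.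
  by rewrite addr_ge0.
have -> : 4 * K1 * expR 1 * theta * tau ^+ k * T `^ (- (p + 1)) =
    2 * (K1 * tau ^+ k * (expR 1 * T `^ (- (p + 1))) * (theta - - theta)) by ring.
apply: Cintegral_arc_diff => //; first by rewrite gtrN.
move=> t ht; rewrite -mulrBl Normc.normcM (Normc.normcM 'i%C).
have nI : nc 'i%C = 1 by rewrite /Normc.normc /= expr0n add0r expr1n sqrtr1.
rewrite nI mul1r nc_polar ?(ltW k0)//.
have := h1 mu T tau _ mu0 t0 (step_region_disk th t0 k0 ktau ht).
rewrite nc_polar ?(ltW k0)// Re_polar => h.
apply: le_trans (ler_wpM2r (ltW k0) h) _.
rewrite -[leLHS]mulrA; apply: ler_wpM2l; first by rewrite mulr_ge0 ?(ltW K10) ?(ltW tk).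
rewrite mulrAC [leLHS]mulrC; apply: ler_pM; rewrite ?expR_ge0 ?mulr_ge0 ?powR_ge0 ?(ltW k0)//.
rewrite ler_expR; apply: le_trans kT1; rewrite -mulrA [cos t * T]mulrC mulrA.
by rewrite ler_piMr ?cos_le1// mulr_ge0// ltW.
Qed.

(** The arc estimate requires kappa <= 1/T. A larger kappa is first replaced by 1/T in both
    integrals; 1/T is an admissible radius because tau <= T. *)
Lemma contour_diff : exists2 K, 0 < K & forall mu T tau kappa, 0 < mu -> 0 < tau -> tau <= T ->
  0 < kappa -> kappa <= 1 / tau ->
  nc (contour_integral theta kappa (strip (pi / tau)) (gd tau mu T)
    - contour_integral theta kappa setT (gc mu T)) <= K * tau ^+ k * T `^ (- (p + 1)).
Proof.
have [K1 K10 h1] := ray_diff; have [K2 K20 h2] := arc_diff.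
exists (K1 + K1 + K2); first by rewrite !addr_gt0.
move=> mu T tau kappa mu0 t0 tT.
have T0 := lt_le_trans t0 tT.
have small kap : 0 < kap -> kap <= 1 / tau -> kap <= 1 / T ->
    nc (contour_integral theta kap (strip (pi / tau)) (gd tau mu T)
    - contour_integral theta kap setT (gc mu T)) <= (K1 + K1 + K2) * tau ^+ k * T `^ (- (p + 1)).
  move=> k0 kt kT; rewrite /contour_integral.
  have r1 := h1 mu T tau kap theta mu0 T0 t0 k0 kt (or_introl erefl).
  have r2 := h1 mu T tau kap (- theta) mu0 T0 t0 k0 kt (or_intror erefl).
  have r3 := h2 mu T tau kap mu0 T0 t0 k0 kt kT.
  have E (a b c a' b' c' : C) : a - b + c - (a' - b' + c') = (a - a') - (b - b') + (c - c') by ring.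
  have E' (x y : R) : (K1 + K1 + K2) * x * y = K1 * x * y + K1 * x * y + K2 * x * y by ring.
  rewrite E E'; apply: le_trans (le_normcD _ _) _; apply: lerD; last exact: r3.
  apply: le_trans (nc_B _ _) _; apply: lerD; [exact: r1|exact: r2].
move=> k0 kt; have [kT|kT] := leP kappa (1 / T); first exact: small.
have iT : 0 < 1 / T by rewrite divr_gt0.
rewrite -(discrete_contour_independent th hk beta a01 mu0 T0 t0 iT kT kt).
rewrite -(continuous_contour_independent th beta a01 mu0 T0 iT kT).
by apply: small => //; rewrite ler_pdivrMr// mulrAC mul1r ler_pdivlMr// mul1r.
Qed.

End scalar_bound.

(** * Weak derivatives and Sobolev functions *)

(** The sigma-algebra is generated by the coordinates, so an open set is written as the countable
    union of the boxes with rational centre and radius 1/(p+1) that it contains. *)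
Lemma open_measurable_rV (R : realType) n (U : set 'rV[R]_n) :
  open U -> measurable U.
Proof.
move=> oU.
pose B (p : nat * 'rV[rat]_n) : set 'rV[R]_n :=
  [set v | forall j, `|ratr (p.2 0 j) - v 0 j| < p.1.+1%:R^-1].
pose F i := if (unpickle i : option (nat * 'rV[rat]_n)) is Some p then
   if `[< B p `<=` U >] then B p else set0 else set0.
have -> : U = \bigcup_i F i.
  apply/seteqP; split => [x Ux|x [i _]]; last first.
    rewrite /F; case: (unpickle _) => // p; case: asboolP => // + Bx.
    exact.
  have := oU; rewrite openE => /(_ _ Ux) /nbhs_ballP[e /= e0 eU].
  have [N N0] : exists N : nat, N.+1%:R^-1 < e / 2.
    have e2 : 0 < e / 2 by rewrite divr_gt0.
    have [N _ /(_ _ (leqnn N))] := near_infty_natSinv_lt (PosNum e2).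
    by exists N.
  have hq (j : 'I_n) : exists q : rat, `|ratr q - x 0 j| < N.+1%:R^-1.
    have /rat_in_itvoo[q] : x 0 j < x 0 j + N.+1%:R^-1 by rewrite ltrDl.
    rewrite in_itv/= => /andP[h1 h2]; exists q.
    by rewrite ger0_norm ?subr_ge0 ?ltW// ltrBlDl.
  pose q : 'rV[rat]_n := \row_j projT1 (cid (hq j)).
  exists (pickle (N, q)) => //.
  rewrite /F pickleK.
  have Bx : B (N, q) x.
    by move=> j /=; rewrite mxE; case: cid.
  case: asboolP => // -[] y By; apply: eU.
  split => // i j; rewrite /ball/= (ord1 i).
  have := Bx j; have := By j; rewrite /= => h1 h2.
  rewrite (_ : x 0 j - y 0 j = (ratr (q 0 j) - y 0 j) - (ratr (q 0 j) - x 0 j)); last first.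
    by ring.
  rewrite (le_lt_trans (ler_normB _ _))// (splitr e) ltrD//; exact: (lt_trans _ N0).
apply: bigcupT_measurable => i; rewrite /F.
case: unpickle => [p|]; last exact: measurable0.
case: asboolP => _; last exact: measurable0.
rewrite (_ : B p = \bigcap_(j in [set: 'I_n])
   ((fun v : 'rV[R]_n => v 0 j : measurableTypeR R) @^-1` [set y | `|ratr (p.2 0 j) - y| < p.1.+1%:R^-1])).
  apply: fin_bigcap_measurable => // j _.
  rewrite -[X in measurable X]setTI; apply: measurable_coord => //.
  apply: open_measurable; exact: (@ball_open R R^o).
by apply/seteqP; split=> v /= h j; [move=> _|]; exact: h.
Qed.

Lemma continuous_measurable_rV (R : realType) n (f : 'rV[R]_n -> R) (D : set 'rV[R]_n) :
  measurable D -> continuous f -> measurable_fun D (f : 'rV[R]_n -> measurableTypeR R).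
Proof.
move=> mD cf; apply: (@measurable_funS _ _ _ _ setT) => //.
apply: (measurability _ (RGenOpens.measurableE R)) => _ [_ [a [b ->] <-]].
rewrite setTI; apply: open_measurable_rV.
by move/continuousP : cf; apply; exact: interval_open.
Qed.


Lemma continuous_rV (R : realType) (T : topologicalType) n (f : T -> 'rV[R]_n) :
  (forall j, continuous (fun x => f x 0 j)) -> continuous f.
Proof.
move=> cf x; apply/cvg_ballP => e e0.
have : \forall y \near x, forall j, ball (f x 0 j) e (f y 0 j).
  apply: filter_forall => j.
  by have := cf j x; move/cvg_ballP => /(_ _ e0).
apply: filterS => y h; split => // i j; rewrite (ord1 i); exact: h.
Qed.

Lemma coord_continuous_rV (R : realType) n (j : 'I_n) :
  continuous (fun v : 'rV[R]_n => v 0 j).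
Proof. exact: coord_continuous. Qed.

(** * Cubes: compactness, finite measure, integrability of continuous functions supported in them *)

Section box.
Context {R : realType}.

Definition cbox n (B : R) : set 'rV[R]_n := [set v | forall j, `|v 0 j| <= B].

Lemma measurable_cbox n B : measurable (@cbox n B).
Proof.
rewrite (_ : cbox B = \bigcap_(j in [set: 'I_n])
   ((fun v : 'rV[R]_n => v 0 j : measurableTypeR R) @^-1` [set y | `|y| <= B])).
  apply: fin_bigcap_measurable => // j _.
  rewrite -[X in measurable X]setTI; apply: measurable_coord => //.
  rewrite (_ : mkset _ = `[-B, B]%classic); first exact: measurable_itv.
  by apply/seteqP; split => x /=; rewrite in_itv/= ler_norml.
by apply/seteqP; split=> v /= h j; [move=> _|]; exact: h.
Qed.

Lemma rv_cons0 n (p : measurableTypeR R * 'rV[R]_n) : rv_cons p 0 ord0 = p.1.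
Proof.
rewrite /rv_cons; have -> : ord0 = lshift n (0 : 'I_1) by exact: val_inj.
by apply: etrans (row_mxEl _ _ _ _) _; rewrite mxE eqxx mulr1n.
Qed.

Lemma rv_consS n (p : measurableTypeR R * 'rV[R]_n) j :
  rv_cons p 0 (lift ord0 j) = p.2 0 j.
Proof.
rewrite /rv_cons; have -> : lift ord0 j = rshift 1 j by exact: val_inj.
exact: (row_mxEr _ _ _ _).
Qed.

Lemma rv_cons_cbox n B :
  @rv_cons R n @^-1` (@cbox n.+1 B) = [set x | `|x| <= B] `*` @cbox n B.
Proof.
apply/seteqP; split => -[x v] /=.
  move=> h; split => /=; first by have := h ord0; rewrite rv_cons0.
  by move=> j; have := h (lift ord0 j); rewrite rv_consS.
move=> [/= hx hv] j; case: (unliftP ord0 j) => [i ->|->].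
  by rewrite rv_consS; exact: hv.
by rewrite rv_cons0.
Qed.

Lemma lebesgue_cbox_lty n B : (lebesgue_rv n (@cbox n B) < +oo)%E.
Proof.
elim: n => [|n IH]; first by rewrite /= diracE; case: (_ \in _); rewrite ?ltry.
have -> : lebesgue_rv n.+1 (@cbox n.+1 B) =
   (@lebesgue_measure R \x lebesgue_rv n)%E (@rv_cons R n @^-1` (@cbox n.+1 B)) by [].
have E : [set x : R | `|x| <= B] = `[-B, B]%classic.
  by apply/seteqP; split => x /=; rewrite in_itv/= ler_norml.
rewrite rv_cons_cbox product_measure1E//; last 2 first.
- rewrite E; exact: measurable_itv.
- exact: measurable_cbox.
have leb : (@lebesgue_measure R (`[(- B)%R, B]%classic) < +oo)%E.
  by rewrite lebesgue_measure_itv/=; case: ifP => // _; rewrite -EFinB ltry.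
rewrite E lte_mul_pinfty// ge0_fin_numE//.
Qed.

Lemma compact_cbox n B : compact (@cbox n B).
Proof.
apply: bounded_closed_compact.
  exists `|B|; split; first exact: num_real.
  move=> M BM v /= hv.
  have M0 : 0 <= M by rewrite (le_trans (normr_ge0 B))// ltW.
  rewrite /Num.norm/= mx_normrE; apply/bigmax_leP; split=> // -[i j] _ /=.
  by rewrite (ord1 i) (le_trans (hv j))// (le_trans (ler_norm _))// ltW.
rewrite (_ : cbox B = \bigcap_(j in [set: 'I_n])
   ((fun v : 'rV[R]_n => v 0 j) @^-1` [set y | `|y| <= B])); last first.
  by apply/seteqP; split=> v /= h j; [move=> _|]; exact: h.
apply: closed_bigI => j _; apply: closed_comp.
  by move=> v _; exact: coord_continuous_rV.
rewrite (_ : mkset _ = `[-B, B]%classic); first exact: interval_closed.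
by apply/seteqP; split => x /=; rewrite in_itv/= ler_norml.
Qed.

Lemma compact_sub_cbox n (C : set 'rV[R]_n) : compact C -> exists B, C `<=` cbox B.
Proof.
move=> /compact_bounded[M [_ /(_ (M + 1))]]; rewrite ltrDl ltr01 => /(_ isT) h.
exists (M + 1) => v /h /=; rewrite /Num.norm/= mx_normrE => /bigmax_leP[_ hv] j.
exact: (hv (ord0, j)).
Qed.

Lemma integrable_box n B (f : 'rV[R]_n -> R) : continuous f ->
  (forall v, ~ cbox B v -> f v = 0) ->
  (lebesgue_rv n).-integrable setT (EFin \o f).
Proof.
move=> cf f0.
have -> : EFin \o f = (EFin \o f) \_ (cbox B).
  apply/funext => v; rewrite patchE; case: ifPn => // /negP h.
  by rewrite /= f0// => /mem_set.
apply/(integrable_restrict _ _ _) => //; rewrite ?setTI//.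
  exact: measurable_cbox.
apply: measurable_bounded_integrable.
- exact: measurable_cbox.
- exact: lebesgue_cbox_lty.
- by apply: continuous_measurable_rV => //; exact: measurable_cbox.
- have /compact_bounded[M [Mr hM]] : compact (f @` cbox B).
    apply: continuous_compact; last exact: compact_cbox.
    exact: continuous_subspaceT.
  exists M; split => // x Mx v Bv; apply: (hM x Mx); by exists v.
Qed.
End box.

(** * Vanishing integral of a partial derivative of compact support *)

Section int_partial.
Context {R : realType}.

Lemma cons_scale n (h : R) (x : R) (v u : 'rV[R]_n) :
  rv_cons (x : measurableTypeR R, h *: u + v) = h *: rv_cons (0 : measurableTypeR R, u) + rv_cons (x : measurableTypeR R, v).
Proof.
apply/rowP => j; rewrite [RHS]mxE [X in _ = X + _]mxE.
case: (unliftP ord0 j) => [i ->|->]; first by rewrite !rv_consS !mxE.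
by rewrite !rv_cons0 /= mulr0 add0r.
Qed.

Lemma cons_scale0 n (h : R) (x y : R) (v : 'rV[R]_n) :
  rv_cons ((h *: x + y : R) : measurableTypeR R, v) = h *: rv_cons (x : measurableTypeR R, 0) + rv_cons (y : measurableTypeR R, v).
Proof.
apply/rowP => j; rewrite [RHS]mxE [X in _ = X + _]mxE.
case: (unliftP ord0 j) => [i ->|->]; first by rewrite !rv_consS /= mxE mulr0 add0r.
by rewrite !rv_cons0.
Qed.

Lemma delta_lift n (i : 'I_n) :
  delta_mx 0 (lift ord0 i) = rv_cons (0 : measurableTypeR R, delta_mx 0 i) :> 'rV_n.+1.
Proof.
apply/rowP => j; case: (unliftP ord0 j) => [k ->|->].
  by rewrite rv_consS !mxE (inj_eq (@lift_inj _ ord0)).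
by rewrite rv_cons0 !mxE.
Qed.

Lemma delta_ord0 n :
  delta_mx 0 ord0 = rv_cons (1 : measurableTypeR R, 0) :> 'rV[R]_n.+1.
Proof.
apply/rowP => j; case: (unliftP ord0 j) => [k ->|->].
  by rewrite rv_consS !mxE.
by rewrite rv_cons0 !mxE eqxx.
Qed.

(** Stated for difference quotients, so that derivability and the value of the derivative pass to
    slices together. *)
Lemma quotient_lift n (F : 'rV[R]_n.+1 -> R) (x : R) (v : 'rV[R]_n) i :
  (fun h : R => h^-1 *: ((F \o shift (rv_cons (x : measurableTypeR R, v))) (h *: delta_mx 0 (lift ord0 i))
     - F (rv_cons (x : measurableTypeR R, v)))) =
  (fun h : R => h^-1 *: (((fun w => F (rv_cons (x : measurableTypeR R, w))) \o shift v) (h *: delta_mx 0 i)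
     - F (rv_cons (x : measurableTypeR R, v)))).
Proof. by apply/funext => h; rewrite /= delta_lift -cons_scale. Qed.

Lemma quotient_ord0 n (F : 'rV[R]_n.+1 -> R) (x : R) (v : 'rV[R]_n) :
  (fun h : R => h^-1 *: ((F \o shift (rv_cons (x : measurableTypeR R, v))) (h *: delta_mx 0 ord0)
     - F (rv_cons (x : measurableTypeR R, v)))) =
  (fun h : R => h^-1 *: (((fun y : R => F (rv_cons (y : measurableTypeR R, v))) \o shift x) (h *: (1 : R))
     - F (rv_cons (x : measurableTypeR R, v)))).
Proof. by apply/funext => h; rewrite /= delta_ord0 -cons_scale0. Qed.

Lemma continuous_rv_cons n (x : R) :
  continuous (fun v : 'rV[R]_n => rv_cons (x : measurableTypeR R, v)).
Proof.
apply: continuous_rV => j; case: (unliftP ord0 j) => [k ->|->].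
  by under eq_fun do rewrite rv_consS /=; exact: coord_continuous_rV.
by under eq_fun do rewrite rv_cons0 /=; exact: cst_continuous.
Qed.

Lemma continuous_rv_cons0 n (v : 'rV[R]_n) :
  continuous (fun x : R => rv_cons (x : measurableTypeR R, v)).
Proof.
apply: continuous_rV => j; case: (unliftP ord0 j) => [k ->|->].
  by under eq_fun do rewrite rv_consS /=; exact: cst_continuous.
by under eq_fun do rewrite rv_cons0 /=; move=> x; exact: cvg_id.
Qed.

Lemma derive_outside_cbox n B (F : 'rV[R]_n -> R) u :
  (forall v, ~ cbox B v -> F v = 0) -> forall v, ~ cbox B v -> 'D_u F v = 0.
Proof.
move=> F0 v nBv; rewrite (near_eq_derive (g := cst 0)) ?derive_cst//.
have oC : open (~` (@cbox R n B)).
  by apply: closed_openC; apply: compact_closed; [exact: norm_hausdorff|exact: compact_cbox].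
by apply: filterS (open_nbhs_nbhs (conj oC nBv)) => w /= /F0.
Qed.

Lemma integral_derive_bounded_support B (f : R -> R) :
  (forall x, derivable f x 1) -> continuous (fun x => 'D_1 f x) ->
  (forall x, B < `|x| -> f x = 0) ->
  (\int[@lebesgue_measure R]_x ('D_1 f x)%:E = 0)%E.
Proof.
move=> df cdf f0.
have Df0 x : B < `|x| -> 'D_1 f x = 0.
  move=> Bx; rewrite (near_eq_derive (g := cst 0)) ?derive_cst//.
  have oC : open [set y : R | B < `|y|].
    rewrite (_ : mkset _ = (fun y : R => `|y|) @^-1` [set y | y > B])//.
    apply: open_comp; last exact: open_gt.
    by move=> y _; exact: norm_continuous.
  by apply: filterS (open_nbhs_nbhs (conj oC Bx)) => w /= /f0.
pose M := `|B| + 1.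
have BM : B < M by rewrite /M ltr_pwDr// ler_norm.
have M0 : 0 < M by rewrite /M ltr_pwDr.
have -> : (fun x => ('D_1 f x)%:E) = ((fun x => ('D_1 f x)%:E) \_ `[-M, M]).
  apply/funext => x; rewrite patchE; case: ifPn => // /negP h.
  rewrite Df0//; rewrite ltNge; apply/negP => xB; apply: h.
  by rewrite inE/= in_itv/= -ler_norml (le_trans xB)// ltW.
have cf : continuous f.
  by move=> x; apply: differentiable_continuous; exact/derivable1_diffP.
rewrite -integral_mkcond (@continuous_FTC2 _ _ f).
- by rewrite !f0 ?subee// ?normrN gtr0_norm.
- by rewrite gtrN.
- exact: continuous_subspaceT.
- split.
  + by move=> x _; exact: df.
  + by apply: cvg_at_right_filter; exact: cf.
  + by apply: cvg_at_left_filter; exact: cf.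
- by move=> x _; rewrite derive1E.
Qed.

Lemma rv_cons_notin n B (x : R) (v : 'rV[R]_n) :
  ~ cbox B (rv_cons (x : measurableTypeR R, v)) <-> (B < `|x|) \/ ~ cbox B v.
Proof.
have := rv_cons_cbox n B; move/seteqP => -[/(_ (x, v)) /= h1 /(_ (x, v)) /= h2].
split.
  move=> h; have [Bx|xB] := ltP B `|x|; [by left|right=> hv].
  by apply: h; apply: h2.
by move=> [Bx|nv] h; have [/=] := h1 h; [rewrite leNgt Bx|].
Qed.

(** Fubini along [rv_cons]: in the first direction the inner integral over the line vanishes by the
    fundamental theorem of calculus, in any other direction the integral over each slice vanishes by
    induction. *)
Lemma integral_partial n B (i : 'I_n) (F : 'rV[R]_n -> R) :
  continuous F -> (forall v, derivable F v (delta_mx 0 i)) ->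
  continuous (partial i F) -> (forall v, ~ cbox B v -> F v = 0) ->
  (\int[lebesgue_rv n]_v (partial i F v)%:E = 0)%E.
Proof.
elim: n i F => [[]//|n IH] i F cF dF cdF F0.
have iF : (lebesgue_rv n.+1).-integrable setT (EFin \o partial i F).
  apply: (@integrable_box _ _ B) => // v nBv; exact: derive_outside_cbox nBv.
pose mu := (@lebesgue_measure R \x lebesgue_rv n)%E.
have mG : measurable_fun setT (EFin \o partial i F) by exact: measurable_int iF.
have iG : mu.-integrable setT ((EFin \o partial i F) \o @rv_cons R n).
  apply/integrableP; split.
    by apply: measurableT_comp => //; exact: measurable_rv_cons.
  have /integrableP[_] := iF; congr (_ < _)%E.
  exact: (@ge0_integral_pushforward _ _ _ _ R _ (@measurable_rv_cons R n) mu setT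
     (abse \o (EFin \o partial i F)) measurableT (measurableT_comp (@abse_measurable _ _) mG)
     (fun _ _ => abse_ge0 _)).
have -> : (\int[lebesgue_rv n.+1]_v (partial i F v)%:E =
   \int[mu]_p ((EFin \o partial i F) \o @rv_cons R n) p)%E.
  exact: (integral_pushforward (@measurable_rv_cons R n)).
case: (unliftP ord0 i) => [j ij|i0].
  rewrite -integral12_prod_meas1//= integral0_eq// => x _.
  rewrite -[RHS](IH j (fun w => F (rv_cons (x : measurableTypeR R, w)))).
  + apply: eq_integral => v _; congr EFin.
    by rewrite /partial ij /derive quotient_lift.
  + by move=> v; apply: continuous_comp; [exact: continuous_rv_cons|exact: cF].
  + move=> v; have := dF (rv_cons (x : measurableTypeR R, v)).
    by rewrite /derivable ij quotient_lift.
  + have -> : partial j (fun w => F (rv_cons (x : measurableTypeR R, w))) =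
       fun v => partial i F (rv_cons (x : measurableTypeR R, v)).
      by apply/funext => v; rewrite /partial ij /derive quotient_lift.
    by move=> v; apply: continuous_comp; [exact: continuous_rv_cons|exact: cdF].
  + by move=> v nv; apply: F0; apply/rv_cons_notin; right.
rewrite -integral21_prod_meas1//= integral0_eq// => v _.
have DF x : 'D_1 (fun y : R => F (rv_cons (y : measurableTypeR R, v))) x =
     partial i F (rv_cons (x : measurableTypeR R, v)).
  by rewrite /partial i0 /derive quotient_ord0.
rewrite -[RHS](@integral_derive_bounded_support B (fun y : R => F (rv_cons (y : measurableTypeR R, v)))).
- by apply: eq_integral => x _; rewrite DF.
- move=> x; have := dF (rv_cons (x : measurableTypeR R, v)).
  by rewrite /derivable i0 quotient_ord0.
- under eq_fun do rewrite DF.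
  by move=> x; apply: continuous_comp; [exact: continuous_rv_cons0|exact: cdF].
- by move=> x Bx; apply: F0; apply/rv_cons_notin; left.
Qed.

End int_partial.

Lemma sum_sqr_eq0 (R : realDomainType) n (c : 'I_n -> R) :
  \sum_i c i ^+ 2 = 0 -> forall i, c i = 0.
Proof.
move=> h i; apply/eqP; rewrite -sqrf_eq0; apply/eqP.
by apply: (psumr_eq0P _ h) => // j _; exact: sqr_ge0.
Qed.

(* For the complex eigenvector p + iq with eigenvalue x + iy, symmetry of A
   gives y * (|p|^2 + |q|^2) = 0. *)
Lemma symmetric_real_eigenvector (R : rcfType) n (A : 'M[R]_n.+1) : A^T = A ->
  exists (l : R) (v : 'rV[R]_n.+1), v != 0 /\ v *m A = l *: v.
Proof.
move=> sA.
pose A' : 'M[R[i]]_n.+1 := map_mx (real_complex R) A.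
have [//|z /eigenvalueP[v vA v0]] := @eigenvalue_closed _ _ A'.
pose p : 'rV[R]_n.+1 := map_mx (@complex.Re R) v.
pose q : 'rV[R]_n.+1 := map_mx (@complex.Im R) v.
have vA' j : \sum_k v 0 k * (A k j)%:C%C = z * v 0 j.
  have := congr1 (fun M : 'rV_n.+1 => M 0 j) vA; rewrite !mxE => <-.
  by apply: eq_bigr => k _; rewrite !mxE.
have ReA j : complex.Re (\sum_k v 0 k * (A k j)%:C%C) = (p *m A) 0 j.
  rewrite mxE (big_morph (@complex.Re R) (id1 := 0) (op1 := +%R))//; last by case=> ? ? [].
  apply: eq_bigr => k _; rewrite !mxE; case: (v 0 k) => a b /=.
  by rewrite mulr0 subr0.
have ImA j : complex.Im (\sum_k v 0 k * (A k j)%:C%C) = (q *m A) 0 j.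
  rewrite mxE (big_morph (@complex.Im R) (id1 := 0) (op1 := +%R))//; last by case=> ? ? [].
  apply: eq_bigr => k _; rewrite !mxE; case: (v 0 k) => a b /=.
  by rewrite mulr0 add0r.
set x := complex.Re z; set y := complex.Im z.
have pA : p *m A = x *: p - y *: q.
  apply/rowP => j; rewrite -ReA vA' !mxE /x /y; by case: (z) (v 0 j) => ? ? [].
have qA : q *m A = x *: q + y *: p.
  apply/rowP => j; rewrite -ImA vA' !mxE /x /y; by case: (z) (v 0 j) => ? ? [].
have sym : (p *m A) *m q^T = (q *m A) *m p^T.
  by rewrite -[RHS]trmxK; rewrite (mx11_scalar ((q *m A *m p^T)^T)) tr_scalar_mx -mx11_scalar
   !trmx_mul trmxK sA mulmxA.
have pp (w : 'rV[R]_n.+1) : (w *m w^T) 0 0 = \sum_k w 0 k ^+ 2.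
  by rewrite mxE; apply: eq_bigr => k _; rewrite mxE expr2.
have qp : (q *m p^T) 0 0 = (p *m q^T) 0 0.
  by rewrite !mxE; apply: eq_bigr => k _; rewrite !mxE mulrC.
have : y * (\sum_k q 0 k ^+ 2 + \sum_k p 0 k ^+ 2) = 0.
  rewrite -!pp; move: sym; rewrite pA qA mulmxBl mulmxDl -!scalemxAl.
  move/(congr1 (fun M : 'M[R]_1 => M 0 0)).
  rewrite ![fun_of_matrix (_ + _) _ _]mxE ![fun_of_matrix (- _) _ _]mxE.
  rewrite ![fun_of_matrix (_ *: _) _ _]mxE qp => sym.
  set a := (p *m q^T) 0 0 in sym; set b := (q *m q^T) 0 0 in sym *; set c := (p *m p^T) 0 0 in sym *.
  rewrite (_ : y * (b + c) = (x * a + y * c) - (x * a - y * b)); last by ring.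
  by rewrite sym subrr.
move/eqP; rewrite mulf_eq0 => /orP[/eqP y0|].
  have [p0|p0] := eqVneq p 0; last by exists x, p; rewrite pA y0 scale0r subr0.
  have [q0|q0] := eqVneq q 0; last by exists x, q; rewrite qA y0 scale0r addr0.
  case/eqP: v0; apply/rowP => k; rewrite mxE.
  move/(congr1 (fun M : 'rV_n.+1 => M 0 k)): p0; move/(congr1 (fun M : 'rV_n.+1 => M 0 k)): q0.
  by rewrite !mxE; case: (v 0 k) => a b /= -> ->.
rewrite paddr_eq0 ?sumr_ge0// => [/andP[/eqP hq /eqP hp]|k _|k _]; rewrite ?sqr_ge0//.
case/eqP: v0; apply/rowP => k; rewrite mxE.
have := sum_sqr_eq0 hp k; have := sum_sqr_eq0 hq k; rewrite !mxE.
by case: (v 0 k) => a b /= -> ->.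
Qed.

(** * Eigenbasis of a semidefinite form relative to another one *)

Section form.
Context {R : rcfType} {V : lmodType R}.

(** Semidefinite, since functions are not taken modulo null sets; restricted to a set S, since
    integrals are linear only on suitable functions. *)
Record psd_form (S : V -> Prop) (b : V -> V -> R) : Prop := PsdForm {
  form0 : S 0;
  formS : forall a u v, S u -> S v -> S (a *: u + v);
  formC : forall u v, S u -> S v -> b u v = b v u;
  formL : forall a u v w, S u -> S v -> S w -> b (a *: u + v) w = a * b u w + b v w;
  form_ge0 : forall u, S u -> 0 <= b u u }.

Section theory.
Variables (S : V -> Prop) (b : V -> V -> R).
Hypothesis Sb : psd_form S b.
Let S0 := form0 Sb.
Let Slin := formS Sb.
Let bC := formC Sb.
Let blin := formL Sb.
Let bge0 := form_ge0 Sb.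

Lemma formZ a u : S u -> S (a *: u).
Proof. by move=> Su; rewrite -[_ *: _]addr0; exact: Slin. Qed.

Lemma formD u v : S u -> S v -> S (u + v).
Proof. by move=> Su Sv; rewrite -[u]scale1r; exact: Slin. Qed.

Lemma formB u v : S u -> S v -> S (u - v).
Proof. by move=> Su Sv; rewrite addrC -scaleN1r; exact: Slin. Qed.

Lemma form_sum n (c : 'I_n -> R) (e : 'I_n -> V) : (forall i, S (e i)) ->
  S (\sum_i c i *: e i).
Proof.
by move=> Se; apply: (big_ind S) => //; [exact: formD|move=> i _; exact: formZ].
Qed.

Lemma form0l w : S w -> b 0 w = 0.
Proof.
move=> Sw; have := blin 1 S0 S0 Sw; rewrite scale1r addr0 mul1r.
by move/eqP; rewrite -subr_eq subrr => /eqP.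
Qed.

Lemma formZl a u w : S u -> S w -> b (a *: u) w = a * b u w.
Proof. by move=> Su Sw; rewrite -[_ *: _]addr0 blin// form0l// addr0. Qed.

Lemma formDl u v w : S u -> S v -> S w -> b (u + v) w = b u w + b v w.
Proof. by move=> Su Sv Sw; rewrite -[u]scale1r blin// mul1r scale1r. Qed.

Lemma formBl u v w : S u -> S v -> S w -> b (u - v) w = b u w - b v w.
Proof. by move=> Su Sv Sw; rewrite addrC -scaleN1r blin// mulN1r addrC. Qed.

Lemma formBr u v w : S u -> S v -> S w -> b w (u - v) = b w u - b w v.
Proof. by move=> Su Sv Sw; rewrite bC ?formBl// 1?[b w u]bC// ?[b w v]bC//; exact: formB. Qed.

Lemma form_suml n (c : 'I_n -> R) (e : 'I_n -> V) w : (forall i, S (e i)) -> S w ->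
  b (\sum_i c i *: e i) w = \sum_i c i * b (e i) w.
Proof.
move=> Se Sw; elim: n c e Se => [|n IH] c e Se; first by rewrite !big_ord0 form0l.
rewrite !big_ord_recr/= formDl ?IH ?formZl//; first exact: form_sum.
exact: formZ.
Qed.

Lemma form_sumr n (c : 'I_n -> R) (e : 'I_n -> V) w : (forall i, S (e i)) -> S w ->
  b w (\sum_i c i *: e i) = \sum_i c i * b w (e i).
Proof.
move=> Se Sw; rewrite bC ?form_suml//; last exact: form_sum.
by apply: eq_bigr => i _; rewrite bC.
Qed.

Lemma form_sqrB u v : S u -> S v -> b (u - v) (u - v) = b u u - 2 * b u v + b v v.
Proof.
move=> Su Sv; rewrite formBl ?formBr//; last exact: formB.
by rewrite (bC Sv Su); ring.
Qed.

Lemma form_CauchySchwarz u v : S u -> S v -> b u v ^+ 2 <= b u u * b v v.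
Proof.
move=> Su Sv.
have h t : 0 <= t ^+ 2 * b u u - 2 * t * b u v + b v v.
  have := bge0 (formB (formZ t Su) Sv).
  rewrite form_sqrB ?formZl// ?(bC Su) ?formZl//; try exact: formZ.
  by rewrite (bC Sv Su) expr2 -!mulrA.
have [u0|u0] := eqVneq (b u u) 0.
  rewrite u0 mul0r; have [->|uv0] := eqVneq (b u v) 0; first by rewrite expr0n.
  (* For b u u = 0 the quadratic is affine in t, and at this t its value is -1. *)
  have := h ((b v v + 1) / (2 * b u v)).
  rewrite u0 mulr0 add0r.
  have -> : 2 * ((b v v + 1) / (2 * b u v)) * b u v = b v v + 1 by field.
  lra.
have u1 : 0 < b u u by rewrite lt_neqAle eq_sym u0 bge0.
have := h (b u v / b u u).
have -> : (b u v / b u u) ^+ 2 * b u u - 2 * (b u v / b u u) * b u v + b v v =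
   (b u u * b v v - b u v ^+ 2) / b u u by field.
by rewrite pmulr_lge0 ?invr_gt0// subr_ge0.
Qed.

Lemma form_eq0l u v : S u -> S v -> b u u = 0 -> b u v = 0.
Proof.
move=> Su Sv u0; have := form_CauchySchwarz Su Sv; rewrite u0 mul0r => h.
by apply/eqP; rewrite -sqrf_eq0 eq_le h sqr_ge0.
Qed.

Lemma form_sqrD_le u v : S u -> S v -> b (u + v) (u + v) <= 2 * b u u + 2 * b v v.
Proof.
move=> Su Sv; have := bge0 (formB Su Sv); rewrite form_sqrB// => h.
rewrite formDl// ?(bC Su (formD Su Sv)) ?(bC Sv (formD Su Sv)) ?formDl//; last exact: formD.
by rewrite (bC Sv Su); lra.
Qed.

Definition orthonormal_in n (e : 'I_n -> V) :=
  (forall i, S (e i)) /\ (forall i j, b (e i) (e j) = (i == j)%:R).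

Lemma form_residual n (e : 'I_n -> V) v : orthonormal_in e -> S v ->
  let r := v - \sum_i b v (e i) *: e i in
  S r /\ forall i, b r (e i) = 0.
Proof.
move=> [Se oe] Sv r; have Sr : S r by apply: formB => //; exact: form_sum.
split=> // i; rewrite formBl ?form_suml//; last exact: form_sum.
rewrite (bigD1 i)//= oe eqxx mulr1 big1 ?addr0 ?subrr// => j ji.
by rewrite oe (negbTE ji) mulr0.
Qed.

(** Bounds by M the dimension of S modulo the vectors on which b vanishes. *)
Definition form_rank_le (M : nat) := forall e : 'I_M.+1 -> V, (forall i, S (e i)) ->
  exists2 c : 'I_M.+1 -> R, exists i, c i != 0 &
    b (\sum_i c i *: e i) (\sum_i c i *: e i) = 0.

Lemma orthonormal_size n (e : 'I_n -> V) M : orthonormal_in e -> form_rank_le M -> (n <= M)%N.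
Proof.
move=> [Se oe] rM; rewrite leqNgt; apply/negP => Mn.
pose f i := e (widen_ord Mn i).
have Sf i : S (f i) by exact: Se.
have of_ i j : b (f i) (f j) = (i == j)%:R by exact: oe.
have [c [i ci]] := rM f Sf.
have SS : S (\sum_i c i *: f i) by exact: form_sum.
rewrite form_suml//; under eq_bigr do rewrite form_sumr//.
under eq_bigr => j _.
  rewrite (bigD1 j)//= of_ eqxx mulr1 big1 => [|l lj]; last first.
    by rewrite of_ eq_sym (negbTE lj) mulr0.
  rewrite addr0 -expr2; over.
by move=> /sum_sqr_eq0/(_ i)/eqP; rewrite (negbTE ci).
Qed.

Lemma orthonormal_extend n (e : 'I_n -> V) u : orthonormal_in e -> S u ->
  (forall i, b u (e i) = 0) -> b u u != 0 ->
  orthonormal_in (fun i : 'I_n.+1 => if unlift ord0 i is Some j then e j else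
     (Num.sqrt (b u u))^-1 *: u).
Proof.
move=> [Se oe] Su ue u0.
have u1 : 0 < b u u by rewrite lt_neqAle eq_sym u0 bge0.
have s0 : Num.sqrt (b u u) != 0 by rewrite gt_eqF// sqrtr_gt0.
split.
  by move=> i; case: unliftP => // _; exact: formZ.
move=> i j; case: (unliftP ord0 i) => [k ->|->]; case: (unliftP ord0 j) => [l ->|->].
- by rewrite oe (inj_eq (@lift_inj _ ord0)).
- by rewrite bC// ?formZl ?ue ?mulr0//; exact: formZ.
- by rewrite formZl ?ue ?mulr0.
- rewrite formZl//; last exact: formZ.
  rewrite bC ?formZl//; last exact: formZ.
  move: (sqr_sqrtr (ltW u1)) s0; move: (Num.sqrt _) => s <- s0; rewrite eqxx mulr1n; by field.
Qed.

(** An orthonormal family of maximal size: a residual with nonzero norm could be normalized and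
    added. *)
Lemma orthonormal_basis M : form_rank_le M ->
  exists n (e : 'I_n -> V), orthonormal_in e /\
   forall v, S v -> b (v - \sum_i b v (e i) *: e i) (v - \sum_i b v (e i) *: e i) = 0.
Proof.
move=> rM.
pose P n := `[< exists e : 'I_n -> V, orthonormal_in e >].
have P0 : exists n, P n.
  by exists 0%N; apply/asboolP; exists (fun=> 0); split => -[].
have PM n : P n -> (n <= M)%N by move=> /asboolP[e oe]; exact: orthonormal_size oe rM.
case: (ex_maxnP P0 PM) => n /asboolP[e oe] nmax.
exists n, e; split => // v Sv; apply/eqP/negPn/negP => h.
have [Sr re] := form_residual oe Sv.
suff : P n.+1 by move/nmax; rewrite ltnn.
by apply/asboolP; eexists; exact: orthonormal_extend oe Sr re h.
Qed.

End theory.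

Section eigenbasis.
Variables (S : V -> Prop) (b a : V -> V -> R) (M : nat).
Hypothesis Sb : psd_form S b.
Hypothesis Sa : psd_form S a.
Hypothesis ab0 : forall u v, S u -> S v -> b u u = 0 -> a u v = 0.
Hypothesis rM : form_rank_le S b M.

Definition orthonormal_eigen n (e : 'I_n -> V) (mu : 'I_n -> R) :=
  orthonormal_in S b e /\ forall i v, S v -> a (e i) v = mu i * b (e i) v.

(** On the b-orthogonal complement S' of the eigenvectors found so far, the matrix of a in an
    orthonormal basis of S' is symmetric and has a real eigenvector; it gives u. [ab0] lets a ignore
    the part of S' that the basis misses. *)
Lemma eigenvector_in_orthogonal n (e : 'I_n -> V) (mu : 'I_n -> R) v :
  orthonormal_eigen e mu -> S v -> (forall i, b v (e i) = 0) -> b v v != 0 ->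
  exists u l, [/\ S u, forall i, b u (e i) = 0, b u u != 0 &
     forall w, S w -> a u w = l * b u w].
Proof.
move=> [oe ae] Sv ve v0.
pose S' u := S u /\ forall i, b u (e i) = 0.
have S'S u : S' u -> S u by case.
have Se := oe.1.
have Sb' : psd_form S' b.
  split.
  - by split; [exact: form0 Sb|move=> i; rewrite (form0l Sb)].
  - move=> c u w [Su hu] [Sw hw]; split; first exact: formS Sb _ _ _ Su Sw.
    by move=> i; rewrite (formL Sb)// hu hw mulr0 addr0.
  - by move=> u w [Su _] [Sw _]; exact: formC Sb _ _ Su Sw.
  - by move=> c u w z [Su _] [Sw _] [Sz _]; exact: formL Sb _ _ _ _ Su Sw Sz.
  - by move=> u [Su _]; exact: form_ge0 Sb _ Su.
have rM' : form_rank_le S' b M by move=> f Sf; apply: rM => i; exact: (Sf i).1.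
have [m [f [[Sf of_] hf]]] := orthonormal_basis Sb' rM'.
case: m f Sf of_ hf => [|m] f Sf of_ hf.
  have := hf v (conj Sv ve); rewrite big_ord0 subr0 => h.
  by rewrite h eqxx in v0.
pose G : 'M[R]_m.+1 := \matrix_(i, j) a (f i) (f j).
have [l [c [c0 cG]]] : exists (l : R) (v : 'rV[R]_m.+1), v != 0 /\ v *m G = l *: v.
  apply: symmetric_real_eigenvector; apply/matrixP => i j; rewrite !mxE.
  by apply: (formC Sa); apply: S'S.
pose u := \sum_i c 0 i *: f i.
have S'u : S' u by apply: (form_sum Sb').
have SSf i : S (f i) by exact: S'S.
have bu w : S w -> b u w = \sum_i c 0 i * b (f i) w by move=> Sw; rewrite (form_suml Sb).
have au w : S w -> a u w = \sum_i c 0 i * a (f i) w by move=> Sw; rewrite (form_suml Sa).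
have buf j : b u (f j) = c 0 j.
  rewrite bu// (bigD1 j)//= of_ eqxx mulr1 big1 ?addr0// => i ij.
  by rewrite of_ (negbTE ij) mulr0.
have auf j : a u (f j) = l * c 0 j.
  rewrite au//; have := congr1 (fun X : 'rV_m.+1 => X 0 j) cG; rewrite !mxE => <-.
  by apply: eq_bigr => i _; rewrite mxE.
exists u, l; split; [exact: S'u.1|exact: S'u.2| |].
  rewrite bu; last exact: S'u.1.
  apply: contra_neq c0 => h; apply/rowP => i; rewrite mxE.
  move: h; under eq_bigr => j _ do rewrite (formC Sb (SSf j) S'u.1) buf -expr2.
  by move/sum_sqr_eq0.
have inS' w : S' w -> a u w = l * b u w.
  move=> S'w; have Sw := S'w.1.
  pose w' := \sum_i b w (f i) *: f i.
  have Sw' : S w' by exact: (form_sum Sb).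
  have h := hf w S'w; rewrite -/w' in h.
  have Sr : S (w - w') by exact: (formB Sb).
  have := ab0 Sr S'u.1 h; rewrite (formC Sa Sr S'u.1) (formBr Sa)//; last exact: S'u.1.
  move/eqP; rewrite subr_eq0 => /eqP ->.
  have := form_eq0l Sb Sr S'u.1 h; rewrite (formC Sb Sr S'u.1) (formBr Sb)//; last exact: S'u.1.
  move/eqP; rewrite subr_eq0 => /eqP ->.
  rewrite /w' (form_sumr Sa)// ?(form_sumr Sb)//; try exact: S'u.1.
  rewrite mulr_sumr; apply: eq_bigr => i _; rewrite auf buf; ring.
(* From S' to S: w is its residual, which lies in S', plus a combination of the e i, on which a u
   and b u vanish because the e i are eigenvectors orthogonal to u. *)
move=> w Sw; have [Sr re] := form_residual Sb oe Sw.
set w' := \sum_i b w (e i) *: e i in Sr re.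
have Sw' : S w' by exact: (form_sum Sb).
rewrite -(subrK w' w) addrC.
have aw' : a u w' = 0.
  rewrite (form_sumr Sa)//; last exact: S'u.1.
  rewrite big1// => i _; rewrite (formC Sa S'u.1 (Se i)) ae; last exact: S'u.1.
  by rewrite (formC Sb (Se i) S'u.1) S'u.2 !mulr0.
have bw' : b u w' = 0.
  rewrite (form_sumr Sb)//; last exact: S'u.1.
  by rewrite big1// => i _; rewrite S'u.2 mulr0.
have Su := S'u.1; have Sww := formD Sb Sw' Sr.
rewrite (formC Sa Su Sww) (formC Sb Su Sww) (formDl Sa)// (formDl Sb)//.
rewrite (formC Sa Sw' Su) (formC Sb Sw' Su) aw' bw' !add0r.
by rewrite (formC Sa Sr Su) (formC Sb Sr Su) inS'.
Qed.

Lemma eigenbasis : exists n (e : 'I_n -> V) (mu : 'I_n -> R),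
  orthonormal_eigen e mu /\
  forall v, S v -> b (v - \sum_i b v (e i) *: e i) (v - \sum_i b v (e i) *: e i) = 0.
Proof.
pose P n := `[< exists (e : 'I_n -> V) (mu : 'I_n -> R), orthonormal_eigen e mu >].
have P0 : exists n, P n.
  by exists 0%N; apply/asboolP; exists (fun=> 0), (fun=> 0); split; [split|] => -[].
have PM n : P n -> (n <= M)%N.
  by move=> /asboolP[e [mu [oe _]]]; exact: (orthonormal_size Sb oe rM).
case: (ex_maxnP P0 PM) => n /asboolP[e [mu [oe ae]]] nmax.
exists n, e, mu; split => // v Sv; apply/eqP/negPn/negP => h.
have [Sr re] := form_residual Sb oe Sv.
have [u [l [Su ue u0 au]]] := eigenvector_in_orthogonal (conj oe ae) Sr re h.
suff : P n.+1 by move/nmax; rewrite ltnn.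
apply/asboolP; exists (fun i : 'I_n.+1 => if unlift ord0 i is Some j then e j else
     (Num.sqrt (b u u))^-1 *: u), (fun i => if unlift ord0 i is Some j then mu j else l).
split; first exact: (orthonormal_extend Sb).
move=> i w Sw; case: (unliftP ord0 i) => [k _|_]; first exact: ae.
by rewrite (formZl Sa)// (formZl Sb)// au//; ring.
Qed.

End eigenbasis.
End form.

(** * The L2 form and equality almost everywhere *)

Section L2.
Context {R : realType} {d : nat} (Om : set 'rV[R]_d).
Hypothesis mOm : measurable Om.
Local Notation mu := (@lebesgue_rv R d).
Local Notation fct := ('rV[R]_d -> R).
Implicit Types f g h : fct.

Lemma L2_integrable_mul f g : L2 Om f -> L2 Om g ->
  mu.-integrable Om (fun x => (f x * g x)%:E).
Proof.
move=> [mf if2] [mg ig2].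
apply: (@le_integrable _ _ _ _ _ mOm _ (fun x => (f x ^+ 2)%:E + (g x ^+ 2)%:E)%E).
- by apply/measurable_EFinP; exact: measurable_funM.
- move=> x _; rewrite -EFinD !abse_EFin lee_fin normrM [leRHS]ger0_norm ?addr_ge0 ?sqr_ge0//.
  rewrite -(real_normK (num_real (f x))) -(real_normK (num_real (g x))).
  have := sqr_ge0 (`|f x| - `|g x|); have := sqr_ge0 (`|f x| + `|g x|); nra.
- exact: integrableD.
Qed.

Lemma L2_lin a f g : L2 Om f -> L2 Om g -> L2 Om (a *: f + g).
Proof.
move=> L2f L2g; have [mf if2] := L2f; have [mg ig2] := L2g.
split.
  by apply: measurable_funD => //; apply: measurable_funM => //; exact: measurable_cst.
have -> : (fun x => (((a *: f + g) x) ^+ 2)%:E) = (fun x => (a ^+ 2)%:E * (f x ^+ 2)%:E + ((2 * a)%:E * (f x * g x)%:E + (g x ^+ 2)%:E))%E.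
  apply/funext => x; rewrite -!EFinM -!EFinD; congr EFin.
  have -> : (a *: f + g) x = a * f x + g x by [].
  ring.
apply: integrableD => //; first exact: integrableZl.
by apply: integrableD => //; apply: integrableZl => //; exact: L2_integrable_mul.
Qed.

Lemma L2_0 : L2 Om 0.
Proof.
split; first exact: measurable_cst.
under eq_fun do rewrite expr0n/=.
exact: integrable0.
Qed.

Lemma ip_psd : psd_form (L2 Om) (ip Om).
Proof.
split.
- exact: L2_0.
- exact: L2_lin.
- by move=> u v _ _; apply: eq_Rintegral => x _; rewrite mulrC.
- move=> a u v w Lu Lv Lw.
  have iu := L2_integrable_mul Lu Lw; have iv := L2_integrable_mul Lv Lw.
  rewrite /ip -RintegralZl// -RintegralD//; last exact: (integrableZl mOm a iu).
  apply: eq_Rintegral => x _.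
  have -> : (a *: u + v) x = a * u x + v x by [].
  ring.
- by move=> u _; apply: Rintegral_ge0 => x _; rewrite -expr2 sqr_ge0.
Qed.

Lemma ip_eq0 f : L2 Om f -> ip Om f f = 0 -> aeOm Om (fun x => f x = 0).
Proof.
move=> Lf; rewrite /ip /Rintegral => f0.
have iff := L2_integrable_mul Lf Lf.
have : (\int[mu]_(x in Om) `|(f x * f x)%:E| = 0)%E.
  rewrite (eq_integral (fun x => (f x * f x)%:E)).
    by rewrite -[LHS]fineK ?f0//; exact: integrable_fin_num.
  by move=> x _; rewrite gee0_abs// lee_fin -expr2 sqr_ge0.
have mff : measurable_fun Om (fun x => (f x * f x)%:E) by exact: measurable_int iff.
move/(ae_eq_integral_abs mu mOm mff); apply: filterS => x h Ox.
by have /eqP := h Ox; rewrite eqe mulf_eq0 orbb => /eqP.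
Qed.

Lemma ip_ae f g h : L2 Om f -> L2 Om g -> L2 Om h -> aeOm Om (fun x => f x = g x) ->
  ip Om f h = ip Om g h.
Proof.
move=> Lf Lg Lh fg; rewrite /ip /Rintegral; congr fine.
apply: ae_eq_integral => //.
- exact: measurable_int (L2_integrable_mul Lf Lh).
- exact: measurable_int (L2_integrable_mul Lg Lh).
- by move: fg; rewrite /aeOm; apply: filterS => x e Ox; rewrite e.
Qed.

Lemma aeOmD (P Q : 'rV[R]_d -> Prop) : aeOm Om P -> aeOm Om Q -> aeOm Om (fun x => P x /\ Q x).
Proof.
by rewrite /aeOm; apply: filterS2 => x a b Ox; split; [exact: a|exact: b].
Qed.

Lemma aeOmS (P Q : 'rV[R]_d -> Prop) : (forall x, P x -> Q x) -> aeOm Om P -> aeOm Om Q.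
Proof. by move=> PQ; rewrite /aeOm; apply: filterS => x a /a/PQ. Qed.

Lemma ip_ae_eq0 f h : L2 Om f -> L2 Om h -> aeOm Om (fun x => f x = 0) -> ip Om f h = 0.
Proof.
by move=> Lf Lh f0; rewrite (ip_ae Lf L2_0 Lh f0) (form0l ip_psd).
Qed.

Lemma ae_of_ip f g : L2 Om f -> L2 Om g -> ip Om (f - g) (f - g) = 0 ->
  aeOm Om (fun x => f x = g x).
Proof.
move=> Lf Lg /(ip_eq0 (formB ip_psd Lf Lg)); apply: aeOmS => x.
by move/eqP; rewrite subr_eq0 => /eqP.
Qed.

End L2.

(** * Test functions and integration by parts *)

Section test_functions.
Context {R : realType} {d : nat} (Om : set 'rV[R]_d).
Hypothesis oOm : open Om.
Let mOm : measurable Om := open_measurable_rV oOm.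
Local Notation mu := (@lebesgue_rv R d).
Local Notation fct := ('rV[R]_d -> R).
Implicit Types f g h : fct.

Lemma L2_continuous_box B f : continuous f -> (forall v, ~ cbox B v -> f v = 0) -> L2 Om f.
Proof.
move=> cf f0; split; first exact: continuous_measurable_rV.
apply: (integrableS measurableT) => //.
apply: (@integrable_box _ _ B (fun x => f x ^+ 2)).
  have -> : (fun x => f x ^+ 2) = (fun x => f x * f x) by apply/funext => x; rewrite expr2.
  by move=> x; apply: continuousM; exact: cf.
by move=> v /f0 ->; rewrite expr0n.
Qed.

Lemma Rintegral_supp f : (forall x, ~ Om x -> f x = 0) ->
  \int[mu]_(x in Om) f x = \int[mu]_x f x.
Proof.
move=> f0; rewrite Rintegral_mkcond; apply: eq_Rintegral => x _.
by rewrite patchE; case: ifPn => // /negP h; rewrite f0// => /mem_set.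
Qed.

Lemma Rintegral_partial0 B i (F : fct) :
  continuous F -> (forall v, derivable F v (delta_mx 0 i)) ->
  continuous (partial i F) -> (forall v, ~ cbox B v -> F v = 0) ->
  \int[mu]_x partial i F x = 0.
Proof. by move=> cF dF cdF F0; rewrite /Rintegral (@integral_partial _ _ B i F). Qed.

Lemma derive_outside_compact (C : set 'rV[R]_d) f u : compact C ->
  (forall x, ~ C x -> f x = 0) -> forall x, ~ C x -> 'D_u f x = 0.
Proof.
move=> cC f0 v nCv; rewrite (near_eq_derive (g := cst 0)) ?derive_cst//.
have oC : open (~` C).
  by apply: closed_openC; apply: compact_closed; [exact: norm_hausdorff|].
by apply: filterS (open_nbhs_nbhs (conj oC nCv)) => w /= /f0.
Qed.

Lemma test_facts f : test_function Om f -> [/\ continuous f,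
  forall i x, derivable f x (delta_mx 0 i : 'rV[R]_d),
  forall i, continuous (partial i f) &
  exists B, [/\ forall v, ~ cbox B v -> f v = 0, forall x, ~ Om x -> f x = 0,
    forall i v, ~ cbox B v -> partial i f v = 0 &
    forall i x, ~ Om x -> partial i f x = 0]].
Proof.
move=> [sf [C cC [COm f0]]]; split.
- exact: (sf [::]).1.
- by move=> i x; exact: (sf [::]).2.
- by move=> i; exact: (sf [:: i]).1.
have [B CB] := compact_sub_cbox cC; exists B; split.
- by move=> v nB; apply: f0 => /CB.
- by move=> v nB; apply: f0 => /COm.
- by move=> i v nB; apply: (@derive_outside_compact C f (delta_mx 0 i) cC f0 v) => /CB.
- by move=> i v nB; apply: (@derive_outside_compact C f (delta_mx 0 i) cC f0 v) => /COm.
Qed.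

Lemma test_L2 f : test_function Om f -> L2 Om f.
Proof.
by move=> /test_facts[cf _ _ [B [f0 _ _ _]]]; exact: L2_continuous_box cf f0.
Qed.

Lemma test_partial_L2 i f : test_function Om f -> L2 Om (partial i f).
Proof.
by move=> /test_facts[_ _ /(_ i) cf [B [_ _ f0 _]]]; exact: L2_continuous_box cf (f0 i).
Qed.

(** The partial derivative of the product f g of two test functions integrates to zero. *)
Lemma test_weak_partial i f : test_function Om f -> weak_partial Om i f (partial i f).
Proof.
move=> tf g tg.
have [cf df cdf [B [f0 fO pf0 pfO]]] := test_facts tf.
have [cg dg cdg [B' [g0 gO pg0 pgO]]] := test_facts tg.
have pE : partial i (f * g) = (fun x => f x * partial i g x + partial i f x * g x).
  apply/funext => x; rewrite /partial deriveM//.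
  by rewrite [X in _ + X]mulrC.
have cM h k : continuous h -> continuous k -> continuous (fun x => h x * k x : R).
  by move=> ch ck x; apply: continuousM; [exact: ch|exact: ck].
have := @Rintegral_partial0 B i (f * g).
rewrite pE -Rintegral_supp; last by move=> x nO; rewrite fO// pfO// !mul0r addr0.
have i1 := L2_integrable_mul mOm (test_L2 tf) (test_partial_L2 i tg).
have i2 := L2_integrable_mul mOm (test_partial_L2 i tf) (test_L2 tg).
rewrite RintegralD//.
move=> /(_ _ _ _ _)/eqP; rewrite addr_eq0 => h; apply/eqP; apply: h.
- exact: cM.
- by move=> v; apply: derivableM; [exact: df|exact: dg].
- by move=> x; apply: (@continuousD _ _ _ (fun x => f x * partial i g x : R) (fun x => partial i f x * g x));
    apply: cM.
- by move=> v nB; rewrite /GRing.mul/= f0// mul0r.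
Qed.

Lemma test_lin a f g : test_function Om f -> test_function Om g -> test_function Om (a *: f + g).
Proof.
move=> [sf [C cC [CO f0]]] [sg [D cD [DO g0]]]; split; last first.
  exists (C `|` D); first exact: compactU.
  split; first by move=> x [/CO|/DO].
  move=> x /not_orP[nC nD].
  have -> : (a *: f + g) x = a * f x + g x by [].
  by rewrite f0// g0// mulr0 addr0.
have E s : foldr (@partial R d) (a *: f + g) s = a *: foldr (@partial R d) f s + foldr (@partial R d) g s.
  elim: s => //= i s ->; apply/funext => x; rewrite /partial deriveD.
  - by rewrite deriveZ//; exact: (sf s).2.
  - by apply: derivableZ; exact: (sf s).2.
  - exact: (sg s).2.
move=> s; rewrite E; split.
  move=> x; apply: (@continuousD _ _ _ (a *: foldr _ f s) (foldr _ g s)); last exact: (sg s).1.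
  apply: continuousZr; exact: (sf s).1.
move=> i x; apply: derivableD; last exact: (sg s).2.
by apply: derivableZ; exact: (sf s).2.
Qed.

End test_functions.

Lemma sqr_combine_lt (R : realFieldType) (a t x y : R) : x < t ^+ 2 -> y < t ^+ 2 ->
  2 * (a * (a * x)) + 2 * y < (2 * (`|a| + 1)) ^+ 2 * t ^+ 2.
Proof.
move=> xt yt.
have h1 : a ^+ 2 * x <= a ^+ 2 * t ^+ 2 by apply: ler_wpM2l; [exact: sqr_ge0|exact: ltW].
have -> : (2 * (`|a| + 1)) ^+ 2 * t ^+ 2 = 4 * (`|a| ^+ 2 * t ^+ 2) + 8 * (`|a| * t ^+ 2) + 4 * t ^+ 2 by ring.
rewrite (real_normK (num_real a)).
have h2 : 0 <= a ^+ 2 * t ^+ 2 by rewrite mulr_ge0// sqr_ge0.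
have h3 : 0 <= `|a| * t ^+ 2 by rewrite mulr_ge0// sqr_ge0.
have h4 := sqr_ge0 t.
rewrite (_ : a * (a * x) = a ^+ 2 * x); last by ring.
lra.
Qed.

Lemma sqr_sub_bound (R : realFieldType) (x y l g i a b e : R) : 0 <= g -> 0 <= i ->
  x ^+ 2 <= a * g -> y ^+ 2 <= b * i -> a <= e -> b <= e ->
  (x - l * y) ^+ 2 <= (2 * g + 2 * l ^+ 2 * i) * e.
Proof.
move=> g0 i0 hx hy ae be.
have h1 : x ^+ 2 <= e * g by apply: le_trans hx _; exact: ler_wpM2r.
have h2 : y ^+ 2 <= e * i by apply: le_trans hy _; exact: ler_wpM2r.
have h3 := ler_wpM2l (sqr_ge0 l) h2.
have := sqr_ge0 (x + l * y).
lra.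
Qed.

(** * Uniqueness of weak derivatives, H^1_0, and the weak form of the eigenvalue equation *)

Section sobolev.
Context {R : realType} {d : nat} (Om : set 'rV[R]_d).
Hypothesis oOm : open Om.
Let mOm : measurable Om := open_measurable_rV oOm.
Variables (lam : nat -> R) (phi : nat -> 'rV[R]_d -> R).
Hypothesis eig : dirichlet_eigensystem Om lam phi.
Local Notation fct := ('rV[R]_d -> R).
Implicit Types u v f g h : fct.
Let ipP := @ip_psd R d Om mOm.

Lemma grad_ip_ge0 u : 0 <= grad_ip Om u u.
Proof.
by apply: sumr_ge0 => i _; apply: Rintegral_ge0 => x _; rewrite -expr2 sqr_ge0.
Qed.

Lemma ip_ge0 u : 0 <= ip Om u u.
Proof. by apply: Rintegral_ge0 => x _; rewrite -expr2 sqr_ge0. Qed.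

Lemma H1norm_ge_ip u : H1norm Om u ^+ 2 = ip Om u u + grad_ip Om u u.
Proof.
rewrite sqr_sqrtr// addr_ge0 ?sumr_ge0// => [|i _];
  by apply: Rintegral_ge0 => x _; rewrite -expr2 sqr_ge0.
Qed.

Local Opaque ip.

Lemma H1norm_lt u e : 0 < e -> H1norm Om u < e -> ip Om u u + grad_ip Om u u < e ^+ 2.
Proof.
by move=> e0 h; rewrite -H1norm_ge_ip ltr_pXn2r// nnegrE ?sqrtr_ge0// ltW.
Qed.

(** Used to pass to the limit in density arguments: if x were nonzero, e^2 = x^2 / (2 (|K| + 1))
    would give x^2 <= x^2 / 2. *)
Lemma small_sqr_eq0 (x K : R) : (forall e, 0 < e -> x ^+ 2 <= K * e ^+ 2) -> x = 0.
Proof.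
move=> h; apply/eqP; rewrite -sqrf_eq0; apply/negPn/negP => x0.
have x1 : 0 < x ^+ 2 by rewrite lt_neqAle eq_sym x0 sqr_ge0.
have K1 : 0 < `|K| + 1 by rewrite ltr_wpDl.
have q0 : 0 < x ^+ 2 / (2 * (`|K| + 1)) by rewrite divr_gt0// mulr_gt0.
have := h (Num.sqrt (x ^+ 2 / (2 * (`|K| + 1)))).
rewrite sqrtr_gt0 => /(_ q0); rewrite sqr_sqrtr; last exact: ltW.
have : K * (x ^+ 2 / (2 * (`|K| + 1))) <= (`|K| + 1) * (x ^+ 2 / (2 * (`|K| + 1))).
  by rewrite ler_wpM2r// ?(ltW q0)// (le_trans (ler_norm K))// lerDl.
have -> : (`|K| + 1) * (x ^+ 2 / (2 * (`|K| + 1))) = x ^+ 2 / 2 by field; rewrite gt_eqF.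
move=> h1 h2; have := le_trans h2 h1; rewrite leNgt ltr_pdivrMr ?ltr0n// mulr_natr mulr2n ltrDl x1//.
Qed.

Lemma phi_L2 j : L2 Om (phi j).
Proof. by case: eig => /(_ j)[[[]]]. Qed.

Lemma phi_H10 j : H10 Om (phi j).
Proof. by case: eig => /(_ j)[]. Qed.

(** All partial sums of the expansion of v are zero, so the constant sequence [L2norm Om v]
    converges to 0. *)
Lemma orthogonal_phi v : L2 Om v -> (forall j, ip Om v (phi j) = 0) -> ip Om v v = 0.
Proof.
move=> Lv v0; have [_ _ _ /(_ _ Lv)] := eig.
have -> : (fun J => L2norm Om (v \- (fun x => \sum_(j < J) ip Om v (phi j) * phi j x))) =
   cst (L2norm Om v).
  apply/funext => J; congr L2norm; apply/funext => x /=.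
  by rewrite big1 ?subr0// => j _; rewrite v0 mul0r.
move=> h; have : L2norm Om v = 0.
  by apply: (cvg_unique _ (cvg_cst _) h); exact: Rhausdorff.
by move/eqP; rewrite sqrtr_eq0 => h0; apply/eqP; rewrite eq_le h0 ip_ge0.
Qed.

(** Each eigenfunction is an H^1 limit of test functions, so v is orthogonal to all of them and
    completeness applies. *)
Lemma orthogonal_test v : L2 Om v -> (forall f, test_function Om f -> ip Om v f = 0) ->
  ip Om v v = 0.
Proof.
move=> Lv v0; apply: orthogonal_phi => // j.
apply: (@small_sqr_eq0 _ (ip Om v v)) => e e0.
have [f tf fe] := (phi_H10 j).2 e e0.
have Lf := test_L2 oOm tf; have Lp := phi_L2 j.
have -> : ip Om v (phi j) = ip Om v (phi j - f).
  by rewrite (formBr ipP)// (v0 f)// subr0.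
apply: le_trans (form_CauchySchwarz ipP Lv (formB ipP Lp Lf)) _.
rewrite ler_wpM2l ?ip_ge0// ltW//.
have := H1norm_lt e0 fe; apply: le_lt_trans; rewrite lerDl; exact: grad_ip_ge0.
Qed.

Lemma weak_partial_unique i u g h : L2 Om g -> L2 Om h ->
  weak_partial Om i u g -> weak_partial Om i u h -> aeOm Om (fun x => g x = h x).
Proof.
move=> Lg Lh wg wh; apply: ae_of_ip => //; apply: orthogonal_test.
  exact: (formB ipP).
move=> f tf; rewrite (formBl ipP)//; last exact: test_L2.
by have := wg f tf; rewrite (wh f tf) => /oppr_inj ->; rewrite subrr.
Qed.

Lemma wpartialP u i : H1 Om u -> L2 Om (wpartial Om i u) /\ weak_partial Om i u (wpartial Om i u).
Proof.
move=> [_ /(_ i)] ex; exact: (xgetPex (fun=> 0) ex).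
Qed.

(** [wpartial] is a chosen representative; its linearity and its value on test functions hold only
    almost everywhere and are derived from this. *)
Lemma wpartial_ae u i g : H1 Om u -> L2 Om g -> weak_partial Om i u g ->
  aeOm Om (fun x => wpartial Om i u x = g x).
Proof.
move=> /(wpartialP i)[Lw ww] Lg wg; exact: weak_partial_unique ww wg.
Qed.

Lemma H1_L2 u : H1 Om u -> L2 Om u. Proof. by case. Qed.

Lemma weak_partial_lin i a u v g h : L2 Om u -> L2 Om v -> L2 Om g -> L2 Om h ->
  weak_partial Om i u g -> weak_partial Om i v h -> weak_partial Om i (a *: u + v) (a *: g + h).
Proof.
move=> Lu Lv Lg Lh wg wh f tf.
have Lf := test_L2 oOm tf; have Lpf := test_partial_L2 oOm i tf.
by rewrite !(formL ipP)// wg// wh// opprD mulrN.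
Qed.

Lemma H1_lin a u v : H1 Om u -> H1 Om v -> H1 Om (a *: u + v).
Proof.
move=> Hu Hv; split; first by apply: (formS ipP); exact: H1_L2.
move=> i; exists (a *: wpartial Om i u + wpartial Om i v); split.
  by apply: (formS ipP); exact: (wpartialP _ _).1.
have [Lu wu] := wpartialP i Hu; have [Lv wv] := wpartialP i Hv.
by apply: weak_partial_lin => //; exact: H1_L2.
Qed.

Lemma H1_0 : H1 Om 0.
Proof.
split=> [|i]; first exact: L2_0.
exists 0; split; first exact: L2_0.
move=> f tf; rewrite !(form0l ipP) ?oppr0//; first exact: test_L2.
exact: test_partial_L2.
Qed.

Lemma wpartial_lin i a u v : H1 Om u -> H1 Om v ->
  aeOm Om (fun x => wpartial Om i (a *: u + v) x = (a *: wpartial Om i u + wpartial Om i v) x).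
Proof.
move=> Hu Hv.
have [Lu wu] := wpartialP i Hu; have [Lv wv] := wpartialP i Hv.
apply: wpartial_ae; first exact: H1_lin.
  exact: (formS ipP).
by apply: weak_partial_lin => //; exact: H1_L2.
Qed.

Lemma grad_psd : psd_form (H1 Om) (grad_ip Om).
Proof.
split.
- exact: H1_0.
- exact: H1_lin.
- move=> u v Hu Hv; apply: eq_bigr => i _; apply: (formC ipP).
    exact: (wpartialP i Hu).1.
  exact: (wpartialP i Hv).1.
- move=> a u v w Hu Hv Hw; rewrite /grad_ip mulr_sumr -big_split/=.
  apply: eq_bigr => i _.
  have Lu := (wpartialP i Hu).1; have Lv := (wpartialP i Hv).1.
  have Lw := (wpartialP i Hw).1.
  rewrite (ip_ae mOm _ _ _ (wpartial_lin i a Hu Hv))//; first exact: (formL ipP).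
    exact: (wpartialP i (H1_lin a Hu Hv)).1.
  exact: (formS ipP).
- by move=> u _; exact: grad_ip_ge0.
Qed.

Definition H1_ip u v := ip Om u v + grad_ip Om u v.

Lemma H1_ip_psd : psd_form (H1 Om) H1_ip.
Proof.
split.
- exact: H1_0.
- exact: H1_lin.
- move=> u v Hu Hv; rewrite /H1_ip (formC grad_psd)// (formC ipP)//; exact: H1_L2.
- move=> a u v w Hu Hv Hw; rewrite /H1_ip (formL grad_psd)// (formL ipP)//; try exact: H1_L2.
  by rewrite mulrDr addrACA.
- by move=> u _; rewrite addr_ge0 ?ip_ge0 ?grad_ip_ge0.
Qed.

Local Opaque grad_ip H1_ip.

Lemma test_H1 f : test_function Om f -> H1 Om f.
Proof.
move=> tf; split=> [|i]; first exact: test_L2.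
by exists (partial i f); split; [exact: test_partial_L2|exact: test_weak_partial].
Qed.

Lemma wpartial_test i f : test_function Om f ->
  aeOm Om (fun x => wpartial Om i f x = partial i f x).
Proof.
move=> tf; apply: wpartial_ae; [exact: test_H1|exact: test_partial_L2|].
exact: test_weak_partial.
Qed.

Lemma H10_approx u e : H10 Om u -> 0 < e -> exists f, test_function Om f /\
  H1_ip (u - f) (u - f) < e ^+ 2.
Proof.
by move=> [_ h] e0; have [f tf fe] := h e e0; exists f; split=> //; exact: H1norm_lt.
Qed.

Lemma H10_lin a u v : H10 Om u -> H10 Om v -> H10 Om (a *: u + v).
Proof.
move=> H0u H0v; have [Hu _] := H0u; have [Hv _] := H0v.
split; first exact: H1_lin.
move=> e e0.
have e1 : 0 < e / (2 * (`|a| + 1)) by rewrite divr_gt0// mulr_gt0// ltr_wpDl.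
have [f [tf fe]] := H10_approx H0u e1; have [g [tg ge]] := H10_approx H0v e1.
exists (a *: f + g); first exact: test_lin.
have Hf := test_H1 tf; have Hg := test_H1 tg.
have B := H1_ip_psd.
rewrite -(@ltr_pXn2r _ 2)// ?nnegrE ?sqrtr_ge0 ?ltW// H1norm_ge_ip.
have -> : ((a *: u + v) \- (a *: f + g)) = a *: (u - f) + (v - g).
  apply/funext => x /=.
  have -> : (a *: u + v) x = a * u x + v x by [].
  have -> : (a *: f + g) x = a * f x + g x by [].
  have -> : (a *: (u - f) + (v - g)) x = a * (u x - f x) + (v x - g x) by [].
  ring.
have Huf := formB B Hu Hf; have Hvg := formB B Hv Hg.
apply: le_lt_trans (form_sqrD_le B (formZ B a Huf) Hvg) _.
have HZ := formZ B a Huf.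
rewrite (formZl B a Huf HZ) (formC B Huf HZ) (formZl B a Huf Huf).
set t := e / _ in e1 fe ge.
have -> : e ^+ 2 = (2 * (`|a| + 1)) ^+ 2 * t ^+ 2.
  rewrite /t; field; rewrite gt_eqF// ltr_wpDl//.
exact: (sqr_combine_lt a fe ge).
Qed.

Lemma H10_0 : H10 Om 0.
Proof.
split; first exact: H1_0.
(* The witness is the zero function, and the empty set serves as its compact support. *)
move=> e e0; exists (0 *: phi 0%N + 0 - 0).
  split.
    move=> s; have -> : foldr (@partial R d) (0 *: phi 0%N + 0 - 0) s = 0.
      elim: s => /= [|i s ->]; first by rewrite scale0r addr0 subr0.
      by apply/funext => x; exact: derive_cst.
    by split; [exact: cst_continuous|move=> i x; exact: derivable_cst].
  exists set0; first exact: compact0.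
  split; first exact: sub0set.
  by move=> x _; rewrite scale0r addr0 subr0.
have -> : ((0 : fct) \- (0 *: phi 0%N + 0 - 0)) = 0.
  by rewrite scale0r addr0 subr0; apply/funext => x /=; rewrite subr0.
suff : H1norm Om 0 ^+ 2 = 0 by move/eqP; rewrite sqrf_eq0 => /eqP ->.
by rewrite H1norm_ge_ip (form0l ipP (L2_0 Om)) (form0l grad_psd H1_0) addr0.
Qed.

(** Here f is a test function, so the definition of the second weak derivatives of the eigenfunction
    moves one derivative onto it and produces its Laplacian. *)
Lemma grad_ip_test_phi f j : test_function Om f ->
  grad_ip Om f (phi j) = lam j * ip Om f (phi j).
Proof.
move=> tf; have Lf := test_L2 oOm tf.
have [/(_ j)[[Hp Hpp] _] /(_ j) ae _ _] := eig.
have Lpp i := (wpartialP i (Hpp i)).1.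
have -> : grad_ip Om f (phi j) =
   \sum_i (-1) * ip Om (wpartial Om i (wpartial Om i (phi j))) f.
  apply: eq_bigr => i _; have [Lp _] := wpartialP i Hp.
  have Lpf := test_partial_L2 oOm i tf.
  rewrite (ip_ae mOm (wpartialP i (test_H1 tf)).1 Lpf Lp (wpartial_test i tf)).
  rewrite (formC ipP)// (wpartialP i (Hpp i)).2// mulN1r//.
rewrite -(form_suml ipP)// (formC ipP Lf (phi_L2 j)).
rewrite -(formZl ipP)//; last exact: phi_L2.
apply: ip_ae => //.
- exact: (form_sum ipP).
- by apply: (formZ ipP); exact: phi_L2.
- apply: aeOmS ae => x.
  rewrite /laplacian => e; rewrite [RHS](_ : _ = lam j * phi j x)// -e.
  rewrite fct_sumE -sumrN; apply: eq_bigr => i _.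
  by rewrite [LHS](_ : _ = -1 * wpartial Om i (wpartial Om i (phi j)) x)// mulN1r.
Qed.

(** Both sides are continuous in v for the H^1 norm, so the identity passes from test functions to
    H^1_0. *)
Lemma grad_ip_phi v j : H10 Om v -> grad_ip Om v (phi j) = lam j * ip Om v (phi j).
Proof.
move=> H0v; have [Hv _] := H0v; have [Hp _] := phi_H10 j.
apply/eqP; rewrite -subr_eq0; apply/eqP.
apply: (@small_sqr_eq0 _ (2 * grad_ip Om (phi j) (phi j) + 2 * lam j ^+ 2 * ip Om (phi j) (phi j))) => e e0.
have [f [tf fe]] := H10_approx H0v e0.
have Hf := test_H1 tf.
have Hvf := formB grad_psd Hv Hf.
have -> : grad_ip Om v (phi j) - lam j * ip Om v (phi j) =
   grad_ip Om (v - f) (phi j) - lam j * ip Om (v - f) (phi j).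
  rewrite (formBl grad_psd Hv Hf Hp) (formBl ipP (H1_L2 Hv) (H1_L2 Hf) (H1_L2 Hp)).
  by rewrite (grad_ip_test_phi j tf) mulrBr opprB addrA subrK.
have h1 := form_CauchySchwarz grad_psd Hvf Hp.
have h2 := form_CauchySchwarz ipP (H1_L2 Hvf) (H1_L2 Hp).
have g1 : grad_ip Om (v - f) (v - f) <= e ^+ 2.
  by apply: ltW; apply: le_lt_trans fe; rewrite lerDr ip_ge0.
have g2 : ip Om (v - f) (v - f) <= e ^+ 2.
  by apply: ltW; apply: le_lt_trans fe; rewrite lerDl grad_ip_ge0.
by have := sqr_sub_bound (lam j) (grad_ip_ge0 (phi j)) (ip_ge0 (phi j)) h1 h2 g1 g2.

Qed.

End sobolev.

Lemma is_derive_coord (R : realType) d (i : 'I_d) (v : 'rV[R]_d) :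
  is_derive v (delta_mx 0 i) (fun w : 'rV[R]_d => w 0 i) 1.
Proof.
have h : (fun h : R => h^-1 *: (((fun w : 'rV[R]_d => w 0 i) \o shift v) (h *: delta_mx 0 i) - v 0 i)) @ 0^' --> (1 : R).
  apply: cvg_near_cst; near=> h.
  rewrite /= !mxE !eqxx mulr1 addrK /GRing.scale/= mulVf//.
  by near: h; exact: nbhs_dnbhs_neq.
split; first by apply/cvg_ex; exists 1.
exact: cvg_lim h.
Unshelve. all: by end_near. Qed.

Lemma half_absorb (R : realFieldType) (a b c B2 : R) :
  - 1 * b <= 2^-1 * a + 2 * B2 * c -> a + b = 0 -> a <= 4 * B2 * c.
Proof. by move=> h1 h2; rewrite (_ : 4 * B2 * c = 2 * (2 * B2 * c)); [lra|ring]. Qed.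

Lemma le_of_sub_double (R : realFieldType) (x y : R) : 0 <= x - 2 * y + y -> y <= x.
Proof. lra. Qed.

Lemma poincare_limit (R : realFieldType) (K t v g vf gf f df : R) : 0 <= K -> 0 <= g ->
  0 <= vf -> 0 <= gf -> vf + gf < t -> v <= 2 * vf + 2 * f -> df <= 2 * g + 2 * gf ->
  f <= K * df -> v <= (4 * K + 1) * g + (4 * K + 2) * t.
Proof.
move=> K0 g0 vf0 gf0 h1 h2 h3 h4.
have h5 := ler_wpM2l K0 h3.
have h6 : K * gf <= K * t by rewrite ler_wpM2l//; lra.
have h7 : 0 <= K * g by rewrite mulr_ge0.
rewrite (_ : K * (2 * g + 2 * gf) = 2 * (K * g) + 2 * (K * gf)) in h5; last by ring.
rewrite (_ : (4 * K + 1) * g + (4 * K + 2) * t = 4 * (K * g) + g + 4 * (K * t) + 2 * t); last by ring.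
move: (K * g) (K * gf) (K * t) (K * df) h4 h5 h6 h7 => x y z w h4 h5 h6 h7.
lra.
Qed.

(** * Poincare inequality and comparison of the energy with the eigenvalue norms *)

Section energy.
Context {R : realType} {d : nat} (Om : set 'rV[R]_d).
Hypothesis oOm : open Om.
Let mOm : measurable Om := open_measurable_rV oOm.
Variables (lam : nat -> R) (phi : nat -> 'rV[R]_d -> R).
Hypothesis eig : dirichlet_eigensystem Om lam phi.
Local Notation mu := (@lebesgue_rv R d).
Local Notation fct := ('rV[R]_d -> R).
Implicit Types u v f g h : fct.
Let ipP := @ip_psd R d Om mOm.

(* integrate the derivative of x_i f^2 along direction i *)
Lemma poincare_test B (i : 'I_d) f : Om `<=` cbox B -> test_function Om f ->
  ip Om f f <= 4 * B ^+ 2 * ip Om (partial i f) (partial i f).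
Proof.
move=> OB tf; have [cf df cdf [C [f0 fO pf0 pfO]]] := test_facts tf.
pose X : fct := fun w : 'rV[R]_d => w 0 i.
have cX : continuous X by exact: coord_continuous_rV.
pose F : fct := X * (f * f).
have dff (v : 'rV[R]_d) : derivable (f * f : fct) v (delta_mx 0 i) by apply: derivableM; exact: df.
have dX (v : 'rV[R]_d) : derivable X v (delta_mx 0 i) by case: (is_derive_coord i v).
have pE : partial i F = (fun x => f x * f x + 2 * (X x * f x) * partial i f x).
  apply/funext => x; rewrite /partial deriveM// (deriveM (df i x) (df i x)).
  rewrite (@derive_val _ _ _ _ _ _ _ (is_derive_coord i x)).
  rewrite /GRing.scale/= mulr1 [(f * f) x](_ : _ = f x * f x)//.
  set D := 'D__ f x; rewrite /X; ring.
have Lf := test_L2 oOm tf; have Lpf := test_partial_L2 oOm i tf.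
have cM h k : continuous h -> continuous k -> continuous (fun x : 'rV[R]_d => h x * k x : R).
  by move=> ch ck x; apply: continuousM; [exact: ch|exact: ck].
have LXf : L2 Om (fun x => 2 * (X x * f x)).
  apply: (@L2_continuous_box _ _ _ oOm C); last by move=> v nB; rewrite f0// !mulr0.
  by apply: (cM); [exact: cst_continuous|exact: cM].
have iff := L2_integrable_mul mOm Lf Lf.
have iXf := L2_integrable_mul mOm LXf Lpf.
have ipp := L2_integrable_mul mOm Lpf Lpf.
have h0 : \int[mu]_(x in Om) (f x * f x) + \int[mu]_(x in Om) (2 * (X x * f x) * partial i f x) = 0.
  rewrite -RintegralD// Rintegral_supp; last by move=> x nO; rewrite fO// pfO// !mulr0 addr0.
  rewrite -pE; apply: (@Rintegral_partial0 _ _ C).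
  - by apply: (cM) => //; exact: cM.
  - by move=> v; apply: derivableM.
  - rewrite pE => x.
    apply: (@continuousD _ _ _ (fun x => f x * f x : R) (fun x => 2 * (X x * f x) * partial i f x)).
      exact: cM.
    by apply: (cM) => //; apply: (cM); [exact: cst_continuous|exact: cM].
  - by move=> v nB; rewrite /F /GRing.mul/= f0// !mulr0.
have iff2 : mu.-integrable Om (EFin \o (fun x => 2^-1 * (f x * f x))).
  exact: (integrableZl mOm (2^-1) iff).
have ipp2 : mu.-integrable Om (EFin \o (fun x => (2 * B ^+ 2) * (partial i f x * partial i f x))).
  exact: (integrableZl mOm (2 * B ^+ 2) ipp).
have ineg : mu.-integrable Om (EFin \o (fun x => - 1 * (2 * (X x * f x) * partial i f x))).
  exact: (integrableZl mOm (- 1) iXf).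
(* Young's inequality for - 2 x_i f f', with weight 1/2 on f^2 so that this part is absorbed by the
   left-hand side. *)
have h1 : \int[mu]_(x in Om) (- 1 * (2 * (X x * f x) * partial i f x)) <=
  \int[mu]_(x in Om) (2^-1 * (f x * f x) + (2 * B ^+ 2) * (partial i f x * partial i f x)).
  apply: le_Rintegral => //.
    rewrite [X in _.-integrable _ X](_ : _ = (fun x => (2^-1 * (f x * f x))%:E + ((2 * B ^+ 2) * (partial i f x * partial i f x))%:E)%E)//.
    exact: integrableD.
  move=> x Ox.
  have XB : (X x) ^+ 2 <= B ^+ 2.
    have := OB x Ox i; rewrite -/(X x) => XB; rewrite -(real_normK (num_real (X x))).
    by rewrite ler_pXn2r// nnegrE// (le_trans _ XB).
  set p := partial i f x.
  have := sqr_ge0 (f x + 2 * X x * p); have := ler_wpM2r (sqr_ge0 p) XB.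
  set y := X x; set z := f x; rewrite !expr2 => h2 h3.
  have : 0 <= 2^-1 * ((z + 2 * y * p) * (z + 2 * y * p)) + 2 * (B * B * (p * p) - y * y * (p * p)).
    by rewrite addr_ge0// mulr_ge0// subr_ge0.
  lra.
move: h1 h0; rewrite RintegralD// !RintegralZl//; exact: half_absorb.
Qed.

Local Opaque ip.

Lemma ip_partial_le_grad (i : 'I_d) f : test_function Om f ->
  ip Om (partial i f) (partial i f) <= grad_ip Om f f.
Proof.
move=> tf; have [Lw _] := wpartialP i (test_H1 oOm tf).
have Lpf := test_partial_L2 oOm i tf.
have wp := wpartial_test oOm eig i tf.
have -> : ip Om (partial i f) (partial i f) = ip Om (wpartial Om i f) (wpartial Om i f).
  by rewrite (ip_ae mOm Lw Lpf Lw wp) (formC ipP Lpf Lw) (ip_ae mOm Lw Lpf Lpf wp).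
rewrite /grad_ip (bigD1 i) ?lerDl ?sumr_ge0//= => k _; exact: ip_ge0.
Qed.

Local Opaque grad_ip.

Hypothesis d1 : (1 <= d)%N.
Hypothesis bOm : bounded_set Om.

Lemma bounded_sub_cbox : exists B, Om `<=` cbox B.
Proof.
have [M [_ /(_ (M + 1))]] := bOm; rewrite ltrDl ltr01 => /(_ isT) h.
exists (M + 1) => v /h /=; rewrite /Num.norm/= mx_normrE => /bigmax_leP[_ hv] j.
exact: (hv (ord0, j)).
Qed.

Lemma poincare : exists2 C : R, 0 < C & forall v, H10 Om v -> ip Om v v <= C * grad_ip Om v v.
Proof.
have [B OB] := bounded_sub_cbox.
pose i := Ordinal d1.
pose K := 4 * B ^+ 2; have K0 : 0 <= K by rewrite mulr_ge0// sqr_ge0.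
exists (4 * K + 1) => [|v H0v]; first by rewrite ltr_wpDl// mulr_ge0.
have Hv := H0v.1.
apply/ler_addgt0Pr => e e0.
have e1 : 0 < Num.sqrt (e / (4 * K + 2)) by rewrite sqrtr_gt0 divr_gt0// ltr_wpDl// mulr_ge0.
have [f [tf fe]] := H10_approx H0v e1.
have Hf := test_H1 oOm tf.
have G := grad_psd oOm eig.
have Hvf := formB G Hv Hf.
move: fe; rewrite /H1_ip sqr_sqrtr; last by rewrite divr_ge0 ?(ltW e0)// addr_ge0// mulr_ge0.
set t := e / _ => fe.
have et : e = (4 * K + 2) * t by rewrite /t; field; rewrite gt_eqF// ltr_wpDl// mulr_ge0.
have g0 := grad_ip_ge0 Om (v - f); have i0 := ip_ge0 Om (v - f).
have a1 : ip Om v v <= 2 * ip Om (v - f) (v - f) + 2 * ip Om f f.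
  have := form_sqrD_le ipP (H1_L2 Hvf) (H1_L2 Hf); by rewrite subrK.
have a2 : grad_ip Om f f <= 2 * grad_ip Om v v + 2 * grad_ip Om (v - f) (v - f).
  have := form_sqrD_le G Hv (formZ G (- 1) Hvf).
  have -> : v + -1 *: (v - f) = f by rewrite scaleN1r opprB addrC subrK.
  have HZ := formZ G (-1) Hvf.
  rewrite (formZl G (-1) Hvf HZ) (formC G Hvf HZ) (formZl G (-1) Hvf Hvf).
  by rewrite mulrA mulrN1 opprK mul1r.
have a3 : ip Om f f <= K * grad_ip Om f f.
  apply: le_trans (poincare_test i OB tf) _.
  by apply: ler_wpM2l; [exact: K0|exact: ip_partial_le_grad].
rewrite et; exact: poincare_limit K0 (grad_ip_ge0 _ _) i0 g0 fe a1 a2 a3.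
Qed.

Lemma grad_phi_phi j k : grad_ip Om (phi j) (phi k) = lam k * (j == k)%:R.
Proof.
rewrite (grad_ip_phi oOm eig)//; last exact: phi_H10 eig _.
by have [_ _ -> _] := eig.
Qed.

(** The energy of v minus its partial sum is nonnegative, and by [grad_ip_phi] the mixed term equals
    the energy of the partial sum. *)
Lemma H10_bessel J v : H10 Om v ->
  \sum_(j < J) lam j * ip Om v (phi j) ^+ 2 <= grad_ip Om v v.
Proof.
move=> H0v; have Hv := H0v.1; have G := grad_psd oOm eig.
have Hp j : H1 Om (phi j) := (phi_H10 eig j).1.
pose w := \sum_(j < J) ip Om v (phi j) *: phi j.
have Hw : H1 Om w by exact: (form_sum G (fun j : 'I_J => ip Om v (phi j)) (fun j => Hp j)).
have := grad_ip_ge0 Om (v - w); rewrite (form_sqrB G)//.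
have vw : grad_ip Om v w = \sum_(j < J) lam j * ip Om v (phi j) ^+ 2.
  rewrite (form_sumr G (fun j : 'I_J => ip Om v (phi j)) (fun j => Hp j))//.
  by apply: eq_bigr => j _; rewrite (grad_ip_phi oOm eig)//; ring.
have ww : grad_ip Om w w = \sum_(j < J) lam j * ip Om v (phi j) ^+ 2.
  rewrite (form_sumr G (fun j : 'I_J => ip Om v (phi j)) (fun j => Hp j))//.
  apply: eq_bigr => j _.
  rewrite (form_suml G (fun j : 'I_J => ip Om v (phi j)) (fun j => Hp j))//.
  rewrite (bigD1 j)//= grad_phi_phi eqxx mulr1 big1 ?addr0; first by rewrite mulrA mulrC expr2.
  by move=> l lj; rewrite grad_phi_phi [_ == _](negbTE lj) !mulr0.
rewrite vw ww; exact: le_of_sub_double.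
Qed.

Lemma lam_lower : exists2 c : R, 0 < c & forall j, c <= lam j.
Proof.
have [C C0 hC] := poincare; exists C^-1; first by rewrite invr_gt0.
move=> j; have := hC (phi j) (phi_H10 eig j).
rewrite grad_phi_phi eqxx mulr1; have [_ _ -> _] := eig.
by rewrite eqxx => h; rewrite -[_^-1]mul1r ler_pdivrMr// mulrC.
Qed.

Lemma hdot_sqnorm_le (r K : R) v :
  (forall J, \sum_(j < J) lam j `^ r * ip Om v (phi j) ^+ 2 <= K) ->
  (hdot_sqnorm Om lam phi r v <= K%:E)%E.
Proof.
move=> h; apply: lime_le.
  by apply: is_cvg_nneseries => j _ _; rewrite lee_fin mulr_ge0// ?powR_ge0// sqr_ge0.
apply: nearW => J; rewrite big_mkord sumEFin lee_fin; exact: h.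
Qed.

(** Since the eigenvalues are at least c > 0 and r <= 1, lam^r <= c^(r-1) lam, and Bessel's
    inequality applies. With r = - s this makes a functional of index s act on H^1_0. *)
Lemma hdot_fun_H10 (r : R) : 0 < r <= 1 -> exists2 K, 0 < K &
  forall v, H10 Om v -> hdot_fun Om lam phi r v /\
    hdot_fun_norm Om lam phi r v ^+ 2 <= K * grad_ip Om v v.
Proof.
move=> /andP[r0 r1]; have [c c0 hc] := lam_lower.
have l0 j : 0 < lam j by exact: lt_le_trans (hc j).
have K0 : 0 < c `^ (r - 1) by exact: powR_gt0.
exists (c `^ (r - 1)) => // v H0v.
have hs : (hdot_sqnorm Om lam phi r v <= (c `^ (r - 1) * grad_ip Om v v)%:E)%E.
  apply: hdot_sqnorm_le => J.
  apply: (@le_trans _ _ (c `^ (r - 1) * \sum_(j < J) lam j * ip Om v (phi j) ^+ 2)).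
    rewrite mulr_sumr ler_sum// => j _; rewrite mulrA ler_wpM2r ?sqr_ge0//.
    have -> : lam j `^ r = lam j `^ (r - 1) * lam j.
      rewrite -[X in _ * X]powRr1 ?(ltW (l0 j))// -powRD; first by rewrite subrK.
      by rewrite (gt_eqF (l0 j)) implybT.
    rewrite ler_wpM2r ?(ltW (l0 j))//.
    have -> : r - 1 = - (1 - r) by rewrite opprB.
    rewrite !powRN lef_pV2 ?posrE ?powR_gt0//.
    by rewrite ge0_ler_powR// ?nnegrE ?(ltW c0) ?(ltW (l0 j))// subr_ge0.
  by rewrite ler_wpM2l ?(ltW K0)// H10_bessel.
have s0 : (0 <= hdot_sqnorm Om lam phi r v)%E.
  by apply: nneseries_ge0 => j _ _; rewrite lee_fin mulr_ge0// ?powR_ge0// sqr_ge0.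
have sfin : hdot_sqnorm Om lam phi r v \is a fin_num.
  by rewrite ge0_fin_numE//; apply: le_lt_trans hs (ltry _).
split; first by split; [exact: H1_L2 H0v.1|apply: le_lt_trans hs (ltry _)].
rewrite /hdot_fun_norm sqr_sqrtr ?fine_ge0//.
by rewrite -lee_fin fineK.
Qed.

(** One half of Parseval's identity: |v|^2 is the sum of finitely many squared coefficients plus a
    squared remainder that completeness makes smaller than e. *)
Lemma ip_le_hdot0 v : L2 Om v -> (hdot_sqnorm Om lam phi 0 v < +oo)%E ->
  ip Om v v <= hdot_fun_norm Om lam phi 0 v ^+ 2.
Proof.
move=> Lv hfin; have [_ _ oph /(_ _ Lv) cv] := eig.
have s0 : (0 <= hdot_sqnorm Om lam phi 0 v)%E.
  by apply: nneseries_ge0 => j _ _; rewrite lee_fin mulr_ge0// ?powR_ge0// sqr_ge0.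
have sfin : hdot_sqnorm Om lam phi 0 v \is a fin_num by rewrite ge0_fin_numE.
rewrite /hdot_fun_norm sqr_sqrtr ?fine_ge0//.
have part J : \sum_(j < J) ip Om v (phi j) ^+ 2 <= fine (hdot_sqnorm Om lam phi 0 v).
  rewrite -lee_fin fineK// -sumEFin.
  rewrite (eq_bigr (fun j : 'I_J => (lam j `^ 0 * ip Om v (phi j) ^+ 2)%:E)).
    rewrite -(big_mkord xpredT (fun j => (lam j `^ 0 * ip Om v (phi j) ^+ 2)%:E)).
    apply: nneseries_lim_ge => j _; by rewrite lee_fin mulr_ge0// ?powR_ge0// sqr_ge0.
  by move=> j _; rewrite powRr0 mul1r.
apply/ler_addgt0Pr => e e0.
have e1 : 0 < Num.sqrt e by rewrite sqrtr_gt0.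
move/cvgrPdist_lt : cv => /(_ _ e1)[J _ /(_ J (leqnn J))] /=.
rewrite sub0r normrN ger0_norm ?sqrtr_ge0// /L2norm ltr_sqrt// => h.
pose w := \sum_(j < J) ip Om v (phi j) *: phi j.
have Lp j : L2 Om (phi j) := phi_L2 eig j.
have Lw : L2 Om w by exact: (form_sum ipP (fun j : 'I_J => ip Om v (phi j)) (fun j => Lp j)).
have vw : v \- (fun x => \sum_(j < J) ip Om v (phi j) * phi j x) = v - w.
  apply/funext => x /=; rewrite [RHS](_ : _ = v x - w x)// /w fct_sumE.
  by congr (_ - _).
have vwE : ip Om v w = \sum_(j < J) ip Om v (phi j) ^+ 2.
  rewrite (form_sumr ipP (fun j : 'I_J => ip Om v (phi j)) (fun j => Lp j))//.
have wwE : ip Om w w = \sum_(j < J) ip Om v (phi j) ^+ 2.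
  rewrite (form_sumr ipP (fun j : 'I_J => ip Om v (phi j)) (fun j => Lp j))//.
  apply: eq_bigr => j _.
  rewrite (form_suml ipP (fun j : 'I_J => ip Om v (phi j)) (fun j => Lp j))//.
  rewrite (bigD1 j)//= oph eqxx mulr1 big1 ?addr0//.
  by move=> l lj; rewrite oph [_ == _](negbTE lj) mulr0.
move: h; rewrite vw (form_sqrB ipP)// vwE wwE; have := part J; lra.
Qed.

End energy.

(** * Finite elements and discrete operators *)

Lemma convex_polyhedral_open (R : realType) d (Om : set 'rV[R]_d) :
  convex_polyhedral_domain Om -> open Om.
Proof.
move=> [_ _ [p [a [b ->]]]].
have ce (i : 'I_p) : continuous (fun x : 'rV[R]_d => edot (a i) x).
  have -> : (fun x : 'rV[R]_d => edot (a i) x) = \sum_j (fun x : 'rV[R]_d => a i 0 j * x 0 j).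
    by apply/funext => x; rewrite fct_sumE.
  elim/big_ind : _ => [|f g cf cg|j _].
  - exact: cst_continuous.
  - by move=> x; apply: continuousD; [exact: cf|exact: cg].
  - by move=> x; apply: continuousM; [exact: cst_continuous|exact: coord_continuous_rV].
rewrite openE => x /= hx.
have : \forall y \near x, forall i, edot (a i) y < b i.
  apply: (@filter_forall _ _ (fun i => [set y | edot (a i) y < b i]) (nbhs x) _) => i.
  have oi : open ((fun x : 'rV[R]_d => edot (a i) x) @^-1` [set y | y < b i]).
    by apply: open_comp; [move=> y _; exact: ce|exact: open_lt].
  exact: (open_nbhs_nbhs (conj oi (hx i))).
exact.
Qed.

(** * The finite element space: finite rank and discrete eigenbasis *)

Section fe.
Context {R : realType} {d : nat} (Om : set 'rV[R]_d).
Hypothesis oOm : open Om.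
Let mOm : measurable Om := open_measurable_rV oOm.
Variables (lam : nat -> R) (phi : nat -> 'rV[R]_d -> R).
Hypothesis eig : dirichlet_eigensystem Om lam phi.
Local Notation fct := ('rV[R]_d -> R).
Let ipP := @ip_psd R d Om mOm.
Variables (r nK : nat) (K : @mesh R d nK).
Let X := fe_space Om r K.

Lemma fe_H10 v : X v -> H10 Om v. Proof. by case. Qed.

Lemma polynomial_lin a (p q : fct) : polynomial_function r p -> polynomial_function r q ->
  polynomial_function r (a *: p + q).
Proof.
move=> [c hc] [e he]; exists (fun b => a * c b + e b) => x.
rewrite [LHS](_ : _ = a * p x + q x)// hc he mulr_sumr -big_split/=.
by apply: eq_bigr => b _; rewrite mulrDl mulrA.
Qed.

Lemma fe_lin a u v : X u -> X v -> X (a *: u + v).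
Proof.
move=> [Hu pu] [Hv pv]; split; first exact: (H10_lin oOm eig).
move=> k; have [q hq uq] := pu k; have [p hp vp] := pv k.
exists (a *: q + p); first exact: polynomial_lin.
apply: aeOmS (aeOmD uq vp) => x [h1 h2] xk.
by rewrite [LHS](_ : _ = a * u x + v x)// h1// h2.
Qed.

Lemma fe_0 : X 0.
Proof.
split; first exact: (H10_0 oOm eig).
move=> k; exists 0.
  by exists (fun=> 0) => x; rewrite big1// => b _; rewrite mul0r.
by apply: aeW.
Qed.

Lemma fe_ip : psd_form X (ip Om).
Proof.
have XL u : X u -> L2 Om u by move=> Xu; exact: H1_L2 (fe_H10 Xu).1.
split.
- exact: fe_0.
- exact: fe_lin.
- by move=> u v /XL ? /XL ?; exact: (formC ipP).
- by move=> a u v w /XL ? /XL ? /XL ?; exact: (formL ipP).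
- by move=> u _; exact: ip_ge0.
Qed.

Lemma fe_grad : psd_form X (grad_ip Om).
Proof.
have G := grad_psd oOm eig.
have XL u : X u -> H1 Om u by move=> Xu; exact: (fe_H10 Xu).1.
split.
- exact: fe_0.
- exact: fe_lin.
- by move=> u v /XL ? /XL ?; exact: (formC G).
- by move=> a u v w /XL ? /XL ? /XL ?; exact: (formL G).
- by move=> u _; exact: grad_ip_ge0.
Qed.

(** Such a u is a null vector of the L2 form, so 0 is a weak derivative of u, and weak derivatives
    are unique almost everywhere. This is the compatibility [ab0] of [eigenbasis]. *)
Lemma grad_ip_null u v : H1 Om u -> H1 Om v -> ip Om u u = 0 -> grad_ip Om u v = 0.
Proof.
move=> Hu Hv u0; rewrite /grad_ip big1// => i _.
have [Lu wu] := wpartialP i Hu; have [Lv _] := wpartialP i Hv.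
apply: (ip_ae_eq0 mOm Lu Lv).
apply: (weak_partial_unique oOm eig Lu (L2_0 Om) wu) => f tf.
have Lpf := test_partial_L2 oOm i tf; have Lf := test_L2 oOm tf.
by rewrite (form_eq0l ipP (H1_L2 Hu) Lpf u0) (form0l ipP Lf) oppr0.
Qed.

Hypothesis part : partitions K Om.

Local Notation T := ('I_nK * {ffun 'I_d -> 'I_r.+1})%type.

(** Polynomial coefficients on all simplices form a matrix with one more row than columns. A vector
    of its left kernel gives a combination that vanishes almost everywhere on each simplex, hence on
    the domain, which the simplices cover. *)
Lemma fe_rank : form_rank_le X (ip Om) #|{: T}|.
Proof.
move=> e Xe.
have hq i k : exists c : {ffun 'I_d -> 'I_r.+1} -> R,
   aeOm Om (fun x => simplex (K k) x -> e i x =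
     \sum_(b : {ffun 'I_d -> 'I_r.+1} | (\sum_i b i <= r)%N) c b * \prod_i x 0 i ^+ b i).
  have [_ /(_ k)[q [c hc] h]] := Xe i; exists c.
  by apply: aeOmS h => x h xk; rewrite h// hc.
pose c i k := projT1 (cid (hq i k)).
have ce i k : aeOm Om (fun x => simplex (K k) x -> e i x =
     \sum_(b : {ffun 'I_d -> 'I_r.+1} | (\sum_i b i <= r)%N) c i k b * \prod_i x 0 i ^+ b i).
  by rewrite /c; case: cid.
pose A : 'M[R]_(#|{: T}|.+1, #|{: T}|) := \matrix_(i, j) c i (enum_val j).1 (enum_val j).2.
have rA : (\rank A < #|{: T}|.+1)%N by rewrite ltnS; exact: rank_leq_col.
have [v vA v0] : exists2 v : 'rV[R]_(#|{: T}|.+1), v *m A = 0 & v != 0.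
  have : kermx A != 0 by rewrite kermx_eq0 /row_free ltn_eqF.
  case/rowV0Pn => v /sub_kermxP vA v0; by exists v.
exists (v 0).
  by case/rV0Pn: v0 => i vi; exists i.
have key k b : \sum_i v 0 i * c i k b = 0.
  have := congr1 (fun M : 'rV[R]__ => M 0 (enum_rank ((k, b) : T))) vA.
  rewrite !mxE => h; apply: etrans h; apply: eq_bigr => i _; by rewrite mxE enum_rankK.
set w := \sum_i _ *: _.
have Xw : X w by exact: (form_sum fe_ip).
have Lw : L2 Om w by exact: H1_L2 (fe_H10 Xw).1.
apply: (ip_ae_eq0 mOm Lw Lw).
have : aeOm Om (fun x => forall i k, simplex (K k) x -> e i x =
     \sum_(b : {ffun 'I_d -> 'I_r.+1} | (\sum_i b i <= r)%N) c i k b * \prod_i x 0 i ^+ b i).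
  have : {ae lebesgue_rv d, forall x, forall i k, Om x -> simplex (K k) x -> e i x =
     \sum_(b : {ffun 'I_d -> 'I_r.+1} | (\sum_i b i <= r)%N) c i k b * \prod_i x 0 i ^+ b i}.
    by apply: filter_forall => i; apply: filter_forall => k; exact: ce.
  by rewrite /aeOm; apply: filterS => x h Ox i k; exact: h.
have [_ clO _] := part.
rewrite /aeOm; apply: filterS => x h Ox.
have : (\bigcup_k simplex (K k)) x by rewrite -clO; exact: subset_closure.
case=> k _ xk.
rewrite /w fct_sumE (eq_bigr (fun i => \sum_(b : {ffun 'I_d -> 'I_r.+1} | (\sum_i b i <= r)%N)
   v 0 i * c i k b * \prod_i x 0 i ^+ b i)); last first.
  move=> i _; rewrite [LHS](_ : _ = v 0 i * e i x)// (h Ox i k xk) mulr_sumr.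
  by apply: eq_bigr => b _; rewrite mulrA.
rewrite exchange_big/= big1// => b _.
by rewrite -mulr_suml key mul0r.
Qed.

Lemma fe_eigenbasis : exists n (e : 'I_n -> fct) (mu : 'I_n -> R),
  [/\ forall i, X (e i), forall i j, ip Om (e i) (e j) = (i == j)%:R,
   forall i v, X v -> grad_ip Om (e i) v = mu i * ip Om (e i) v &
   forall v, X v -> aeOm Om (fun x => v x = (\sum_i ip Om v (e i) *: e i) x)].
Proof.
have [|n [e [mu [[[Xe oe] ee] he]]]] := eigenbasis fe_ip fe_grad _ fe_rank.
  move=> u v Xu Xv; apply: grad_ip_null; [exact: (fe_H10 Xu).1|exact: (fe_H10 Xv).1].
exists n, e, mu; split=> // v Xv; apply: (ae_of_ip mOm) => //.
- exact: H1_L2 (fe_H10 Xv).1.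
- by apply: (form_sum ipP) => i; exact: H1_L2 (fe_H10 (Xe i)).1.
- exact: he.
Qed.

End fe.

Lemma inv_sqr_cancel (F : fieldType) (g K : F) : g != 0 -> K != 0 ->
  g^-1 * (g^-1 * (g ^+ 2 / K)) = K^-1.
Proof. by move=> g0 K0; field; rewrite ?g0 ?K0. Qed.

Lemma sqr_le_of_scaled (R : realFieldType) (g N x : R) : 0 < g -> 0 <= N ->
  `|g^-1 * x| <= N -> x ^+ 2 <= g ^+ 2 * N ^+ 2.
Proof.
move=> g0 N0; rewrite normrM normfV (gtr0_norm g0) ler_pdivrMl// => h.
by rewrite -exprMn -(real_normK (num_real x)) ler_pXn2r// nnegrE// mulr_ge0// ltW.
Qed.

(** * Action of the initial datum on H^1_0 *)

Section pairing.
Context {R : realType} {d : nat} (Om : set 'rV[R]_d).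
Hypothesis oOm : open Om.
Let mOm : measurable Om := open_measurable_rV oOm.
Variables (lam : nat -> R) (phi : nat -> 'rV[R]_d -> R).
Hypothesis eig : dirichlet_eigensystem Om lam phi.
Hypothesis d1 : (1 <= d)%N.
Hypothesis bOm : bounded_set Om.
Local Notation fct := ('rV[R]_d -> R).
Let ipP := @ip_psd R d Om mOm.
Local Opaque ip grad_ip.

Variable s : R.
Hypothesis s01 : -1 <= s <= 0.

Lemma pairing_lin u0 a v w : hdot Om lam phi s u0 -> H10 Om v -> H10 Om w ->
  pairing Om u0 (a *: v + w) = a * pairing Om u0 v + pairing Om u0 w.
Proof.
move=> + Hv Hw; have Lv := H1_L2 Hv.1; have Lw := H1_L2 Hw.1.
case: u0 => [u|l] /=.
  move=> [s0 [Lu _]]; rewrite (formC ipP Lu (formS ipP a Lv Lw)) (formL ipP a Lv Lw Lu).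
  by rewrite (formC ipP Lv Lu) (formC ipP Lw Lu).
move=> [s0 [hl _]].
have rs : 0 < - s <= 1 by rewrite oppr_gt0 s0/= lerNl; case/andP: s01.
have [K K0 hK] := hdot_fun_H10 oOm eig d1 bOm rs.
by rewrite -(hl a v w (hK v Hv).1 (hK w Hw).1).
Qed.

(** For s = 0, Cauchy-Schwarz and the Poincare inequality; for s < 0, the dual norm tested on a
    multiple of v, with [hdot_fun_H10] to bound the norm of index - s by the energy. *)
Lemma pairing_bound : exists2 K : R, 0 < K & forall u0, hdot Om lam phi s u0 ->
  0 <= hdot_norm Om lam phi s u0 /\ forall v, H10 Om v ->
  pairing Om u0 v ^+ 2 <= K * hdot_norm Om lam phi s u0 ^+ 2 * grad_ip Om v v.
Proof.
case/andP: (s01) => sm1 s0; have [s00|sneq] := eqVneq s 0.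
  have [C C0 hC] := poincare oOm eig d1 bOm.
  exists C => // -[u|l] /=; last by rewrite s00 ltxx => -[].
  rewrite s00 => -[_ [Lu ufin]].
  split=> [|v Hv]; first exact: sqrtr_ge0.
  have Lv := H1_L2 Hv.1.
  apply: le_trans (form_CauchySchwarz ipP Lu Lv) _.
  have h1 := ip_le_hdot0 oOm eig Lu ufin.
  rewrite -mulrA mulrCA mulrA -mulrA.
  apply: ler_pM; [exact: ip_ge0|exact: ip_ge0|exact: h1|exact: hC].
have sn : s < 0 by rewrite lt_neqAle sneq.
have rs : 0 < - s <= 1 by rewrite oppr_gt0 sn/= lerNl.
have [K K0 hK] := hdot_fun_H10 oOm eig d1 bOm rs.
exists K => // -[u|l] /=; first by rewrite leNgt sn => -[].
move=> hl; have [_ [llin [M hM]]] := hl.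
pose A := [set `|l v| | v in [set v | hdot_fun Om lam phi (- s) v /\
  hdot_fun_norm Om lam phi (- s) v <= 1]].
(* The dual norm is a [sup], so boundedness of the set must be shown before it can be used; the sign
   of M is unknown, hence its absolute value. *)
have ubA : has_ubound A.
  exists `|M| => _ [v [hv v1] <-]; apply: le_trans (hM v hv) _.
  apply: le_trans (ler_norm _) _; rewrite normrM (ger0_norm (sqrtr_ge0 _)).
  by apply: ler_piMr.
have N0 : 0 <= hdot_dual_norm Om lam phi (- s) l.
  have A0 : A `|l 0|.
    exists 0 => //; have [h1 h2] := hK 0 (H10_0 oOm eig); split => //.
    rewrite -(@expr_le1 _ 2)// ?sqrtr_ge0//; apply: le_trans h2 _.
    by rewrite (form0l (grad_psd oOm eig) (H1_0 oOm)) mulr0.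
  exact: le_trans (normr_ge0 _) (ub_le_sup ubA A0).
split=> // v Hv; have [hv nv] := hK v Hv.
have [G0|G0] := eqVneq (grad_ip Om v v) 0.
  have : hdot_fun_norm Om lam phi (- s) v = 0.
    apply/eqP; rewrite -sqrf_eq0 eq_le sqr_ge0 andbT.
    by move: nv; rewrite G0 mulr0.
  have := hM v hv => + n0; rewrite n0 mulr0 normr_le0 => /eqP ->.
  by rewrite G0 mulr0 expr0n.
have G1 : 0 < grad_ip Om v v by rewrite lt_neqAle eq_sym G0 grad_ip_ge0.
(* With this g the function v / g has energy 1/K, so its norm of index - s is at most 1. *)
pose g := Num.sqrt (K * grad_ip Om v v).
have g0 : 0 < g by rewrite sqrtr_gt0 mulr_gt0.
have g2 : g ^+ 2 = K * grad_ip Om v v by rewrite sqr_sqrtr// ltW// mulr_gt0.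
have H0 := H10_0 oOm eig.
(* The summand 0 gives the scaled function the shape required by [H10_lin] and [pairing_lin]. *)
have Hgv : H10 Om (g^-1 *: v + 0) by exact: (H10_lin oOm eig).
have gvE : grad_ip Om (g^-1 *: v + 0) (g^-1 *: v + 0) = K^-1.
  have G := grad_psd oOm eig.
  have HZ := formZ G g^-1 Hv.1.
  rewrite addr0 (formZl G g^-1 Hv.1 HZ) (formC G Hv.1 HZ) (formZl G g^-1 Hv.1 Hv.1).
  have -> : grad_ip Om v v = g ^+ 2 / K by rewrite g2 mulrAC divff ?mul1r// gt_eqF.
  by apply: inv_sqr_cancel; rewrite gt_eqF.
have [hgv ngv] := hK _ Hgv.
have n1 : hdot_fun_norm Om lam phi (- s) (g^-1 *: v + 0) <= 1.
  rewrite -(@expr_le1 _ 2)// ?sqrtr_ge0//; apply: le_trans ngv _.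
  by rewrite gvE divff// gt_eqF.
have Agv : A `|l (g^-1 *: v + 0)| by exists (g^-1 *: v + 0).
have := ub_le_sup ubA Agv.
have l0 : l 0 = 0.
  have := @pairing_lin (HdotDual l) 1 0 0 hl H0 H0; rewrite scaler0 addr0 mul1r /=.
  by move/eqP; rewrite -subr_eq subrr => /eqP.
have e := @pairing_lin (HdotDual l) g^-1 v 0 hl Hv H0.
rewrite /= l0 [X in _ = X]addr0 in e.
rewrite e => h; rewrite mulrAC -g2; exact: (sqr_le_of_scaled g0 N0 h).
Qed.

End pairing.

Lemma le_of_sqr (R : realDomainType) (x y : R) : 0 <= x -> 0 <= y -> x ^+ 2 <= y ^+ 2 -> x <= y.
Proof. by move=> x0 y0; rewrite ler_pXn2r ?nnegrE. Qed.

(** * Discrete operators and vector integrals in coordinates of the eigenbasis *)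

Section discrete.
Context {R : realType} {d : nat} (Om : set 'rV[R]_d).
Hypothesis oOm : open Om.
Let mOm : measurable Om := open_measurable_rV oOm.
Local Notation fct := ('rV[R]_d -> R).
Local Notation cfct := ('rV[R]_d -> R[i]).
Let ipP := @ip_psd R d Om mOm.
Local Opaque ip grad_ip.

Variables (X : set fct) (n : nat) (e : 'I_n -> fct) (mu : 'I_n -> R).
Hypothesis XH10 : forall v, X v -> H10 Om v.
Hypothesis Xlin : forall a u v, X u -> X v -> X (a *: u + v).
Hypothesis X0 : X 0.
Hypothesis Xe : forall i, X (e i).
Hypothesis oe : forall i j, ip Om (e i) (e j) = (i == j)%:R.
Hypothesis ee : forall i v, X v -> grad_ip Om (e i) v = mu i * ip Om (e i) v.
Hypothesis Xgrad : psd_form X (grad_ip Om).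
Hypothesis grad_null : forall u v, X u -> X v -> ip Om u u = 0 -> grad_ip Om u v = 0.
Hypothesis span : forall v, X v -> aeOm Om (fun x => v x = (\sum_i ip Om v (e i) *: e i) x).
Hypothesis mu0 : forall i, 0 < mu i.

Lemma XL2 v : X v -> L2 Om v.
Proof. by move=> Xv; exact: H1_L2 (XH10 Xv).1. Qed.
Hint Resolve XL2 : core.

Let Xip : psd_form X (ip Om).
Proof.
split => //.
- by move=> u v /XL2 Lu /XL2 Lv; exact: (formC ipP Lu Lv).
- by move=> a u v w /XL2 Lu /XL2 Lv /XL2 Lw; exact: (formL ipP a Lu Lv Lw).
- by move=> u _; exact: ip_ge0.
Qed.

Lemma X_comb (c : 'I_n -> R) : X (\sum_i c i *: e i).
Proof. exact: (form_sum Xip c Xe). Qed.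

Lemma ip_comb (c : 'I_n -> R) j : ip Om (\sum_i c i *: e i) (e j) = c j.
Proof.
rewrite (form_suml Xip c Xe (Xe j)) (bigD1 j)//= oe eqxx mulr1 big1 ?addr0// => i ij.
by rewrite oe (negbTE ij) mulr0.
Qed.

Lemma coef_ext u v : X u -> X v -> (forall i, ip Om u (e i) = ip Om v (e i)) ->
  aeOm Om (fun x => u x = v x).
Proof.
move=> Xu Xv uv; apply: aeOmS (aeOmD (span Xu) (span Xv)) => x [-> ->].
by congr (_ x); apply: eq_bigr => i _; rewrite uv.
Qed.

Lemma ip_span v w : X v -> L2 Om w -> ip Om v w = \sum_i ip Om v (e i) * ip Om (e i) w.
Proof.
move=> Xv Lw.
rewrite (ip_ae mOm (XL2 Xv) (XL2 (X_comb _)) Lw (span Xv)).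
by rewrite (form_suml ipP _ (fun i => XL2 (Xe i)) Lw).
Qed.

Lemma residual_null v : X v ->
  let r := v - \sum_i ip Om v (e i) *: e i in X r /\ ip Om r r = 0.
Proof.
move=> Xv r; have Xr : X r by exact: (formB Xip Xv (X_comb _)).
split=> //; apply: (ip_ae_eq0 mOm (XL2 Xr) (XL2 Xr)).
apply: aeOmS (span Xv) => x h.
by rewrite [LHS](_ : _ = v x - (\sum_i ip Om v (e i) *: e i) x)// h subrr.
Qed.

Lemma grad_span v w : X v -> X w ->
  grad_ip Om v w = \sum_i ip Om v (e i) * (mu i * ip Om (e i) w).
Proof.
move=> Xv Xw; have [Xr r0] := residual_null Xv.
have := grad_null Xr Xw r0; rewrite (formBl Xgrad Xv (X_comb _) Xw) => /eqP.
rewrite subr_eq0 => /eqP ->; rewrite (form_suml Xgrad _ Xe Xw).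
by apply: eq_bigr => i _; rewrite ee.
Qed.

Lemma grad_comb (c : 'I_n -> R) :
  grad_ip Om (\sum_i c i *: e i) (\sum_i c i *: e i) = \sum_i mu i * c i ^+ 2.
Proof.
rewrite (grad_span (X_comb c) (X_comb c)); apply: eq_bigr => i _.
rewrite (formC Xip (Xe i) (X_comb c)) ip_comb; ring.
Qed.

(** An element of X and its expansion differ by a null vector of the L2 form, which the functional
    must not see. *)
Lemma functional_span (l : fct -> R) v :
  (forall a u v, X u -> X v -> l (a *: u + v) = a * l u + l v) ->
  (forall u, X u -> ip Om u u = 0 -> l u = 0) ->
  X v -> l v = \sum_i ip Om v (e i) * l (e i).
Proof.
move=> llin lnull Xv; have [Xr r0] := residual_null Xv.
have l0 : l 0 = 0 by apply: lnull => //; exact: (form0l Xip X0).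
have lsum k (c : 'I_k -> R) (f : 'I_k -> fct) : (forall i, X (f i)) ->
    l (\sum_i c i *: f i) = \sum_i c i * l (f i).
  elim: k c f => [|k IH] c f Xf; first by rewrite !big_ord0.
  rewrite !big_ord_recl llin//; first by rewrite IH.
  exact: (form_sum Xip _ (fun i => Xf _)).
rewrite -lsum//; apply/eqP; rewrite -subr_eq0.
have XS := X_comb (fun i => ip Om v (e i)).
have := lnull _ Xr r0; rewrite -scaleN1r addrC (llin _ _ _ XS Xv) mulN1r addrC => ->.
by [].
Qed.

(** Serves both [Ph], with l the pairing with the datum, and [Ah], with l the energy against v. The
    explicit expansion shows that the set under [xget] is nonempty, so the chosen element has the
    required pairings. *)
Lemma riesz_coef (l : fct -> R) :
  (forall a u v, X u -> X v -> l (a *: u + v) = a * l u + l v) ->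
  (forall u, X u -> ip Om u u = 0 -> l u = 0) ->
  let w := xget (fun=> 0) [set w | X w /\ forall chi, X chi -> ip Om w chi = l chi] in
  X w /\ forall i, ip Om w (e i) = l (e i).
Proof.
move=> llin lnull w.
have [Xw hw] : [set w | X w /\ forall chi, X chi -> ip Om w chi = l chi] w.
  apply: (@xgetPex _ (fun=> 0)); exists (\sum_i l (e i) *: e i); split; first exact: X_comb.
  move=> chi Xchi; rewrite (functional_span llin lnull Xchi).
  rewrite (form_suml Xip _ Xe Xchi); apply: eq_bigr => i _.
  by rewrite (formC Xip (Xe i) Xchi) mulrC.
by split=> // i; exact: hw.
Qed.

Lemma Ah_coef v : X v -> X (Ah Om X v) /\ forall i, ip Om (Ah Om X v) (e i) = mu i * ip Om v (e i).
Proof.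
move=> Xv; have [] := @riesz_coef (grad_ip Om v).
- move=> a u w Xu Xw; rewrite (formC Xgrad Xv (Xlin _ Xu Xw)) (formL Xgrad _ Xu Xw Xv).
  by rewrite (formC Xgrad Xu Xv) (formC Xgrad Xw Xv).
- by move=> u Xu u0; rewrite (formC Xgrad Xv Xu); exact: grad_null.
move=> XA hA; split=> // i; rewrite [LHS]hA.
by rewrite (formC Xgrad Xv (Xe i)) ee// (formC Xip (Xe i) Xv).
Qed.

Lemma Ah_inv_coef v : X v ->
  X (Ah_inv Om X v) /\ forall i, ip Om (Ah_inv Om X v) (e i) = (mu i)^-1 * ip Om v (e i).
Proof.
move=> Xv.
have [Xw hw] : [set w | X w /\ aeOm Om (fun x => Ah Om X w x = v x)] (Ah_inv Om X v).
  apply: (@xgetPex _ (fun=> 0)); exists (\sum_i ((mu i)^-1 * ip Om v (e i)) *: e i).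
  split; first exact: X_comb.
  have [XA hA] := Ah_coef (X_comb (fun i => (mu i)^-1 * ip Om v (e i))).
  apply: coef_ext => // i; rewrite hA ip_comb mulrA mulfV ?mul1r//.
  by rewrite gt_eqF.
split=> // i; have [XA hA] := Ah_coef Xw.
rewrite -(ip_ae mOm (XL2 XA) (XL2 Xv) (XL2 (Xe i)) hw) hA mulrA mulVf ?mul1r//.
by rewrite gt_eqF.
Qed.

Lemma iter_Ah_inv_coef m v : X v ->
  X (iter m (Ah_inv Om X) v) /\
  forall i, ip Om (iter m (Ah_inv Om X) v) (e i) = (mu i)^-1 ^+ m * ip Om v (e i).
Proof.
move=> Xv; elim: m => [|m [IX IH]]; first by split=> // i; rewrite mul1r.
have [h1 h2] := Ah_inv_coef IX; split=> // i.
by rewrite iterS h2 IH exprS mulrA.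
Qed.

Lemma re_funE (u v : fct) : re_fun (fun x => (u x +i* v x)%C) = u. Proof. by []. Qed.
Lemma im_funE (u v : fct) : im_fun (fun x => (u x +i* v x)%C) = v. Proof. by []. Qed.

Lemma cpairing_comb (z : 'I_n -> R[i]) chi : X chi ->
  cpairing Om (fun x => ((\sum_i complex.Re (z i) *: e i) x +i* (\sum_i complex.Im (z i) *: e i) x)%C) chi
  = \sum_i z i * (ip Om (e i) chi)%:C%C.
Proof.
move=> Xchi; rewrite /cpairing re_funE im_funE !(form_suml Xip _ Xe Xchi).
elim/big_ind3 : _ => //.
  by move=> a b c a' b' c' <- <-.
by move=> i _; case: (z i) => a b; rewrite /GRing.mul/= !mulr0 subr0 add0r.
Qed.

(** A solution is first built from the coefficients (w + mu i)^-1, so that [xget] returns a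
    solution; then the equation is tested with each e i, which determines the coefficients of
    whichever solution was chosen. Real and imaginary parts are treated as two equations in X. *)
Lemma resolvent_coef (w : R[i]) (g : fct) : X g -> (forall i, w + (mu i)%:C%C != 0) ->
  let y := resolvent Om X w (fun x => (g x)%:C%C) in
  XC X y /\ forall i, cpairing Om y (e i) = (w + (mu i)%:C%C)^-1 * (ip Om g (e i))%:C%C.
Proof.
move=> Xg wmu y.
have [[Xr Xi] hy] : [set y | XC X y /\
    aeOm Om (fun x => w * y x + AhC Om X y x = (g x)%:C%C)] y.
  apply: (@xgetPex _ (fun=> 0)).
  pose z i := (w + (mu i)%:C%C)^-1 * (ip Om g (e i))%:C%C.
  pose yr := \sum_i complex.Re (z i) *: e i; pose yi := \sum_i complex.Im (z i) *: e i.
  have Xyr : X yr by exact: X_comb. have Xyi : X yi by exact: X_comb.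
  have [XAr hAr] := Ah_coef Xyr; have [XAi hAi] := Ah_coef Xyi.
  exists (fun x => (yr x +i* yi x)%C); split; first by [].
  have key i : w * z i + (mu i)%:C%C * z i = (ip Om g (e i))%:C%C.
    by rewrite -mulrDl /z mulrA mulfV// mul1r.
  have e1 : aeOm Om (fun x => (complex.Re w *: yr + (- complex.Im w *: yi + Ah Om X yr)) x = g x).
    apply: coef_ext => //; first by do 2?apply: (Xlin).
    move=> i; rewrite !(formL Xip) ?hAr ?ip_comb//; last exact: Xlin.
    have := congr1 (@complex.Re R) (key i); case: (z i) (w) => a b [p q] /= <-.
    by rewrite mul0r subr0 mulNr addrA.
  have e2 : aeOm Om (fun x => (complex.Re w *: yi + (complex.Im w *: yr + Ah Om X yi)) x = (0 : fct) x).
    apply: coef_ext => //; first by do 2?apply: (Xlin).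
    move=> i; rewrite !(formL Xip) ?hAi ?ip_comb ?(form0l Xip)//; last exact: Xlin.
    have := congr1 (@complex.Im R) (key i); case: (z i) (w) => a b [p q] /= <-.
    by rewrite mul0r addr0 addrA.
  apply: aeOmS (aeOmD e1 e2) => x [h1 h2].
  rewrite /AhC re_funE im_funE; case: (w) h1 h2 => p q /= h1 h2.
  apply/eqP; rewrite eq_complex /=; apply/andP; split; apply/eqP.
    rewrite -h1 [RHS](_ : _ = p * yr x + (- q * yi x + Ah Om X yr x))//.
    by rewrite mulNr addrA.
  rewrite -[RHS]h2 [RHS](_ : _ = p * yi x + (q * yr x + Ah Om X yi x))//.
  by rewrite addrA.
clearbody y.
split=> // i; apply: (mulfI (wmu i)); rewrite mulrA mulfV// mul1r.
have [XAr hAr] := Ah_coef Xr; have [XAi hAi] := Ah_coef Xi.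
have e1 : aeOm Om (fun x => (complex.Re w *: re_fun y + (- complex.Im w *: im_fun y + Ah Om X (re_fun y))) x = g x).
  apply: aeOmS hy => x /(congr1 (@complex.Re R)) /= <-.
  rewrite /AhC [LHS](_ : _ = complex.Re w * complex.Re (y x) + (- complex.Im w * complex.Im (y x) + Ah Om X (re_fun y) x))//.
  by case: (w) (y x) => p q [a b] /=; rewrite mulNr addrA.
have e2 : aeOm Om (fun x => (complex.Re w *: im_fun y + (complex.Im w *: re_fun y + Ah Om X (im_fun y))) x = (0 : fct) x).
  apply: aeOmS hy => x /(congr1 (@complex.Im R)) /= h; rewrite [RHS](_ : _ = 0)// -h.
  rewrite /AhC [LHS](_ : _ = complex.Re w * complex.Im (y x) + (complex.Im w * complex.Re (y x) + Ah Om X (im_fun y) x))//.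
  by case: (w) (y x) => p q [a b] /=; rewrite addrA.
have Xe1 := Xlin (complex.Re w) Xr (Xlin (- complex.Im w) Xi XAr).
have Xe2 := Xlin (complex.Re w) Xi (Xlin (complex.Im w) Xr XAi).
have h1 := ip_ae mOm (XL2 Xe1) (XL2 Xg) (XL2 (Xe i)) e1.
have h2 := ip_ae mOm (XL2 Xe2) (XL2 X0) (XL2 (Xe i)) e2.
have f1 := formL Xip (complex.Re w) Xr (Xlin (- complex.Im w) Xi XAr) (Xe i).
have f2 := etrans (formL Xip (- complex.Im w) Xi XAr (Xe i)) (congr1 (fun t => _ + t) (hAr i)).
have f3 := formL Xip (complex.Re w) Xi (Xlin (complex.Im w) Xr XAi) (Xe i).
have f4 := etrans (formL Xip (complex.Im w) Xr XAi (Xe i)) (congr1 (fun t => _ + t) (hAi i)).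
have := etrans (congr1 (fun t => _ + t) (esym f2)) (etrans (esym f1) h1).
have := etrans (congr1 (fun t => _ + t) (esym f4)) (etrans (esym f3) (etrans h2 (form0l Xip (Xe i)))).
clear h1 h2 f1 f2 f3 f4.
rewrite /cpairing => h2 <-; move: h2.
move: (ip Om (re_fun y) (e i)) (ip Om (im_fun y) (e i)) (mu i) => a b r; case: (w) => p q /= h2.
apply/eqP; rewrite eq_complex /=; apply/andP; split; apply/eqP; first by ring.
by rewrite -[RHS]h2; ring.
Qed.

Lemma cpairing_span y chi : XC X y -> X chi ->
  cpairing Om y chi = \sum_i cpairing Om y (e i) * (ip Om (e i) chi)%:C%C.
Proof.
move=> [Xr Xi] Xchi; rewrite /cpairing.
rewrite (ip_span Xr (XL2 Xchi)) (ip_span Xi (XL2 Xchi)).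
elim/big_ind3 : _ => //.
  by move=> a b c a' b' c' <- <-.
by move=> i _; rewrite /GRing.mul/= !mulr0 subr0 add0r.
Qed.

(** The hypothesis exhibits the integral against every chi as the pairing with an explicit element,
    so the set under [xget] is nonempty and its choice has the coefficients J. *)
Lemma contourX_coef theta kappa D (G : R[i] -> cfct) (J : 'I_n -> R[i]) :
  (forall chi, X chi -> contour_integral theta kappa D (fun z => cpairing Om (G z) chi)
     = \sum_i J i * (ip Om (e i) chi)%:C%C) ->
  let U := contour_integralX Om X theta kappa D G in
  XC X U /\ forall i, cpairing Om U (e i) = J i.
Proof.
move=> hJ U.
have [XU hU] : [set U | XC X U /\ forall chi, X chi -> cpairing Om U chi =
    contour_integral theta kappa D (fun z => cpairing Om (G z) chi)] U.
  apply: (@xgetPex _ (fun=> 0)).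
  exists (fun x => ((\sum_i complex.Re (J i) *: e i) x +i* (\sum_i complex.Im (J i) *: e i) x)%C).
  split; first by split; rewrite ?re_funE ?im_funE; exact: X_comb.
  by move=> chi Xchi; rewrite hJ// cpairing_comb.
split=> // i; rewrite hU// hJ// (bigD1 i)//= oe eqxx mulr1 big1 ?addr0// => j ji.
by rewrite oe (negbTE ji) mulr0.
Qed.

Lemma CL2norm_coef y : XC X y ->
  CL2norm Om y ^+ 2 = \sum_i Normc.normc (cpairing Om y (e i)) ^+ 2.
Proof.
move=> [Xr Xi]; rewrite /CL2norm sqr_sqrtr ?addr_ge0 ?ip_ge0//.
rewrite (ip_span Xr (XL2 Xr)) (ip_span Xi (XL2 Xi)) -big_split/=.
apply: eq_bigr => i _; rewrite /Normc.normc /cpairing sqr_sqrtr ?addr_ge0 ?sqr_ge0//.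
by rewrite (formC Xip (Xe i) Xr) (formC Xip (Xe i) Xi) !expr2.
Qed.

Lemma cpairing_diff (p : R[i]) U V : XC X U -> XC X V ->
  let y := fun x => p * U x - p * V x in
  XC X y /\ forall i, cpairing Om y (e i) = p * (cpairing Om U (e i) - cpairing Om V (e i)).
Proof.
move=> [Ur Ui] [Vr Vi] y.
set a := complex.Re p; set b := complex.Im p.
have Er : re_fun y = a *: re_fun U + (- b *: im_fun U + (- a *: re_fun V + b *: im_fun V)).
  apply/funext => x; rewrite [RHS](_ : _ = a * re_fun U x + (- b * im_fun U x + (- a * re_fun V x + b * im_fun V x)))//.
  rewrite /re_fun /im_fun /y /a /b; case: (p) (U x) (V x) => p1 p2 [u1 u2] [v1 v2] /=; ring.
have Ei : im_fun y = a *: im_fun U + (b *: re_fun U + (- a *: im_fun V + - b *: re_fun V)).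
  apply/funext => x; rewrite [RHS](_ : _ = a * im_fun U x + (b * re_fun U x + (- a * im_fun V x + - b * re_fun V x)))//.
  rewrite /re_fun /im_fun /y /a /b; case: (p) (U x) (V x) => p1 p2 [u1 u2] [v1 v2] /=; ring.
have Z1 := formZ Xip b Vi; have Z2 := formZ Xip (- b) Vr.
have L1 := Xlin (- a) Vr Z1; have L2 := Xlin (- a) Vi Z2.
have M1 := Xlin (- b) Ui L1; have M2 := Xlin b Ur L2.
split; first by split; rewrite ?Er ?Ei; exact: Xlin.
move=> i; rewrite /cpairing Er Ei.
rewrite (formL Xip _ Ur M1 (Xe i)) (formL Xip _ Ui L1 (Xe i)) (formL Xip _ Vr Z1 (Xe i)) (formZl Xip _ Vi (Xe i)).
rewrite (formL Xip _ Ui M2 (Xe i)) (formL Xip _ Ur L2 (Xe i)) (formL Xip _ Vi Z2 (Xe i)) (formZl Xip _ Vr (Xe i)).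
rewrite /a /b.
move: (ip Om (re_fun U) (e i)) (ip Om (im_fun U) (e i)) (ip Om (re_fun V) (e i)) (ip Om (im_fun V) (e i)) => u1 u2 v1 v2.
apply/eqP; rewrite eq_complex; apply/andP; case: (p) => p1 p2 /=; split; apply/eqP; ring.
Qed.

Lemma cpairing_scale (c : R[i]) y chi : XC X y -> X chi ->
  cpairing Om (fun x => c * y x) chi = c * cpairing Om y chi.
Proof.
move=> [Xr Xi] Xchi.
have Er : re_fun (fun x => c * y x) = complex.Re c *: re_fun y + (- complex.Im c *: im_fun y).
  apply/funext => x; rewrite [RHS](_ : _ = complex.Re c * re_fun y x + - complex.Im c * im_fun y x)//.
  by rewrite mulNr /re_fun /im_fun cReM.
have Ei : im_fun (fun x => c * y x) = complex.Re c *: im_fun y + (complex.Im c *: re_fun y).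
  apply/funext => x; rewrite [RHS](_ : _ = complex.Re c * im_fun y x + complex.Im c * re_fun y x)//.
  by rewrite /re_fun /im_fun cImM.
have Z1 := formZ Xip (- complex.Im c) Xi; have Z2 := formZ Xip (complex.Im c) Xr.
rewrite /cpairing Er Ei (formL Xip (complex.Re c) Xr Z1 Xchi) (formL Xip (complex.Re c) Xi Z2 Xchi).
rewrite (formZl Xip (- complex.Im c) Xi Xchi) (formZl Xip (complex.Im c) Xr Xchi).
move: (ip Om (re_fun y) chi) (ip Om (im_fun y) chi) => a b.
by apply: complex_ext; rewrite ?cReM ?cImM /= ?mulNr.
Qed.

Section functional.
Variables (l : fct -> R) (M : R).
Hypothesis llin : forall a u v, X u -> X v -> l (a *: u + v) = a * l u + l v.
Hypothesis lM : forall v, X v -> l v ^+ 2 <= M * grad_ip Om v v.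

Lemma functional_null u : X u -> ip Om u u = 0 -> l u = 0.
Proof.
move=> Xu u0; have := lM Xu; rewrite (grad_null Xu Xu u0) mulr0 => h.
by apply/eqP; rewrite -sqrf_eq0 eq_le h sqr_ge0.
Qed.

Lemma dual_sum : 0 <= M -> \sum_i (mu i)^-1 * l (e i) ^+ 2 <= M.
Proof.
move=> M0; pose c i := (mu i)^-1 * l (e i); pose chi := \sum_i c i *: e i.
have Xchi : X chi := X_comb c.
have E1 : l chi = \sum_i (mu i)^-1 * l (e i) ^+ 2.
  rewrite (functional_span llin functional_null Xchi); apply: eq_bigr => i _.
  by rewrite ip_comb /c -mulrA -expr2.
have E2 : grad_ip Om chi chi = \sum_i (mu i)^-1 * l (e i) ^+ 2.
  rewrite grad_comb; apply: eq_bigr => i _; rewrite /c exprMn.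
  have := mu0 i; move: (mu i) (l (e i)) => r x r0; field; exact: lt0r_neq0.
(* The sum S satisfies S^2 <= M S; one divides by S if it is positive. *)
have := lM Xchi; rewrite E1 E2.
have : 0 <= \sum_i (mu i)^-1 * l (e i) ^+ 2.
  by apply: sumr_ge0 => i _; rewrite mulr_ge0 ?sqr_ge0// invr_ge0 ltW.
move: (\sum_i _) => S S0; have [S1|S1] := ltP 0 S; first by rewrite expr2 ler_pM2r.
by move=> _; apply: le_trans S1 M0.
Qed.

(** One factor 1/mu is reserved for [dual_sum]; the remaining 2 m - 1 factors are bounded by 1/c0,
    and m >= 1 ensures that there is one to reserve. *)
Lemma negative_power_sum (c0 : R) (m : nat) : 0 <= M -> (1 <= m)%N -> 0 < c0 -> (forall i, c0 <= mu i) ->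
  \sum_i ((mu i)^-1 ^+ m * l (e i)) ^+ 2 <= c0^-1 ^+ (2 * m).-1 * M.
Proof.
move=> M0 m1 c00 hc; apply: le_trans (ler_wpM2l _ (dual_sum M0)); last first.
  by rewrite exprn_ge0// invr_ge0 ltW.
rewrite mulr_sumr; apply: ler_sum => i _.
have -> : ((mu i)^-1 ^+ m * l (e i)) ^+ 2 = (mu i)^-1 ^+ (2 * m).-1 * ((mu i)^-1 * l (e i) ^+ 2).
  rewrite exprMn -exprM mulrA -exprSr prednK ?muln_gt0//; congr (_ ^+ _ * _); lia.
apply: ler_wpM2r; first by rewrite mulr_ge0 ?sqr_ge0// invr_ge0 ltW.
apply: lerXn2r; rewrite ?nnegrE ?invr_ge0 ?(ltW c00) ?(ltW (mu0 i))//.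
by rewrite lef_pV2 ?posrE ?(mu0 i).
Qed.

End functional.

Variables (alpha beta : R).
Hypothesis a01 : 0 < alpha < 1.

(** The common form of both integrands: W is [step_symbol] for the fully discrete and the identity
    for the semidiscrete solution. *)
Definition symbolX (W : R[i] -> R[i]) (T : R) (g : fct) (z : R[i]) : cfct := fun x =>
  cexp (z * T%:C%C) * cpow (W z) beta * resolvent Om X (cpow (W z) alpha) (fun x => (g x)%:C%C) x.

Lemma cpairing_symbolX W T g z chi : X g -> X chi -> slit (W z) ->
  cpairing Om (symbolX W T g z) chi =
  \sum_i (ip Om g (e i))%:C%C * (ip Om (e i) chi)%:C%C * symbol alpha beta W (mu i) T z.
Proof.
move=> Xg Xchi sW.
have [XR hR] := resolvent_coef Xg (fun i => cpow_add_neq0 a01 (mu0 i) (slit_neq0 sW)).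
rewrite /symbolX (cpairing_scale _ XR Xchi) (cpairing_span XR Xchi) mulr_sumr.
apply: eq_bigr => i _; rewrite hR /symbol /Fsym.
move: (ip Om g (e i))%:C%C (ip Om (e i) chi)%:C%C => a b; ring.
Qed.

Lemma contour_symbolX W T g theta kappa D : X g ->
  contour_integrable theta kappa D (fun=> 0) ->
  (forall i, contour_integrable theta kappa D (symbol alpha beta W (mu i) T)) ->
  (forall t r, t = theta \/ t = - theta -> kappa <= r -> D (r%:C%C * cis t) -> slit (W (r%:C%C * cis t))) ->
  (forall t, - theta <= t <= theta -> D (kappa%:C%C * cis t) -> slit (W (kappa%:C%C * cis t))) ->
  let U := contour_integralX Om X theta kappa D (symbolX W T g) in
  XC X U /\ forall i, cpairing Om U (e i) =
    contour_integral theta kappa D (symbol alpha beta W (mu i) T) * (ip Om g (e i))%:C%C.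
Proof.
move=> Xg i0 iS s1 s2; apply: contourX_coef => chi Xchi.
rewrite (@contour_ext _ _ _ _ _ (fun z => \sum_i (ip Om g (e i))%:C%C * (ip Om (e i) chi)%:C%C * symbol alpha beta W (mu i) T z)).
- rewrite contour_sum//; apply: eq_bigr => i _.
  move: (ip Om g (e i))%:C%C (ip Om (e i) chi)%:C%C => a b; ring.
- by move=> t r ht kr hr; apply: cpairing_symbolX => //; exact: s1.
- by move=> t ht hr; apply: cpairing_symbolX => //; exact: s2.
Qed.

Lemma CL2norm_le (U V : cfct) (p : R[i]) (c : 'I_n -> R[i]) (g : 'I_n -> R) (E G : R) :
  XC X U -> XC X V -> 0 <= E -> 0 <= G ->
  (forall i, cpairing Om U (e i) - cpairing Om V (e i) = c i * (g i)%:C%C) ->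
  (forall i, Normc.normc (c i) <= E) -> \sum_i g i ^+ 2 <= G ^+ 2 ->
  CL2norm Om (fun x => p * U x - p * V x) <= Normc.normc p * E * G.
Proof.
move=> XU XV E0 G0 hc cE gG; have [Xy hy] := cpairing_diff p XU XV.
have N0 : 0 <= Normc.normc p * E * G by rewrite !mulr_ge0// nc_ge0.
apply: (le_of_sqr _ N0); first exact: sqrtr_ge0.
rewrite CL2norm_coef// !exprMn; apply: le_trans (ler_wpM2l _ gG); last first.
  by rewrite mulr_ge0// sqr_ge0.
rewrite mulr_sumr; apply: ler_sum => i _.
rewrite hy hc !Normc.normcM nc_real mulrA !exprMn real_normK ?num_real//.
apply: ler_wpM2r; first exact: sqr_ge0.
apply: ler_wpM2l; first exact: sqr_ge0.
by apply: lerXn2r; rewrite ?nnegrE ?nc_ge0.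
Qed.

End discrete.

(** * Assembly of the L2 error from the scalar errors *)

Theorem theorem3p1 (R : realType) (k : nat) (hk : (1 <= k <= 6)%N) :
  exists theta0 : R, pi / 2 < theta0 < pi /\
  forall (d : nat) (Om : set 'rV[R]_d)
    (lam : nat -> R) (phi : nat -> 'rV[R]_d -> R)
    (m : nat) (alpha s T sigma theta : R),
  (1 <= d)%N ->
  convex_polyhedral_domain Om ->
  dirichlet_eigensystem Om lam phi ->
  (1 <= m)%N ->
  0 < alpha < 1 ->
  -1 <= s <= 0 ->
  0 < T ->
  pi / 2 < theta < theta0 ->
  exists2 c : R, 0 < c &
  forall (nK : nat) (K : mesh nK),
  partitions K Om ->
  shape_regular sigma K ->
  locally_quasi_uniform sigma K ->
  let X := fe_space Om (2 * m + 1) K in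
  forall (N n : nat) (u0 : hdot_elt),
  (1 <= n <= N)%N ->
  hdot Om lam phi s u0 ->
  let tau := T / N%:R in
  let tn := n%:R * tau in
  forall kappa : R,
  0 < kappa <= 1 / tau ->
  CL2norm Om (fun x =>
    fully_discrete_r Om X k m alpha theta kappa tau u0 n x
    - semidiscrete_r Om X m alpha theta kappa u0 tn x)
  <= c * tau ^+ k * tn `^ (- k%:R - m%:R * alpha) * hdot_norm Om lam phi s u0.
Proof.
(* The width 1/2000 is that of [theta_facts]; the same angle works for all six schemes. *)
exists (pi / 2 + 1 / 2000); split.
  by have := @pi_ge2 R; move=> p2; apply/andP; split; lra.
move=> d Om lam phi m alpha s T sigma theta d1 conv eig m1 a01 s01 T0 hth.
have oOm := convex_polyhedral_open conv.
have bOm : bounded_set Om by case: conv.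
pose beta : R := (1 + m)%:R * alpha - 1.
(* With this beta the exponent - (p + 1) of the scalar estimate is the one claimed. *)
have pE : k%:R + beta - alpha + 1 = k%:R + m%:R * alpha by rewrite /beta natrD; ring.
have p0 : 0 <= k%:R + beta - alpha.
  have k1 : 1 <= k%:R :> R by rewrite ler1n; case/andP: hk.
  have : 0 <= m%:R * alpha by rewrite mulr_ge0//; case/andP: a01 => /ltW.
  by move: pE; lra.
have [C0 C00 hC] := poincare oOm eig d1 bOm.
have [Kp Kp0 hKp] := pairing_bound oOm eig d1 bOm s01.
have [Ks Ks0 hKs] := contour_diff hth hk a01 p0.
have c00 : 0 < C0^-1 by rewrite invr_gt0.
(* C0^-1 bounds the discrete eigenvalues from below. The summand 1 gives Q <= Q^2, so Q can replace
   the square root of the constant in [gG]. *)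
pose Q := 1 + C0^-1^-1 ^+ (2 * m).-1 * Kp.
have Q1 : 1 <= Q by rewrite lerDl mulr_ge0 ?(ltW Kp0)// exprn_ge0// invrK ltW.
have Q0 : 0 <= Q by exact: le_trans Q1.
pose P := 1 + Normc.normc (prefactor m : R[i]).
have P0 : 0 < P by apply: (lt_le_trans ltr01); rewrite lerDl nc_ge0.
exists (P * Ks * Q); first by rewrite !mulr_gt0//; exact: lt_le_trans Q1.
move=> nK K part _ _ X N n u0 nN hu0 tau tn kappa hk'.
have N0 : (0 < N)%N by case/andP: nN => n1 nN; exact: leq_trans nN.
have n1 : (1 <= n)%N by case/andP: nN.
have t0 : 0 < tau by rewrite divr_gt0// ltr0n.
(* n >= 1 is what [contour_diff] requires in the form tau <= T. *)
have ttn : tau <= tn by rewrite /tn ler_peMl ?(ltW t0)// ler1n.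
have tn0 : 0 < tn by exact: lt_le_trans ttn.
have [k0 kt] := andP hk'.
have [nE [e [mu [Xe oe ee span]]]] := fe_eigenbasis oOm eig (2 * m + 1) part.
have XH10 : forall v, X v -> H10 Om v by move=> v; exact: fe_H10.
have Xlin : forall a u v, X u -> X v -> X (a *: u + v) by move=> a u v; exact: (fe_lin oOm eig).
have X0 : X 0 by exact: (fe_0 oOm eig).
have Xgrad : psd_form X (grad_ip Om) by exact: (fe_grad oOm eig).
have grad_null u v : X u -> X v -> ip Om u u = 0 -> grad_ip Om u v = 0.
  by move=> /XH10[Hu _] /XH10[Hv _]; exact: (grad_ip_null oOm eig).
have mu_ge i : C0^-1 <= mu i.
  have := hC _ (XH10 _ (Xe i)); rewrite (ee i _ (Xe i)) oe eqxx mulr1 => h.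
  by rewrite -div1r ler_pdivrMr// mulrC.
have mu0 i : 0 < mu i by exact: lt_le_trans (mu_ge i).
pose l := pairing Om u0.
have llin a u v : X u -> X v -> l (a *: u + v) = a * l u + l v.
  by move=> /XH10 Hu /XH10 Hv; exact: (pairing_lin oOm eig d1 bOm s01 a hu0 Hu Hv).
have [H0 hH] := hKp _ hu0.
have lM v : X v -> l v ^+ 2 <= Kp * hdot_norm Om lam phi s u0 ^+ 2 * grad_ip Om v v.
  by move=> /XH10; exact: hH.
have M0 : 0 <= Kp * hdot_norm Om lam phi s u0 ^+ 2 by rewrite mulr_ge0 ?sqr_ge0 ?(ltW Kp0).
have lnull := functional_null grad_null lM.
have [XP hP] := riesz_coef oOm XH10 Xlin X0 Xe span llin lnull.
have [Xg hg] := iter_Ah_inv_coef oOm XH10 Xlin X0 Xe oe ee Xgrad grad_null span mu0 m XP.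
pose g := iter m (Ah_inv Om X) (Ph Om X u0).
have intd r (r0 : 0 < r) := discrete_contour_integrable hth hk beta a01 r0 tn0 t0 k0 kt.
have intc r (r0 : 0 < r) := continuous_contour_integrable hth beta a01 r0 tn0 k0.
have sd t r : t = theta \/ t = - theta -> kappa <= r -> strip (pi / tau) (r%:C%C * cis t) ->
    slit (step_symbol k tau (r%:C%C * cis t)).
  move=> ht kr hr; apply: (slit_step_symbol hk t0); apply: (step_region_ray hth ht t0) hr.
  exact: lt_le_trans kr.
have ktau : kappa * tau <= 2 by move: kt; rewrite ler_pdivlMr// => h; apply: le_trans h _; rewrite ler1n.
have sd' t : - theta <= t <= theta -> strip (pi / tau) (kappa%:C%C * cis t) ->
    slit (step_symbol k tau (kappa%:C%C * cis t)).
  by move=> ht _; apply: (slit_step_symbol hk t0); exact: (step_region_disk hth t0 k0 ktau ht).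
have sc t r : t = theta \/ t = - theta -> kappa <= r -> (setT : set R[i]) (r%:C%C * cis t) ->
    slit (id (r%:C%C * cis t)).
  move=> ht kr _; apply: (slit_polar hth); [exact: lt_le_trans kr|exact: ray_bounds].
have sc' t : - theta <= t <= theta -> (setT : set R[i]) (kappa%:C%C * cis t) ->
    slit (id (kappa%:C%C * cis t)).
  by move=> ht _; exact: (slit_polar hth).
(* Integrability of the zero integrand is taken from the symbol with mu = 1, since the eigenbasis
   may be empty. *)
have [XU hU] := contour_symbolX oOm XH10 Xlin X0 Xe oe ee Xgrad grad_null span mu0 a01 Xg
  (contour_integrable0 (intd _ ltr01)).1 (fun i => intd _ (mu0 i)) sd sd'.
have [XV hV] := contour_symbolX oOm XH10 Xlin X0 Xe oe ee Xgrad grad_null span mu0 a01 Xg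
  (contour_integrable0 (intc _ ltr01)).1 (fun i => intc _ (mu0 i)) sc sc'.
pose c i := contour_integral theta kappa (strip (pi / tau)) (symbol alpha beta (step_symbol k tau) (mu i) tn)
  - contour_integral theta kappa setT (symbol alpha beta id (mu i) tn).
pose E := Ks * tau ^+ k * tn `^ (- (k%:R + beta - alpha + 1)).
have E0 : 0 <= E by rewrite !mulr_ge0 ?powR_ge0 ?exprn_ge0 ?(ltW Ks0) ?(ltW t0).
have cE i : Normc.normc (c i) <= E by exact: hKs.
pose G := Q * hdot_norm Om lam phi s u0.
have G0 : 0 <= G by exact: mulr_ge0.
have gG : \sum_i ip Om g (e i) ^+ 2 <= G ^+ 2.
  have := negative_power_sum oOm XH10 Xlin X0 Xe oe ee Xgrad grad_null span mu0 llin lM M0 m1 c00 mu_ge.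
  rewrite (eq_bigr (fun i => ip Om g (e i) ^+ 2)); last by move=> i _; rewrite hg hP.
  move=> h; apply: le_trans h _; rewrite mulrA exprMn; apply: ler_wpM2r; first exact: sqr_ge0.
  apply: (@le_trans _ _ Q); first by rewrite lerDr.
  by rewrite expr2 ler_peMr.
pose U := contour_integralX Om X theta kappa (strip (pi / tau))
  (symbolX Om X alpha beta (step_symbol k tau) tn g).
pose V := contour_integralX Om X theta kappa setT (symbolX Om X alpha beta id tn g).
have hc i : cpairing Om U (e i) - cpairing Om V (e i) = c i * (ip Om g (e i))%:C%C.
  by rewrite /c mulrBl; congr (_ - _); [exact: hU|exact: hV].
(* The two solutions unfold to [prefactor m] times [U] and [V]. *)
apply: le_trans (CL2norm_le oOm XH10 Xlin X0 Xe span (prefactor m) XU XV E0 G0 hc cE gG) _.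
rewrite /E /G pE opprD.
have e0 : 0 <= Ks * tau ^+ k * tn `^ (- k%:R - m%:R * alpha) * (Q * hdot_norm Om lam phi s u0).
  by move: E0; rewrite /E pE opprD => E0; exact: mulr_ge0.
apply: (@le_trans _ _ (P * (Ks * tau ^+ k * tn `^ (- k%:R - m%:R * alpha) * (Q * hdot_norm Om lam phi s u0)))).
  by rewrite -[leLHS]mulrA; apply: ler_wpM2r => //; rewrite /P lerDr.
move: (hdot_norm Om lam phi s u0) (tn `^ _) (tau ^+ k) => x y z.
by rewrite le_eqVlt; apply/orP; left; apply/eqP; ring.
Qed.
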